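(* Algorithm 2, described in full in the context, solves the reconstruction problem for centered hv-convex polyominoes, and it can be implemented in time $O(m+n)$. That is, given vectors $\mathbf r=(r_1,\dots,r_m)$ and $\mathbf c=(c_1,\dots,c_n)$ of strictly positive integers with $\sum_i r_i=\sum_j c_j$ and $r_k=n$ for some $k$, Algorithm 2 outputs an hv-convex polyomino realization $T$ of $(\mathbf r,\mathbf c)$ if one exists and outputs ''failure'' otherwise; and Algorithm 2 has an implementation running in time $O(m+n)$.
   Context: An object is a set $T$ of cells of the grid $\{1,\dots,m\}\times\{1,\dots,n\}$, where $(i,j)$ is the cell in row $i$ and column $j$; it is identified with an $m\times n$ 0-1 matrix. $T$ is a realization of $(\mathbf r,\mathbf c)$ if $\sum_j T_{i,j}=r_i$ for all $i$ and $\sum_i T_{i,j}=c_j$ for all $j$. $T$ is a polyomino if the graph on the cells of $T$, with $(i,j)$ and $(i',j')$ joined iff $|i-i'|+|j-j'|\le 1$, is connected. $T$ is h-convex if $(i,a),(i,b)\in T$ implies $(i,j)\in T$ for all $a\le j\le b$; v-convexity is the analogous property for columns; hv-convex means both. The centered case is the one where $r_k=n$ for some row $k$ (a row completely filled with cells); fix such a $k$. Representation. An hv-convex realization is represented by a vector $T=(t_1,\dots,t_m)$ with $t_i\in[1,n-r_i+1]$ the smallest $j$ with $(i,j)\in T$; so $(i,j)\in T$ iff $t_i\le j<t_i+r_i$. Vertical convexity is the condition (VC) $t_{i+\delta}\le t_i\le t_{i+\delta}+r_{i+\delta}-r_i$, where $\delta=1$ for $i<k$ and $\delta=-1$ for $i>k$.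 Partial realizations. Let $k\in[p,q]$, $(p,q)\ne(1,m)$, and let $X=(t_p,\dots,t_q)$ with $t_i\in[1,n-r_i+1]$ for each $i$. Put $\mathrm{colsum}_j(X)=|\{i: t_i\le j<t_i+r_i\}|$. Column $j$ is unsaturated if $\mathrm{colsum}_j(X)<c_j$; let $\alpha=\alpha_X$ and $\beta=\beta_X$ be the first and last unsaturated columns. $X$ is a $[p,q]$-realization (partial realization) if (VC) holds for $i=p,\dots,q$ ($i\neq k$), $\min\{t_p,t_q\}\le\alpha\le\beta<\max\{t_p+r_p,t_q+r_q\}$, and $\mathrm{colsum}_j(X)=c_j$ for all $j\notin[\alpha,\beta]$. It is balanced if $\max\{t_p,t_q\}\le\alpha$ and $\beta<\min\{t_p+r_p,t_q+r_q\}$. It is valid if $\mathrm{colsum}_j(X)\le c_j$ for $j=\alpha+1,\dots,\beta-1$. Extensions. Suppose $q=m$ or $r_{p-1}\ge r_{q+1}$ (with $r_0=r_{m+1}=0$). For a $[p,q]$-realization $X$, let $\mathrm{lext}_{p-1}(X)$ and $\mathrm{rext}_{p-1}(X)$ be the extensions of $X$ to row $p-1$ with $t_{p-1}=\alpha_X$ and $t_{p-1}=\beta_X-r_{p-1}+1$, respectively. If $X$ is non-balanced, or balanced and valid, $\mathrm{Ext}_{p-1,q}(X)$ is the set of those vectors among $\mathrm{lext}_{p-1}(X),\mathrm{rext}_{p-1}(X)$ that are $[p-1,q]$-realizations; if $X$ is balanced but not valid, $\mathrm{Ext}_{p-1,q}(X)=\emptyset$. $\mathrm{Ext}_{p,q+1}(X)$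 is defined analogously, extending to row $q+1$, when $p=1$ or $r_{q+1}\ge r_{p-1}$. When the extended range is $[1,m]$, ''$[1,m]$-realization'' is read as ''hv-convex realization of $(\mathbf r,\mathbf c)$''. Algorithm 2. Input: $\mathbf r\in\mathbb N^m$, $\mathbf c\in\mathbb N^n$. Without loss of generality: $r_i\in[1,n]$ for all $i$, $c_j\in[1,m]$ for all $j$, $\sum_i r_i=\sum_j c_j$, and $r_k=n$ for some $k$. 1. Set $t_k\leftarrow1$, $X\leftarrow(t_k)$, $\mathbf P\leftarrow\{X\}$, $(p,q)\leftarrow(k,k)$. 2. While $(p,q)\ne(1,m)$: if $q=m$ or $r_{p-1}\ge r_{q+1}$ then $p\leftarrow p-1$, else $q\leftarrow q+1$. Then, if some $X\in\mathbf P$ is valid and balanced (as a partial realization for the range before this update of $(p,q)$), set $\mathbf P\leftarrow\mathrm{Ext}_{p,q}(X)$ for such an $X$ (new values of $p,q$); else set $\mathbf P\leftarrow\bigcup_{X\in\mathbf P}\mathrm{Ext}_{p,q}(X)$. 3. If $\mathbf P$ contains a realization $T$, output $T$ (as the vector $(t_1,\dots,t_m)$); otherwise output ''failure''. *)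

(* Defs.v *)
From mathcomp Require Import all_boot.

Set Implicit Arguments.
Unset Strict Implicit.
Unset Printing Implicit Defensive.

(* Rows and columns are numbered from 1, and [entry s i] is the i-th entry of
   s with [entry s 0 = entry s (size s).+1 = 0], which realizes the convention
   r_0 = r_{m+1} = 0.  A pair (i, j) : 'I_m * 'I_n is the cell in row i.+1
   and column j.+1 of the grid. *)
Definition entry (s : seq nat) (i : nat) : nat := nth 0 (0 :: s) i.

Section Objects.

Variables m n : nat.
Implicit Type T : {set 'I_m * 'I_n}.

Definition realization (r : m.-tuple nat) (c : n.-tuple nat) T : bool :=
  [forall i, #|[set j | (i, j) \in T]| == tnth r i] &&
  [forall j, #|[set i | (i, j) \in T]| == tnth c j].

Definition h_convex T : bool :=
  [forall i, forall a, forall b, forall j : 'I_n,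
     [&& (i, a) \in T, (i, b) \in T & a <= j <= b] ==> ((i, j) \in T)].

Definition v_convex T : bool :=
  [forall j, forall a, forall b, forall i : 'I_m,
     [&& (a, j) \in T, (b, j) \in T & a <= i <= b] ==> ((i, j) \in T)].

Definition hv_convex T : bool := h_convex T && v_convex T.

(* On nat, (a - b) + (b - a) is |a - b|, since subtraction is truncated. *)
Definition dist (a b : nat) : nat := (a - b) + (b - a).

Definition adjacent (x y : 'I_m * 'I_n) : bool :=
  dist x.1 y.1 + dist x.2 y.2 <= 1.

Definition polyomino T : bool :=
  [forall x in T, forall y in T,
     connect [rel u v | [&& u \in T, v \in T & adjacent u v]] x y].

Definition hv_polyomino_realization (r : m.-tuple nat) (c : n.-tuple nat) T :=
  [&& polyomino T, hv_convex T & realization r c T].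

End Objects.

Section Algorithm.

Variables (m n : nat) (r : m.-tuple nat) (c : n.-tuple nat) (k : nat).

Definition rows (p q : nat) : seq nat := index_iota p q.+1.
Definition columns : seq nat := iota 1 n.

(* The vector (t_p, ..., t_q) is the sequence X = [:: t_p; ...; t_q]. *)
Definition start (p : nat) (X : seq nat) (i : nat) : nat := nth 0 X (i - p).

Definition covers p X i j : bool :=
  start p X i <= j < start p X i + entry r i.

Definition colsum p q X j : nat := count (fun i => covers p X i j) (rows p q).

Definition unsaturated p q X : seq nat :=
  [seq j <- columns | colsum p q X j < entry c j].

(* Both are 0, which is not a column, if every column is saturated. *)
Definition alpha p q X : nat := head 0 (unsaturated p q X).
Definition beta p q X : nat := last 0 (unsaturated p q X).

(* The row i + delta, one step closer to row k. *)
Definition towards (i : nat) : nat := if i < k then i.+1 else i.-1.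

Definition VC p X i : bool :=
  (start p X (towards i) <= start p X i) &&
  (start p X i + entry r i
     <= start p X (towards i) + entry r (towards i)).

(* t_i + r_i <= n + 1 is t_i <= n - r_i + 1, without truncated subtraction. *)
Definition in_range p q X : bool :=
  (size X == q.+1 - p) &&
  all (fun i => (1 <= start p X i) && (start p X i + entry r i <= n.+1))
      (rows p q).

Definition partial_realization p q X : bool :=
  [&& in_range p q X,
      all (fun i => (i != k) ==> VC p X i) (rows p q),
      minn (start p X p) (start p X q) <= alpha p q X,
      alpha p q X <= beta p q X,
      beta p q X < maxn (start p X p + entry r p) (start p X q + entry r q)
    & all (fun j => ~~ (alpha p q X <= j <= beta p q X)
                      ==> (colsum p q X j == entry c j)) columns].

Definition balanced p q X : bool :=
  (maxn (start p X p) (start p X q) <= alpha p q X) &&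
  (beta p q X < minn (start p X p + entry r p) (start p X q + entry r q)).

Definition valid p q X : bool :=
  all (fun j => (alpha p q X < j < beta p q X)
                  ==> (colsum p q X j <= entry c j)) columns.

Definition cells (t : seq nat) : {set 'I_m * 'I_n} :=
  [set x : 'I_m * 'I_n | covers 1 t x.1.+1 x.2.+1].

Definition full_realization (t : seq nat) : bool :=
  [&& in_range 1 m t, hv_convex (cells t) & realization r c (cells t)].

Definition pq_realization p q X : bool :=
  if (p, q) == (1, m) then full_realization X else partial_realization p q X.

(* In the right extensions, truncation turns a start beta - r_i + 1 <= 0 into
   0, and both are rejected by [in_range]. *)
Definition ext_up p q X : seq (seq nat) :=
  if ~~ balanced p q X || valid p q X then
    [seq Y <- [:: alpha p q X :: X;
                  (beta p q X).+1 - entry r p.-1 :: X]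
          | pq_realization p.-1 q Y]
  else [::].

Definition ext_down p q X : seq (seq nat) :=
  if ~~ balanced p q X || valid p q X then
    [seq Y <- [:: rcons X (alpha p q X);
                  rcons X ((beta p q X).+1 - entry r q.+1)]
          | pq_realization p q.+1 Y]
  else [::].

(* [pick] resolves the free choices of the algorithm.  The vectors present at
   two different moments of choice have different lengths, so the choice
   functions account for all its executions. *)
Variable pick : seq (seq nat) -> seq nat.

Definition state : Type := nat * nat * seq (seq nat).

Definition loop_body (s : state) : state :=
  let: (p, q, P) := s in
  let up := (q == m) || (entry r q.+1 <= entry r p.-1) in
  let ext X := if up then ext_up p q X else ext_down p q X in
  let good := [seq X <- P | valid p q X && balanced p q X] in
  let P' := if good is [::] then flatten [seq ext X | X <- P]
            else ext (pick good) in
  if up then (p.-1, q, P') else (p, q.+1, P').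

(* Every pass enlarges [p, q], of size 1 at first and at most m, by one row:
   m passes exhaust the while loop. *)
Fixpoint loop (passes : nat) (s : state) : state :=
  if passes is N.+1 then
    if s.1 == (1, m) then s else loop N (loop_body s)
  else s.

Definition algorithm2 : option (seq nat) :=
  let P := (loop m (k, k, [:: [:: 1]])).2 in
  let sols := [seq t <- P | full_realization t] in
  if sols is [::] then None else Some (pick sols).

End Algorithm.

Definition choice_function (pick : seq (seq nat) -> seq nat) : Prop :=
  forall s, s != [::] -> pick s \in s.

Definition reconstruction_input m n (r : m.-tuple nat) (c : n.-tuple nat) :=
  [/\ forall i, 0 < tnth r i, forall j, 0 < tnth c j
    & \sum_(i < m) tnth r i = \sum_(j < n) tnth c j].

Definition full_row m (n : nat) (r : m.-tuple nat) (k : nat) : Prop :=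
  1 <= k <= m /\ entry r k = n.

(* Running time: programs of a unit-cost random access machine, in structured
   form.  The memory consists of arrays of natural numbers with literal names.
   A program mentions finitely many of them, say K, so this is a flat memory
   with cell i of array a at address K * i + a.  Operations are those of the
   standard machine: constants, indirect load and store, addition, truncated
   subtraction and comparison.  Assignments, skips and evaluations of a guard
   cost 1; the expressions of a fixed program have bounded size. *)
Definition memory := nat -> nat -> nat.

Inductive expr : Type :=
| Const of nat
| Fetch of nat & expr
| Plus of expr & expr
| Minus of expr & expr.

Inductive guard : Type :=
| Leq of expr & expr
| Neg of guard
| And of guard & guard.

Inductive program : Type :=
| Skip
| Store of nat & expr & expr
| Seq of program & program
| If of guard & program & program
| While of guard & program.

Fixpoint eval (M : memory) (e : expr) : nat :=
  match e with
  | Const v => v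
  | Fetch a e1 => M a (eval M e1)
  | Plus e1 e2 => eval M e1 + eval M e2
  | Minus e1 e2 => eval M e1 - eval M e2
  end.

Fixpoint holds (M : memory) (g : guard) : bool :=
  match g with
  | Leq e1 e2 => eval M e1 <= eval M e2
  | Neg g1 => ~~ holds M g1
  | And g1 g2 => holds M g1 && holds M g2
  end.

Definition update (M : memory) (a i v : nat) : memory :=
  fun b j => if (b == a) && (j == i) then v else M b j.

(* [exec S M t M']: from memory M, S halts after t steps in memory M'. *)
Inductive exec : program -> memory -> nat -> memory -> Prop :=
| exec_skip M : exec Skip M 1 M
| exec_store M a e1 e2 :
    exec (Store a e1 e2) M 1 (update M a (eval M e1) (eval M e2))
| exec_seq S1 S2 M M1 M2 t1 t2 :
    exec S1 M t1 M1 -> exec S2 M1 t2 M2 -> exec (Seq S1 S2) M (t1 + t2) M2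
| exec_if g S1 S2 M M1 t :
    exec (if holds M g then S1 else S2) M t M1 -> exec (If g S1 S2) M t.+1 M1
| exec_while_end g S M : ~~ holds M g -> exec (While g S) M 1 M
| exec_while_pass g S M M1 M2 t1 t2 :
    holds M g -> exec S M t1 M1 -> exec (While g S) M1 t2 M2 ->
    exec (While g S) M (t1 + t2).+1 M2.

(* Input: m and n in cells 0 and 1 of array 0, r_i in cell i of array 1, c_j in
   cell j of array 2; everything else is 0.  The row k is not given. *)
Definition input_memory (m n : nat) (r c : seq nat) : memory := fun a i =>
  match a with
  | 0 => nth 0 [:: m; n] i
  | 1 => entry r i
  | 2 => entry c i
  | _ => 0
  end.

(* Output: failure iff cell 0 of array 3 is 0; otherwise t_i is in cell i of
   array 4. *)
Definition output_of (m : nat) (M : memory) : option (seq nat) :=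
  if M 3 0 == 0 then None else Some [seq M 4 i | i <- iota 1 m].

(* Main.v *)
(** A realization amounts to a vector t whose rows, seen as intervals of columns,
    are nested towards the full row k.  Two facts drive everything.
    First, the columns that a solution t leaves unsaturated on the rows p, ..., q
    are those covered by its remaining rows, and these lie inside row p-1 or
    inside row q+1; so the longer of these two rows touches the first or the
    last unsaturated column: t is obtained by extensions to the left or right.
    Second, if X is balanced then every row of X covers [alpha, beta] and all
    other columns are saturated, so X covers each column at least as often as
    the rows p, ..., q of t do; as both cover equally many cells, they cover
    every column equally often.  Hence the remaining rows of t complete X, and
    t restricted to p, ..., q is balanced and valid itself.

    The second fact makes the choices of Algorithm 2 harmless, and it also shows
    that every solution is the output of Algorithm 2 for suitable choices.  So
    an implementation may compute any solution.  In linear time this is done with two vectors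
    in parallel: one starts the rows above k at the first unsaturated column and
    ends the rows below k at the last one, the other does the opposite.  Between
    two balanced stages these placements are forced, and when one run becomes
    balanced both are restarted from it.  Only the multiplicities of the two
    extreme unsaturated columns are needed; they are read off counters that move
    monotonically, up to an amount paid for by the rows added. *)
Require Import Defs.
From mathcomp Require Import all_boot zify.

Set Implicit Arguments.
Unset Strict Implicit.
Unset Printing Implicit Defensive.

(** * Vectors and sets of cells *)

(** Two runs suffice because the next row has a real choice of ends only in a balanced stage;
    [next_row] shows by nestedness and a comparison of lengths that otherwise one end is impossible.
    At a balanced stage the two runs try one end each, and the next balanced run may replace the
    other without loss, since by the second fact it can be completed whenever any solution exists.
    The rows below k are measured from the right and the second run is stored reflected. Reversing
    the columns, with or without exchanging the two groups of rows, then reduces all four ends of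
    the two runs to a single one. The obstacle to linear time is the restart: it overwrites the
    pointers of a run that may have failed long ago, and must not move them back. Hence the
    invariant [low], which involves only the number of rows placed and survives failure, and the
    strict inequalities in [ripe], which compare the demand of the columns at the pointers with that
    same number. *)

Lemma mem_rows p q i : (i \in rows p q) = (p <= i <= q).
Proof. by rewrite /rows mem_index_iota ltnS. Qed.

Lemma mem_columns n j : (j \in columns n) = (1 <= j <= n).
Proof. by rewrite /columns mem_iota add1n ltnS. Qed.

Lemma card_ord_count n (P : pred nat) :
  #|[set j : 'I_n | P j.+1]| = count P (iota 1 n).
Proof.
rewrite cardsE cardE size_filter -[iota 1 n]/(iota (1 + 0) n) iotaDl count_map.
by rewrite -val_enum_ord count_map enumT.
Qed.

Lemma count_interval n t l :
  1 <= t -> t + l <= n.+1 -> count (fun j => t <= j < t + l) (iota 1 n) = l.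
Proof.
elim: n t l => [|n IHn] t l t1 tl; first by move: t1 tl; case: l => //; lia.
have -> : iota 1 n.+1 = iota 1 n ++ [:: n.+1] by rewrite -(iotaD 1 n 1) addn1.
rewrite count_cat /= addn0.
have [tn | tn] := leqP (t + l) n.+1.
  by rewrite IHn //; lia.
case: l tl tn => [|l] tl tn.
  by rewrite (@eq_count _ _ pred0) ?count_pred0 => [|j] /=; lia.
rewrite (@eq_in_count _ _ (fun j => t <= j < t + l)) => [|j]; last by rewrite mem_iota; lia.
by rewrite IHn; lia.
Qed.

Lemma count_sum (T : Type) (P : pred T) s : count P s = \sum_(i <- s) P i.
Proof. by rewrite -sum1_count big_mkcond; apply: eq_bigr => i _; case: (P i). Qed.

Lemma sum_coverage n (t l : nat -> nat) (s : seq nat) :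
  {in s, forall i, 1 <= t i /\ t i + l i <= n.+1} ->
  \sum_(j <- columns n) count (fun i => t i <= j < t i + l i) s
    = \sum_(i <- s) l i.
Proof.
move=> ts; under eq_bigr do rewrite count_sum.
rewrite exchange_big; apply: eq_big_seq => i /ts [t1 tl] /=.
by rewrite -count_sum count_interval.
Qed.

Lemma eq_sum_leq (s : seq nat) (f g : nat -> nat) :
  {in s, forall j, f j <= g j} -> \sum_(j <- s) f j = \sum_(j <- s) g j ->
  {in s, forall j, f j = g j}.
Proof.
elim: s => [//|j s IHs] fg; rewrite !big_cons => e i.
have le_s : \sum_(j <- s) f j <= \sum_(j <- s) g j.
  by rewrite big_seq [leqRHS]big_seq; apply: leq_sum => h hs; rewrite fg // inE hs orbT.
have le_j := fg j (mem_head _ _).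
rewrite inE => /orP [/eqP ->|]; first lia.
by apply: IHs => [h hs|]; [rewrite fg // inE hs orbT | lia].
Qed.

Lemma convex_interval n (S : {set 'I_n}) :
  S != set0 ->
  (forall a b j : 'I_n, a \in S -> b \in S -> a <= j <= b -> j \in S) ->
  exists t, [/\ 1 <= t, t + #|S| <= n.+1
              & forall j : 'I_n, (j \in S) = (t <= j.+1 < t + #|S|)].
Proof.
case/set0Pn => x0 xS convS.
case: (arg_minnP (fun i : 'I_n => val i) xS) => a aS mina.
case: (arg_maxnP (fun i : 'I_n => val i) xS) => b bS maxb.
have ab : a <= b by exact: mina.
have memS (j : 'I_n) : (j \in S) = (a.+1 <= j.+1 < a.+1 + (b.+1 - a)).
  apply/idP/idP => [jS | jab]; first by have := mina j jS; have := maxb j jS; rewrite /=; lia.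
  by apply: (convS a b) => //; lia.
have cardS : #|S| = b.+1 - a.
  have -> : S = [set j : 'I_n | a.+1 <= j.+1 < a.+1 + (b.+1 - a)].
    by apply/setP => j; rewrite inE memS.
  rewrite (card_ord_count _ (fun j => a.+1 <= j < a.+1 + (b.+1 - a))).
  by rewrite count_interval //; have := ltn_ord b; lia.
by exists a.+1; rewrite cardS; split => //; have := ltn_ord b; lia.
Qed.

Section Geometry.

Variables (m n : nat) (r : m.-tuple nat) (c : n.-tuple nat) (k : nat).
Hypothesis rc : reconstruction_input r c.
Hypothesis rk : full_row n r k.

Lemma entry_tnth l (s : l.-tuple nat) (i : 'I_l) : entry s i.+1 = tnth s i.
Proof. by rewrite /entry /= (tnth_nth 0). Qed.

Lemma entry_gt0 i : 1 <= i <= m -> 0 < entry r i.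
Proof.
case: rc => r0 _ _; case: i => [//|i] /andP [_ im].
by rewrite (entry_tnth r (Ordinal im)).
Qed.

Definition nested (t : nat -> nat) (i j : nat) : Prop :=
  t j <= t i /\ t i + entry r i <= t j + entry r j.

Definition covered (t : nat -> nat) (p q j : nat) : nat :=
  count (fun i => t i <= j < t i + entry r i) (rows p q).

(** A function of the row number rather than a sequence, so that restricting it to a window of rows
    shifts no index. *)
Definition solution (t : nat -> nat) : Prop :=
  [/\ forall i, 1 <= i <= m -> 1 <= t i /\ t i + entry r i <= n.+1,
      forall i, 1 <= i <= m -> i != k -> nested t i (towards k i)
    & forall j, 1 <= j <= n -> covered t 1 m j = entry c j].

Lemma nested_trans t : forall i h j, nested t i h -> nested t h j -> nested t i j.
Proof. by move=> i h j; rewrite /nested; lia. Qed.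

Lemma nested_below t p q i j :
  (forall i, p <= i <= q -> i != k -> nested t i (towards k i)) ->
  p <= i -> i <= j -> j <= k -> k <= q -> nested t i j.
Proof.
move=> nt pi ij jk kq; rewrite -(subnKC ij).
have : i + (j - i) <= k by lia.
elim: (j - i) => [|d IHd] ijk; first by rewrite addn0; split.
apply: nested_trans (IHd _) _; first lia.
have := nt (i + d); rewrite /towards ifT ?addnS; first by apply; lia.
lia.
Qed.

Lemma nested_above t p q i j :
  (forall i, p <= i <= q -> i != k -> nested t i (towards k i)) ->
  p <= k -> k <= j -> j <= i -> i <= q -> nested t i j.
Proof.
move=> nt pk kj ji iq; rewrite -(subnKC ji).
have : j + (i - j) <= q by lia.
elim: (i - j) => [|d IHd] ijk; first by rewrite addn0; split.
apply: nested_trans (IHd _); last lia.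
have := nt (j + d.+1); rewrite /towards ifF ?addnS /=; last by lia.
by apply; lia.
Qed.

Definition vec (t : nat -> nat) p q : seq nat := [seq t i | i <- rows p q].

Lemma size_vec t p q : size (vec t p q) = q.+1 - p.
Proof. by rewrite size_map size_iota. Qed.

Lemma start_vec t p q i : p <= i <= q -> start p (vec t p q) i = t i.
Proof.
move=> pq; rewrite /start /vec (nth_map 0) ?size_iota; last lia.
by rewrite nth_iota; [congr t; lia | lia].
Qed.

Lemma vec_start p q X : size X = q.+1 - p -> vec (start p X) p q = X.
Proof.
move=> sX; apply: (@eq_from_nth _ 0); rewrite size_vec // => i ipq.
rewrite (nth_map 0) ?size_iota // nth_iota // /start.
by congr nth; lia.
Qed.

Lemma eq_covered t u p q j :
  (forall i, p <= i <= q -> t i = u i) -> covered t p q j = covered u p q j.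
Proof. by move=> tu; apply: eq_in_count => i; rewrite mem_rows => /tu ->. Qed.

Lemma full_realization_solution t :
  solution t -> full_realization r c (vec t 1 m).
Proof.
move=> [t_in t_nest t_cov].
have mem_cells (i : 'I_m) (j : 'I_n) : ((i, j) \in cells n r (vec t 1 m)) =
    (t i.+1 <= j.+1 < t i.+1 + entry r i.+1).
  by rewrite inE /covers /= start_vec //= ltn_ord.
have [k1m _] := rk.
apply/and3P; split.
- rewrite /in_range size_vec subn1 /= eqxx /=.
  apply/allP => i; rewrite mem_rows => im; rewrite start_vec //.
  by apply/andP; apply: t_in.
- apply/andP; split.
    apply/forallP => i; apply/forallP => a; apply/forallP => b; apply/forallP => j.
    by apply/implyP => /and3P []; rewrite !mem_cells; lia.
  apply/forallP => j; apply/forallP => a; apply/forallP => b; apply/forallP => i.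
  apply/implyP => /and3P []; rewrite !mem_cells => ja jb /andP [ai ib].
  have := ltn_ord b; have := ltn_ord a; have := ltn_ord i => im am bm.
  (* Row i contains row a if it does not lie below row k, and row b otherwise, so one of the two
     given cells decides. *)
  have [ik | ik] := leqP i.+1 k.
    have := @nested_below t 1 m a.+1 i.+1 t_nest; rewrite /nested; lia.
  have := @nested_above t 1 m b.+1 i.+1 t_nest; rewrite /nested; lia.
- apply/andP; split; apply/forallP.
    move=> i; apply/eqP; rewrite -entry_tnth.
    have -> : [set j | (i, j) \in cells n r (vec t 1 m)]
        = [set j : 'I_n | t i.+1 <= j.+1 < t i.+1 + entry r i.+1].
      by apply/setP => j; rewrite [LHS]inE mem_cells inE.
    rewrite (card_ord_count _ (fun j => t i.+1 <= j < t i.+1 + entry r i.+1)).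
    by case: (t_in i.+1 (ltn_ord i)) => ? ?; apply: count_interval.
  move=> j; apply/eqP; rewrite -entry_tnth -t_cov ?ltn_ord //.
  have -> : [set i | (i, j) \in cells n r (vec t 1 m)]
      = [set i : 'I_m | t i.+1 <= j.+1 < t i.+1 + entry r i.+1].
    by apply/setP => i; rewrite [LHS]inE mem_cells inE.
  rewrite (card_ord_count _ (fun i => t i <= j.+1 < t i + entry r i)).
  by rewrite /covered /rows /index_iota subn1.
Qed.

Lemma full_row_cells T (kk : 'I_m) :
  realization r c T -> kk.+1 = k -> forall j, (kk, j) \in T.
Proof.
move=> /andP [/forallP rT _] ek j.
have /eqP := rT kk; rewrite -entry_tnth ek; case: rk => _ ->.
move=> cT; have : [set j | (kk, j) \in T] == setT.
  by rewrite eqEcard subsetT cT cardsT card_ord leqnn.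
by move/eqP/setP/(_ j); rewrite !inE.
Qed.

Lemma realization_solution T :
  hv_convex T -> realization r c T -> exists t, solution t.
Proof.
move=> /andP [hT vT] rT; have [k1m _] := rk.
have km : k.-1 < m by lia.
pose kk := Ordinal km; have ek : kk.+1 = k by rewrite /=; lia.
have Tk := full_row_cells rT ek.
have [rTr rTc] := andP rT.
have cardr i : #|[set j | (i, j) \in T]| = entry r i.+1.
  by move/forallP: rTr => /(_ i) /eqP ->; rewrite entry_tnth.
have : forall i : 'I_m, exists t, [/\ 1 <= t, t + entry r i.+1 <= n.+1
    & forall j : 'I_n, ((i, j) \in T) = (t <= j.+1 < t + entry r i.+1)].
  move=> i; have := @convex_interval n [set j | (i, j) \in T]; rewrite cardr.
  case=> [||t [? ? memt]].
  - by rewrite -card_gt0 cardr entry_gt0 //= ltn_ord.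
  - move=> a b j; rewrite !inE => aT bT ajb.
    move/forallP: hT => /(_ i) /forallP /(_ a) /forallP /(_ b) /forallP /(_ j).
    by move/implyP; apply; apply/and3P.
  by exists t; split => // j; rewrite -memt inE.
case/fin_all_exists => f fP.
pose t i := if insub i.-1 is Some x then f x else 0.
have tE (i : 'I_m) : t i.+1 = f i by rewrite /t /= valK.
exists t; split.
- case=> [//|i] /andP [_ im]; rewrite (tE (Ordinal im)).
  by case: (fP (Ordinal im)).
- case=> [//|i] /andP [_ im] ik.
  have him : (towards k i.+1).-1 < m by rewrite /towards; case: ifP; lia.
  pose h := Ordinal him.
  have eh : towards k i.+1 = h.+1 by rewrite /= /towards; case: ifP; lia.
  pose i' := Ordinal im.
  have := fP i'; have := fP h; rewrite eh /nested (tE h) (tE i').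
  move=> [f1 fn memh] [f1' fn' memi].
  have r0 : 0 < entry r i.+1 by apply: entry_gt0.
  (* Row h lies between row i and the full row k, which meets every column; vertical convexity fills
     the column in between. *)
  have down (j : 'I_n) : (i', j) \in T -> (h, j) \in T.
    move=> iT; have := eh; rewrite /towards; case: ifP => /= ihk ehk.
      move/forallP: vT => /(_ j) /forallP /(_ i') /forallP /(_ kk) /forallP /(_ h).
      move/implyP; apply; apply/and3P; split; [exact: iT | exact: Tk | rewrite /=; lia].
    move/forallP: vT => /(_ j) /forallP /(_ kk) /forallP /(_ i') /forallP /(_ h).
    move/implyP; apply; apply/and3P; split; [exact: Tk | exact: iT | rewrite /=; lia].
  (* Ordinals count columns from 0: these are the first and the last column of row i. *)
  have j1 : (f i').-1 < n by move: fn'; rewrite /=; lia.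
  have j2 : (f i' + entry r i.+1).-2 < n by move: fn'; rewrite /=; lia.
  have := down (Ordinal j1); have := down (Ordinal j2).
  by move: f1' fn'; rewrite !memh !memi /=; lia.
case=> [//|j] /andP [_ jn]; rewrite (entry_tnth c (Ordinal jn)).
move/forallP: rTc => /(_ (Ordinal jn)) /eqP <-.
have -> : [set i | (i, Ordinal jn) \in T]
    = [set i : 'I_m | t i.+1 <= j.+1 < t i.+1 + entry r i.+1].
  by apply/setP => i; rewrite !inE tE; case: (fP i) => _ _ ->.
rewrite (card_ord_count _ (fun i => t i <= j.+1 < t i + entry r i)).
by rewrite /covered /rows /index_iota subn1.
Qed.

(** Vertical convexity joins each cell to the full row k within its column, and the full row joins
    the columns. *)
Lemma polyomino_convex T : hv_convex T -> realization r c T -> polyomino T.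
Proof.
move=> /andP [hT vT] rT; have [k1m _] := rk.
have km : k.-1 < m by lia.
pose kk := Ordinal km; have ek : kk.+1 = k by rewrite /=; lia.
have Tk := full_row_cells rT ek.
pose e := [rel u v : 'I_m * 'I_n | [&& u \in T, v \in T & adjacent u v]].
have e_sym : connect_sym e.
  by apply: sym_connect_sym => u v; rewrite /e /= /adjacent /dist; lia.
have row d : forall a b : 'I_n, a + d = b -> connect e (kk, a) (kk, b).
  elim: d => [|d IHd] a b ab.
    by have -> : a = b by [apply: val_inj; rewrite /=; lia]; rewrite connect0.
  have an : a + d < n by have := ltn_ord b; lia.
  apply: connect_trans (IHd a (Ordinal an) erefl) (connect1 _).
  by rewrite /e /= !Tk /= /adjacent /dist /=; lia.
have up d : forall (i : 'I_m) j, i + d = kk -> (i, j) \in T ->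
    connect e (i, j) (kk, j).
  elim: d => [|d IHd] i j ik iT.
    by have -> : i = kk by [apply: val_inj; rewrite /=; lia]; rewrite connect0.
  have im : i.+1 < m by have := ltn_ord kk; lia.
  have iT' : (Ordinal im, j) \in T.
    move/forallP: vT => /(_ j) /forallP /(_ i) /forallP /(_ kk) /forallP /(_ (Ordinal im)).
    by move/implyP; apply; apply/and3P; split => //=; move: ik => /=; lia.
  apply: connect_trans (connect1 _) (IHd (Ordinal im) j _ iT'); last by move: ik => /=; lia.
  by rewrite /e /= iT iT' /adjacent /dist /=; lia.
have down d : forall (i : 'I_m) j, kk + d = i -> (i, j) \in T ->
    connect e (i, j) (kk, j).
  elim: d => [|d IHd] i j ik iT.
    by have -> : i = kk by [apply: val_inj; rewrite /=; lia]; rewrite connect0.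
  have im : i.-1 < m by have := ltn_ord i; lia.
  have iT' : (Ordinal im, j) \in T.
    move/forallP: vT => /(_ j) /forallP /(_ kk) /forallP /(_ i) /forallP /(_ (Ordinal im)).
    by move/implyP; apply; apply/and3P; split => //=; move: ik => /=; lia.
  apply: connect_trans (connect1 _) (IHd (Ordinal im) j _ iT'); last by move: ik => /=; lia.
  by rewrite /e /= iT iT' /adjacent /dist /=; move: ik => /=; lia.
have to_k x : x \in T -> connect e x (kk, x.2).
  case: x => i j iT; have [ik | ik] := leqP i kk.
    by apply: (up (kk - i)) => //; lia.
  by apply: (down (i - kk)) => //; lia.
apply/forall_inP => x xT; apply/forall_inP => y yT; rewrite -/e.
apply: connect_trans (to_k x xT) _; rewrite e_sym.
apply: connect_trans (to_k y yT) _.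
have [xy | xy] := leqP x.2 y.2.
  by rewrite e_sym; apply: (row (y.2 - x.2)); lia.
by apply: (row (x.2 - y.2)); lia.
Qed.

End Geometry.

(** * Correctness of Algorithm 2 *)

Lemma sorted_head_last (s : seq nat) x :
  sorted leq s -> x \in s -> head 0 s <= x <= last 0 s.
Proof.
move=> ss xs; have nx := nth_index 0 xs; have ix : index x s < size s by rewrite index_mem.
have le_nth := sorted_leq_nth leq_trans leqnn 0 ss.
rewrite -nth0 -nth_last -nx; apply/andP; split; apply: le_nth; rewrite ?inE //; lia.
Qed.

Lemma count_index_iota (P : pred nat) a b d : a <= b -> b <= d ->
  count P (index_iota a d) = count P (index_iota a b) + count P (index_iota b d).
Proof.
move=> ab bd; rewrite -count_cat; congr count; rewrite /index_iota.
have -> : d - a = (b - a) + (d - b) by lia.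
by rewrite iotaD; congr (_ ++ iota _ _); lia.
Qed.

Section Correctness.

Variables (m n : nat) (r : m.-tuple nat) (c : n.-tuple nat) (k : nat).
Hypothesis rc : reconstruction_input r c.
Hypothesis rk : full_row n r k.

Local Notation colsum := (colsum r).
Local Notation alpha := (alpha r c).
Local Notation beta := (beta r c).

Lemma entry_last : entry r m.+1 = 0.
Proof. by rewrite /entry nth_default //= size_tuple. Qed.

Lemma colsum_vec t p q j : colsum p q (vec t p q) j = covered r t p q j.
Proof. by apply: eq_covered => i; apply: start_vec. Qed.

(** A single unsaturated column rules out the default value 0 of [alpha] and [beta]. *)
Lemma alpha_betaP p q X j : 1 <= j <= n -> colsum p q X j < entry c j ->
  [/\ alpha p q X <= j <= beta p q X,
      1 <= alpha p q X <= n, colsum p q X (alpha p q X) < entry c (alpha p q X),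
      1 <= beta p q X <= n & colsum p q X (beta p q X) < entry c (beta p q X)].
Proof.
move=> jn ju; pose s := unsaturated r c p q X.
have mem_s h : h \in s = (colsum p q X h < entry c h) && (1 <= h <= n).
  by rewrite mem_filter mem_columns.
have js : j \in s by rewrite mem_s ju.
have s_sorted : sorted leq s by apply: sorted_filter (iota_sorted _ _); apply: leq_trans.
have sn0 : 0 < size s by case: (s) js.
have : alpha p q X \in s by rewrite /alpha -nth0 mem_nth.
have : beta p q X \in s by rewrite /beta -nth_last mem_nth // prednK.
rewrite !mem_s => /andP [-> ->] /andP [-> ->]; split => //.
exact: sorted_head_last js.
Qed.

Lemma covered_le t p q p' q' j :
  p' <= p -> q <= q' -> covered r t p q j <= covered r t p' q' j.
Proof.
move=> pp qq; have [pq | pq] := leqP p q.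
  rewrite /covered /rows (@count_index_iota _ p' p q'.+1) ?(@count_index_iota _ p q.+1 q'.+1); lia.
by rewrite {1}/covered /rows /index_iota (_ : q.+1 - p = 0) //; lia.
Qed.

Lemma covered_rest t p q j : 1 <= p -> p <= q.+1 -> q <= m ->
  covered r t p q j < covered r t 1 m j <->
  exists i, [/\ 1 <= i <= m, ~~ (p <= i <= q) & t i <= j < t i + entry r i].
Proof.
move=> p1 pq qm; pose P i := t i <= j < t i + entry r i.
have -> : covered r t 1 m j = count P (index_iota 1 p) + covered r t p q j
                            + count P (index_iota q.+1 m.+1).
  rewrite /covered /rows (@count_index_iota _ 1 p); try lia.
  by rewrite (@count_index_iota _ p q.+1) ?addnA //; lia.
split => [lt_cov | [i [im ipq iP]]].
  have : has P (index_iota 1 p) || has P (index_iota q.+1 m.+1).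
    by rewrite !has_count; lia.
  by case/orP => /hasP [i]; rewrite mem_index_iota => ? ?; exists i; split => //; lia.
have : has P (index_iota 1 p) || has P (index_iota q.+1 m.+1).
  have [ip | ip] := ltnP i p; apply/orP; [left | right]; apply/hasP; exists i => //;
  rewrite mem_index_iota; lia.
by rewrite !has_count; lia.
Qed.

(** * Restrictions of a solution to a window of rows *)

Section Window.

Variables (p q : nat).
Hypotheses (p1 : 1 <= p) (pk : p <= k) (kq : k <= q) (qm : q <= m).

Lemma solution_start t i : solution r c k t -> 1 <= i <= m ->
  [/\ 1 <= t i, t i + entry r i <= n.+1 & 0 < entry r i].
Proof. by case=> t_in _ _ im; have [] := t_in i im; have := entry_gt0 rc im. Qed.

Lemma solution_unsaturated t j : solution r c k t -> 1 <= j <= n ->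
  colsum p q (vec t p q) j < entry c j <->
  exists i, [/\ 1 <= i <= m, ~~ (p <= i <= q) & t i <= j < t i + entry r i].
Proof.
move=> [_ _ t_cov] jn; rewrite colsum_vec -t_cov //.
by apply: covered_rest => //; lia.
Qed.

(** The unsaturated columns of a restriction are those covered by rows outside the window; this
    includes the extreme ones, [alpha] and [beta]. *)
Lemma solution_rest t i j : solution r c k t -> 1 <= i <= m -> ~~ (p <= i <= q) ->
  t i <= j < t i + entry r i ->
  [/\ alpha p q (vec t p q) <= j <= beta p q (vec t p q),
      1 <= alpha p q (vec t p q), beta p q (vec t p q) <= n,
      (exists i, [/\ 1 <= i <= m, ~~ (p <= i <= q) &
         t i <= alpha p q (vec t p q) < t i + entry r i]) &
      (exists i, [/\ 1 <= i <= m, ~~ (p <= i <= q) &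
         t i <= beta p q (vec t p q) < t i + entry r i])].
Proof.
move=> st im ipq ij; have [t1 tn _] := solution_start st im.
have jn : 1 <= j <= n by lia.
have ju : colsum p q (vec t p q) j < entry c j.
  by apply/solution_unsaturated => //; exists i.
have [? ? au ? bu] := alpha_betaP jn ju.
split => //; try lia; first exact: (iffLR (solution_unsaturated st _)) au.
exact: (iffLR (solution_unsaturated st _)) bu.
Qed.

Lemma solution_nested t i : solution r c k t -> 1 <= i <= m ->
  (i < p -> nested r t i p) /\ (q < i -> nested r t i q).
Proof.
move=> [_ t_nest _] im; split => iw.
  by apply: (nested_below t_nest); lia.
by apply: (nested_above t_nest); lia.
Qed.

(** The inequalities with minimum and maximum hold because [alpha] and [beta] are covered by outer
    rows, each nested in row p or row q. *)
Lemma solution_partial t : solution r c k t -> (p, q) != (1, m) ->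
  partial_realization r c k p q (vec t p q) && valid r c p q (vec t p q).
Proof.
move=> st pq; have [t_in t_nest t_cov] := st.
have [i [im ipq]] : exists i, 1 <= i <= m /\ ~~ (p <= i <= q).
  have [p' | p'] := ltnP 1 p; first by exists 1; lia.
  by exists m; move: pq; rewrite xpair_eqE; lia.
have [ti1 tin ri] := solution_start st im.
have tii : t i <= t i < t i + entry r i by lia.
have [ab a1 bn [ia [iam iapq ia_a]] [ib [ibm ibpq ib_b]]] := solution_rest st im ipq tii.
have := solution_nested st iam; have := solution_nested st ibm.
rewrite /nested => nb na.
apply/andP; split.
  rewrite /partial_realization !start_vec; try lia.
  apply/and5P; split.
  - rewrite /in_range size_vec eqxx /=; apply/allP => h; rewrite mem_rows => hpq.
    by rewrite start_vec //; apply/andP; apply: t_in; lia.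
  - apply/allP => h; rewrite mem_rows => hpq; apply/implyP => hk.
    have hm : 1 <= h <= m by lia.
    rewrite /VC !start_vec //; last by rewrite /towards; case: ifP; lia.
    by apply/andP; apply: t_nest.
  - lia.
  - lia.
  apply/andP; split; first lia.
  apply/allP => j; rewrite mem_columns => jn; apply/implyP => jab.
  rewrite eqn_leq colsum_vec -t_cov // covered_le //= leqNgt; apply/negP.
  by move/covered_rest; case=> //; first lia; move=> h [hm hpq /(solution_rest st hm hpq) []]; lia.
apply/allP => j; rewrite mem_columns => jn; apply/implyP => _.
by rewrite colsum_vec -t_cov // covered_le.
Qed.

(* X covers each column at least as often as t does, and as many cells in all. *)
Lemma balanced_coverage t X : solution r c k t ->
  partial_realization r c k p q X -> balanced r c p q X ->
  forall j, 1 <= j <= n ->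
    covered r t p q j = colsum p q X j /\
    (alpha p q X <= j <= beta p q X -> colsum p q X j = q.+1 - p).
Proof.
move=> st /and5P [/andP [_ X_in] X_nest _ _ /andP [_ X_sat]] /andP [pqa bpq].
have [t_in t_nest t_cov] := st.
have {}X_nest i : p <= i <= q -> i != k -> nested r (start p X) i (towards k i).
  by rewrite -mem_rows => ipq ik; have /implyP/(_ ik)/andP[] := allP X_nest i ipq.
(* Each row of X contains row p or row q, and by balance both of these cover [[alpha, beta]]. *)
have inside j : alpha p q X <= j <= beta p q X -> colsum p q X j = q.+1 - p.
  move=> jab; rewrite /Defs.colsum -[RHS](size_iota p) -/(rows p q).
  apply/eqP; rewrite -all_count; apply/allP => i; rewrite mem_rows => ipq.
  rewrite /covers; have [ik | ik] := leqP i k.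
    by have := nested_below X_nest (leqnn p) _ ik kq; have := @nested_below _ r k _ p q p i X_nest; rewrite /nested; lia.
  by have := @nested_above _ r k _ p q q i X_nest; rewrite /nested; lia.
have le_cov : {in columns n, forall j, covered r t p q j <= colsum p q X j}.
  move=> j jn; have [jab | jab] := boolP (alpha p q X <= j <= beta p q X).
    by rewrite inside // (leq_trans (count_size _ _)) // size_iota.
  have /implyP/(_ jab)/eqP -> := allP X_sat j jn.
  by rewrite -t_cov ?covered_le // -mem_columns.
have sum_cov : \sum_(j <- columns n) covered r t p q j = \sum_(j <- columns n) colsum p q X j.
  rewrite /covered /Defs.colsum /covers !sum_coverage // => i.
    by move/(allP X_in)/andP.
  by rewrite mem_rows => ipq; apply: t_in; lia.
move=> j jn; split; last exact: inside.
by apply: (eq_sum_leq le_cov sum_cov); rewrite mem_columns.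
Qed.

Lemma balanced_vec t X : solution r c k t ->
  partial_realization r c k p q X -> balanced r c p q X ->
  balanced r c p q (vec t p q) /\ exists2 u, solution r c k u & vec u p q = X.
Proof.
move=> st pX bX; have cov := balanced_coverage st pX bX.
have [t_in t_nest t_cov] := st.
have eq_uns : unsaturated r c p q (vec t p q) = unsaturated r c p q X.
  apply: eq_in_filter => j; rewrite mem_columns => jn.
  by rewrite colsum_vec; have [-> _] := cov j jn.
have eq_a : alpha p q (vec t p q) = alpha p q X by rewrite /alpha /Defs.alpha eq_uns.
have eq_b : beta p q (vec t p q) = beta p q X by rewrite /beta /Defs.beta eq_uns.
have /and5P [/andP [/eqP sX X_in] X_nest Xa Xab /andP [Xb X_sat]] := pX.
have {}X_in i : p <= i <= q -> 1 <= start p X i /\ start p X i + entry r i <= n.+1.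
  by rewrite -mem_rows => /(allP X_in)/andP.
have {}X_nest i : p <= i <= q -> i != k -> nested r (start p X) i (towards k i).
  by rewrite -mem_rows => ipq ik; have /implyP/(_ ik)/andP[] := allP X_nest i ipq.
have /andP [ma mb] := bX.
split.
  rewrite /balanced eq_a eq_b !start_vec; try lia.
  (* The column sum attains the number of rows here, so no row of t misses the column. *)
  have all_cov i j : p <= i <= q -> 1 <= j <= n -> alpha p q X <= j <= beta p q X ->
      t i <= j < t i + entry r i.
    move=> ipq jn jab; have [e1 e2] := cov j jn; have := e2 jab; rewrite -e1.
    rewrite /covered -[RHS](size_iota p) => /eqP; rewrite -all_count.
    by move/allP/(_ i); rewrite mem_rows; apply.
  have [p1X pnX] : 1 <= start p X p /\ start p X p + entry r p <= n.+1 by apply: X_in; lia.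
  have a_in : 1 <= alpha p q X <= n by lia.
  have b_in : 1 <= beta p q X <= n by lia.
  have cov_a i : p <= i <= q -> t i <= alpha p q X < t i + entry r i.
    by move=> ipq; apply: all_cov => //; rewrite leqnn Xab.
  have cov_b i : p <= i <= q -> t i <= beta p q X < t i + entry r i.
    by move=> ipq; apply: all_cov => //; rewrite leqnn Xab.
  have ppq : p <= p <= q by rewrite leqnn (leq_trans pk kq).
  have qpq : p <= q <= q by rewrite leqnn (leq_trans pk kq).
  have [/andP [ap _] /andP [aq _]] := (cov_a p ppq, cov_a q qpq).
  have [/andP [_ bp] /andP [_ bq]] := (cov_b p ppq, cov_b q qpq).
  by rewrite geq_max leq_min ap aq bp bq.
(* The rows of t in the window are exchanged for those of X. (VC) holds at the seam because the
   outer rows lie within [[alpha, beta]], which rows p and q of X cover. *)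
pose u i := if p <= i <= q then start p X i else t i.
have uE i : p <= i <= q -> u i = start p X i by rewrite /u => ->.
have tE i : ~~ (p <= i <= q) -> u i = t i by rewrite /u => /negbTE ->.
exists u; last first.
  by rewrite -[RHS](vec_start sX); apply/eq_in_map => i; rewrite mem_rows => /uE.
split.
- move=> i im; have [ipq | ipq] := boolP (p <= i <= q); last by rewrite tE //; apply: t_in.
  by rewrite uE //; apply: X_in.
- move=> i im ik; have [ipq | ipq] := boolP (p <= i <= q).
    by rewrite /nested !uE //; [apply: X_nest | rewrite /towards; case: ifP; lia].
  have [ipq' | ipq'] := boolP (p <= towards k i <= q); last first.
    by rewrite /nested !tE //; apply: t_nest.
  rewrite /nested (tE _ ipq) (uE _ ipq').
  have [ti1 tin ri] := solution_start st im.
  have := solution_rest st im ipq (j := t i); have := solution_rest st im ipq (j := (t i + entry r i).-1).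
  rewrite eq_a eq_b => b1 b2.
  have {b1} [|b1 _ _ _ _] := b1; first lia.
  have {b2} [|b2 _ _ _ _] := b2; first lia.
  have : towards k i = p \/ towards k i = q.
    by move: ipq'; rewrite /towards; case: ifP; lia.
  by case=> ->; lia.
move=> j jn; rewrite -t_cov // /covered /rows.
have split_cov v : count (fun i => v i <= j < v i + entry r i) (index_iota 1 m.+1) =
    count (fun i => v i <= j < v i + entry r i) (index_iota 1 p)
    + covered r v p q j + count (fun i => v i <= j < v i + entry r i) (index_iota q.+1 m.+1).
  rewrite (@count_index_iota _ 1 p); try lia.
  by rewrite (@count_index_iota _ p q.+1) ?addnA //; lia.
rewrite !split_cov; congr (_ + _ + _).
- by apply: eq_in_count => i; rewrite mem_index_iota => ip; rewrite tE //; lia.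
- by have [-> _] := cov j jn; apply: eq_covered.
by apply: eq_in_count => i; rewrite mem_index_iota => ip; rewrite tE //; lia.
Qed.

Lemma pq_realization_vec t p' q' : solution r c k t ->
  1 <= p' -> p' <= k -> k <= q' -> q' <= m ->
  ((p', q') != (1, m) -> partial_realization r c k p' q' (vec t p' q')) ->
  pq_realization r c k p' q' (vec t p' q').
Proof.
move=> st ? ? ? ? part; rewrite /pq_realization.
case: eqP part => [[-> ->] _ | /eqP pq part]; last exact: part.
exact: (full_realization_solution rk st).
Qed.

End Window.

Definition grows_up (p q : nat) : bool := (q == m) || (entry r q.+1 <= entry r p.-1).

(** For p = 1 and q < m, the length 0 of row 0 loses against the positive length of row q+1. *)
Lemma grows_up_gt p q : 1 <= p -> q <= m -> k <= q -> (p, q) != (1, m) -> grows_up p q -> 1 < p.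
Proof.
move=> p1 qm kq pq /orP [/eqP eq | le_r].
  by move: pq; rewrite eq xpair_eqE eqxx andbT; lia.
have [// | p'] := ltnP 1 p; have ep : p = 1 by lia.
move: pq le_r; rewrite ep xpair_eqE /= => qm' le_r.
by have := entry_gt0 rc (i := q.+1); move: le_r; rewrite [entry r 0]/entry /=; lia.
Qed.

Lemma solution_ext_up t p q : 1 <= p -> p <= k -> k <= q -> q <= m ->
  (p, q) != (1, m) -> grows_up p q -> solution r c k t ->
  vec t p.-1 q \in ext_up r c k p q (vec t p q).
Proof.
move=> p1 pk kq qm pq up st; have pgt1 := grows_up_gt p1 qm kq pq up.
have /andP [_ vX] := solution_partial p1 pk kq qm st pq.
rewrite /ext_up vX orbT mem_filter; apply/andP; split.
  apply: pq_realization_vec => //; try lia.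
  move=> pq'; suff /andP [] : partial_realization r c k p.-1 q (vec t p.-1 q)
    && valid r c p.-1 q (vec t p.-1 q) by [].
  by apply: solution_partial => //; lia.
have -> : vec t p.-1 q = t p.-1 :: vec t p q.
  rewrite /vec /rows /index_iota (_ : q.+1 - p.-1 = (q.+1 - p).+1); last lia.
  by rewrite /= prednK.
have im : 1 <= p.-1 <= m by lia.
have ipq : ~~ (p <= p.-1 <= q) by lia.
have [t1 tn rp] := solution_start st im.
set a := alpha _ _ _; set b := beta _ _ _.
suff : t p.-1 = a \/ t p.-1 + entry r p.-1 = b.+1.
  rewrite !inE; case=> [-> | e]; first by rewrite eqxx.
  by rewrite -e addnK eqxx orbT.
have rest i : 1 <= i <= m -> ~~ (p <= i <= q) -> a <= t i /\ t i + entry r i <= b.+1.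
  move=> im' ipq'; have [? ? ri] := solution_start st im'.
  have := solution_rest p1 pk kq qm st im' ipq' (j := t i).
  have := solution_rest p1 pk kq qm st im' ipq' (j := (t i + entry r i).-1).
  by move=> [|b1 _ _ _ _]; [lia | move=> [|b2 _ _ _ _]; lia].
have [_ _ _ [ia [iam iapq ia_a]] [ib [ibm ibpq ib_b]]] :=
  @solution_rest p q p1 pk kq qm t p.-1 (t p.-1) st im ipq ltac:(lia).
have [_ t_nest _] := st.
have side i : 1 <= i <= m -> ~~ (p <= i <= q) ->
    nested r t i p.-1 \/ (q < m /\ nested r t i q.+1).
  move=> im' ipq'; have [ip | ip] := ltnP i p.
    by left; apply: (nested_below t_nest); lia.
  by right; split; [lia | apply: (nested_above t_nest); lia].
(* If [a] or [b] is covered by a row nested in row p-1, then row p-1 touches that end. Otherwise row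
   q+1 reaches from [a] to [b], and row p-1, at least as long and confined to the same columns,
   fills them. *)
have := side _ iam iapq; have := side _ ibm ibpq.
rewrite -/a -/b in ia_a ib_b *.
have := rest _ im ipq; rewrite /nested.
have [qm' | qm'] := ltnP q m; last by lia.
have := rest q.+1; have le_r : entry r q.+1 <= entry r p.-1 by case/orP: up => //; lia.
lia.
Qed.

Lemma solution_ext_down t p q : 1 <= p -> p <= k -> k <= q -> q <= m ->
  (p, q) != (1, m) -> ~~ grows_up p q -> solution r c k t ->
  vec t p q.+1 \in ext_down r c k p q (vec t p q).
Proof.
move=> p1 pk kq qm pq; rewrite negb_or -ltnNge => /andP [qm' lt_r] st.
have {}qm' : q < m by lia.
have /andP [_ vX] := solution_partial p1 pk kq qm st pq.
rewrite /ext_down vX orbT mem_filter; apply/andP; split.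
  apply: pq_realization_vec => //; try lia.
  move=> pq'; suff /andP [] : partial_realization r c k p q.+1 (vec t p q.+1)
    && valid r c p q.+1 (vec t p q.+1) by [].
  by apply: solution_partial => //; lia.
have -> : vec t p q.+1 = rcons (vec t p q) (t q.+1).
  rewrite /vec /rows /index_iota (_ : q.+2 - p = (q.+1 - p) + 1); last lia.
  by rewrite iotaD map_cat /= cats1; congr (rcons _ (t _)); lia.
have im : 1 <= q.+1 <= m by lia.
have ipq : ~~ (p <= q.+1 <= q) by lia.
have [t1 tn rp] := solution_start st im.
set a := alpha _ _ _; set b := beta _ _ _.
suff : t q.+1 = a \/ t q.+1 + entry r q.+1 = b.+1.
  rewrite !inE; case=> [-> | e]; first by rewrite eqxx.
  by rewrite -e addnK eqxx orbT.
have rest i : 1 <= i <= m -> ~~ (p <= i <= q) -> a <= t i /\ t i + entry r i <= b.+1.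
  move=> im' ipq'; have [? ? ri] := solution_start st im'.
  have := solution_rest p1 pk kq qm st im' ipq' (j := t i).
  have := solution_rest p1 pk kq qm st im' ipq' (j := (t i + entry r i).-1).
  by move=> [|b1 _ _ _ _]; [lia | move=> [|b2 _ _ _ _]; lia].
have [_ _ _ [ia [iam iapq ia_a]] [ib [ibm ibpq ib_b]]] :=
  @solution_rest p q p1 pk kq qm t q.+1 (t q.+1) st im ipq ltac:(lia).
have [_ t_nest _] := st.
have side i : 1 <= i <= m -> ~~ (p <= i <= q) ->
    (1 < p /\ nested r t i p.-1) \/ nested r t i q.+1.
  move=> im' ipq'; have [ip | ip] := ltnP i p.
    by left; split; [lia | apply: (nested_below t_nest); lia].
  by right; apply: (nested_above t_nest); lia.
have := side _ iam iapq; have := side _ ibm ibpq.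
rewrite -/a -/b in ia_a ib_b *.
have := rest _ im ipq; rewrite /nested.
have [p1' | p1'] := ltnP 1 p; last by lia.
have := rest p.-1; lia.
Qed.

(** * The loop and its choices *)

Definition next_window (w : nat * nat) : nat * nat :=
  if grows_up w.1 w.2 then (w.1.-1, w.2) else (w.1, w.2.+1).

Definition is_window (w : nat * nat) : Prop := [/\ 1 <= w.1, w.1 <= k, k <= w.2 & w.2 <= m].

(** The growth of the window depends on the row sums alone. Its size therefore determines it, and a
    choice function can recover it from the length of the vectors offered. *)
Definition scheduled (w : nat * nat) : Prop := w = iter (w.2 - w.1) next_window (k, k).

Lemma next_windowP w : is_window w -> w != (1, m) ->
  is_window (next_window w) /\
  (next_window w).2 - (next_window w).1 = (w.2 - w.1).+1.
Proof.
case: w => p q [/= p1 pk kq qm] pq; rewrite /next_window /is_window /=.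
have := grows_up_gt p1 qm kq pq; case: ifP => up; rewrite /=.
  by move=> /(_ isT) p2; split; [split; lia | lia].
by move: up; rewrite /grows_up => /negbT; rewrite negb_or => ? _; split; [split; lia | lia].
Qed.

Section Pick.

Variable pick : seq (seq nat) -> seq nat.

Local Notation loop_body := (loop_body r c k pick).
Local Notation loop := (loop r c k pick).

Lemma loop_body_window w P : (loop_body (w, P)).1 = next_window w.
Proof. by case: w => p q; rewrite /Defs.loop_body /next_window /grows_up /=; case: ifP. Qed.

Definition good (w : nat * nat) (P : seq (seq nat)) : seq (seq nat) :=
  [seq X <- P | valid r c w.1 w.2 X && balanced r c w.1 w.2 X].

Definition all_partial (w : nat * nat) (P : seq (seq nat)) : Prop :=
  w != (1, m) -> {in P, forall X, partial_realization r c k w.1 w.2 X}.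

Lemma loop_body_partial w P :
  all_partial (loop_body (w, P)).1 (loop_body (w, P)).2.
Proof.
case: w => p q; rewrite /all_partial loop_body_window /next_window /Defs.loop_body.
rewrite -/(grows_up p q) /=; case: ifP => _ /=; set g := filter _ _ => pq X XP.
- have : exists Y, X \in ext_up r c k p q Y.
    by move: XP; case: (g) => [/flatten_mapP [Y _] | Y s]; [exists Y | exists (pick (Y :: s))].
  case=> Y; rewrite /ext_up; case: ifP => // _.
  by rewrite mem_filter /pq_realization (negbTE pq) => /andP [].
have : exists Y, X \in ext_down r c k p q Y.
  by move: XP; case: (g) => [/flatten_mapP [Y _] | Y s]; [exists Y | exists (pick (Y :: s))].
case=> Y; rewrite /ext_down; case: ifP => // _.
by rewrite mem_filter /pq_realization (negbTE pq) => /andP [].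
Qed.

(** In both branches the restriction of t gets extended: as a member of P, or as the chosen
    vector. *)
Lemma loop_body_vec t w P : is_window w -> w != (1, m) -> solution r c k t ->
  (good w P = [::] -> vec t w.1 w.2 \in P) ->
  (good w P != [::] -> pick (good w P) = vec t w.1 w.2) ->
  vec t (next_window w).1 (next_window w).2 \in (loop_body (w, P)).2.
Proof.
case: w => p q [/= p1 pk kq qm] pq st tP pickt.
rewrite /next_window /Defs.loop_body /= -/(grows_up p q) -/(good (p, q) P).
case: ifP => up /=.
  have t_up := solution_ext_up p1 pk kq qm pq up st.
  case: good tP pickt => [/(_ erefl) tP _ | Y s _ /(_ isT) -> //].
  by apply/flatten_mapP; exists (vec t p q).
have t_down := solution_ext_down p1 pk kq qm pq (negbT up) st.
case: good tP pickt => [/(_ erefl) tP _ | Y s _ /(_ isT) -> //].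
by apply/flatten_mapP; exists (vec t p q).
Qed.

(* With I trivial this serves an arbitrary choice function, with I u := (u = t)
   the choice function that follows a given solution t. *)
Lemma loop_invariant (I : (nat -> nat) -> Prop) N w P t :
  (forall t w P, is_window w -> scheduled w -> w != (1, m) -> I t -> solution r c k t -> all_partial w P ->
     vec t w.1 w.2 \in P -> good w P != [::] ->
     exists u, [/\ I u, solution r c k u & pick (good w P) = vec u w.1 w.2]) ->
  is_window w -> scheduled w -> m <= N + (w.2 - w.1).+1 -> I t -> solution r c k t -> all_partial w P ->
  vec t w.1 w.2 \in P ->
  exists u, [/\ I u, solution r c k u & vec u 1 m \in (loop N (w, P)).2].
Proof.
move=> body_pick; elim: N w P t => [|N IHN] w P t ww sw mN It st aP tP.
  have ew : w = (1, m) by case: w ww mN {sw aP tP} => p q [/=]; move=> *; congr (_, _); lia.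
  by exists t; rewrite /= ew in tP *.
rewrite -[loop _ _]/(if w == (1, m) then (w, P) else loop N (loop_body (w, P))).
case: eqP => [ew | /eqP ew]; first by exists t; rewrite /= ew in tP *.
have [ww' ew'] := next_windowP ww ew.
have [u [Iu su uP]] : exists u, [/\ I u, solution r c k u &
    vec u (next_window w).1 (next_window w).2 \in (loop_body (w, P)).2].
  have [g0 | g0] := boolP (good w P == [::]).
    by exists t; split => //; apply: loop_body_vec => //; rewrite g0.
  have [u [Iu su pu]] := body_pick t w P ww sw ew It st aP tP g0.
  exists u; split => //; apply: loop_body_vec => // g1.
  by rewrite g1 in g0.
have aP' : all_partial (loop_body (w, P)).1 (loop_body (w, P)).2.
  by apply: loop_body_partial.
have := loop_body_window w P.
case: (loop_body (w, P)) uP aP' => w' P' /= uP aP' ew2.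
rewrite ew2 in aP' *; apply: (IHN _ _ u) => //; last by rewrite ew'; lia.
by rewrite /scheduled ew' iterS -sw.
Qed.

Lemma loop_reaches (I : (nat -> nat) -> Prop) t :
  (forall t w P, is_window w -> scheduled w -> w != (1, m) -> I t -> solution r c k t ->
     all_partial w P -> vec t w.1 w.2 \in P -> good w P != [::] ->
     exists u, [/\ I u, solution r c k u & pick (good w P) = vec u w.1 w.2]) ->
  I t -> solution r c k t ->
  exists u, [/\ I u, solution r c k u & vec u 1 m \in (loop m (k, k, [:: [:: 1]])).2].
Proof.
move=> body_pick It st; have [k1m rkn] := rk.
have ek : [:: 1] = vec t k k.
  rewrite /vec /rows /index_iota subSnn /=; case: st => t_in _ _.
  by have := t_in k k1m; rewrite rkn => ?; congr [:: _]; lia.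
apply: (loop_invariant body_pick _ _ _ It st) => /=.
- by split => /=; lia.
- by rewrite /scheduled /= subnn.
- by lia.
- move=> /= kk X; rewrite inE => /eqP ->; rewrite ek.
  by case/andP: (solution_partial (proj1 (andP k1m)) (leqnn k) (leqnn k) (proj2 (andP k1m)) st kk).
by rewrite -ek mem_head.
Qed.

Lemma algorithm2_full s : choice_function pick ->
  algorithm2 r c k pick = Some s -> full_realization r c s.
Proof.
rewrite /algorithm2 => pickP; set P := (loop _ _).2.
have [-> // | ] := eqVneq [seq t <- P | full_realization r c t] [::].
case E: [seq t <- P | full_realization r c t] => [//|x s0] _ [<-].
have : pick (x :: s0) \in [seq t <- P | full_realization r c t] by rewrite E pickP.
by rewrite mem_filter => /andP [].
Qed.

(** The solution followed may change on the way: after each choice of a balanced X it is replaced by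
    the one that [balanced_vec] builds around X. *)
Lemma algorithm2_some t : choice_function pick -> solution r c k t ->
  exists s, algorithm2 r c k pick = Some s.
Proof.
move=> pickP st.
have [] := @loop_reaches (fun=> True) t _ I st.
  move=> {}t w P [p1 pk kq qm] _ ew _ {}st aP _ g0.
  have := pickP _ g0; rewrite mem_filter => /andP [/andP [_ bX] XP].
  have [_ [u su <-]] := balanced_vec p1 pk kq qm st (aP ew _ XP) bX.
  by exists u.
move=> u [_ su uP]; rewrite /algorithm2.
have : vec u 1 m \in [seq t <- (loop m (k, k, [:: [:: 1]])).2 | full_realization r c t].
  by rewrite mem_filter uP (full_realization_solution rk su).
by case: filter => // x s _; exists (pick (x :: s)).
Qed.

End Pick.

(** Whenever a choice is due, some vector is balanced; then so is the restriction of t, by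
    [balanced_vec], and it is among the options. *)
Lemma algorithm2_vec t : solution r c k t ->
  exists pick, choice_function pick /\ algorithm2 r c k pick = Some (vec t 1 m).
Proof.
move=> st; have [k1m rkn] := rk.
(* The vectors present at one moment have the same length, which tells the window. *)
pose target N := let w := iter N.-1 next_window (k, k) in vec t w.1 w.2.
pose pick s : seq nat :=
  if target (size (head [::] s)) \in s then target (size (head [::] s)) else head [::] s.
have pickP : choice_function pick.
  by move=> [//|x s] _; rewrite /pick; case: ifP => //= _; rewrite mem_head.
have pickE w s : scheduled w -> vec t w.1 w.2 \in s ->
    {in s, forall X, size X = w.2.+1 - w.1} -> w.1 <= w.2 -> pick s = vec t w.1 w.2.
  move=> sw ts sizes le_w; rewrite /pick; have -> : size (head [::] s) = (w.2 - w.1).+1.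
    by case: s ts sizes => [//|x s] _ /(_ x (mem_head _ _)) /= ->; lia.
  by rewrite /target /= -sw ts.
exists pick; split => //.
have [] := @loop_reaches pick (fun u => u = t) t _ erefl st.
  move=> _ w P [p1 pk kq qm] sw ew -> _ aP tP g0; exists t; split => //.
  have sizes : {in P, forall X, size X = w.2.+1 - w.1}.
    by move=> X XP; have /and5P [/andP [/eqP]] := aP ew X XP.
  apply: pickE => //; last by lia.
    have := pickP _ g0; rewrite mem_filter => /andP [/andP [_ bX] XP].
    have [bt _] := balanced_vec p1 pk kq qm st (aP ew _ XP) bX.
    have ew' : (w.1, w.2) != (1, m) by case: (w) ew.
    rewrite mem_filter tP bt; case/andP: (solution_partial p1 pk kq qm st ew') => _ ->.
    by [].
  by move=> X; rewrite mem_filter => /andP [_]; apply: sizes.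
move=> _ [-> _ tP]; rewrite /algorithm2.
set sols := filter _ _.
have tsols : vec t 1 m \in sols by rewrite mem_filter tP (full_realization_solution rk st).
have -> : (if sols is [::] then None else Some (pick sols)) = Some (pick sols).
  by case: (sols) tsols.
congr Some.
(* The last choice is made among vectors of length m, which the choice function assigns to the
   scheduled window with m rows; this window has to be (1, m). *)
have [w [sw ww ew]] : exists w, [/\ scheduled w, is_window w & w = (1, m)].
  have reach d w : scheduled w -> is_window w -> m <= (w.2 - w.1).+1 + d ->
      exists w, [/\ scheduled w, is_window w & w = (1, m)].
    elim: d w => [|d IHd] w sw ww md.
      by exists w; split => //; case: w ww md {sw} => p q [/= *]; congr (_, _); lia.
    have [ew | ew] := eqVneq w (1, m); first by exists w.
    have [ww' ew'] := next_windowP ww ew.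
    by apply: (IHd (next_window w)); [rewrite /scheduled ew' iterS -sw | | rewrite ew'; lia].
  by apply: (reach m (k, k)); [rewrite /scheduled /= subnn | split => /=; lia | rewrite /=; lia].
have := pickE w sols sw; rewrite ew /=; apply => //; last by lia.
move=> X; rewrite mem_filter => /andP [/and3P [/andP [/eqP -> _] _ _] _]; lia.
Qed.

End Correctness.

(** * Chains of nested rows *)

(* Row 0 is the full row, of length l 0 = n; row i + 1 lies inside row i. *)
Definition chain (l x : nat -> nat) (a : nat) : Prop :=
  x 0 = 1 /\ forall i, i < a -> x i <= x i.+1 /\ x i.+1 + l i.+1 <= x i + l i.

(** Row 0 is left out because two chains share it; [total] adds it once. *)
Definition coverage (l x : nat -> nat) (a j : nat) : nat :=
  count (fun i => x i <= j < x i + l i) (iota 1 a).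

(** Reversing the columns maps the interval x, ..., x + l - 1 to n + 2 - x - l, ..., n + 1 - x. *)
Definition mirror (n : nat) (l x : nat -> nat) (i : nat) : nat := n.+2 - (x i + l i).

Lemma count_prefix (P : pred nat) w a : w <= a ->
  (forall i, 1 <= i <= w -> P i) -> (forall i, w < i <= a -> ~~ P i) ->
  count P (iota 1 a) = w.
Proof.
move=> wa Pw Pa; rewrite -(subnKC wa) iotaD count_cat.
rewrite (@eq_in_count _ P predT) => [|i]; last by rewrite mem_iota => ?; apply: Pw; lia.
rewrite count_predT size_iota (@eq_in_count _ P pred0) => [|i].
  by rewrite count_pred0 addn0.
by rewrite mem_iota => ?; apply/negbTE/Pa; lia.
Qed.

Lemma eq_chain l x y a : (forall i, i <= a -> x i = y i) -> chain l x a -> chain l y a.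
Proof.
move=> xy [x0 xS]; split=> [|i ia]; first by rewrite -xy.
by rewrite -!xy; [apply: xS | lia | lia].
Qed.

Lemma eq_coverage l x y a j :
  (forall i, 1 <= i <= a -> x i = y i) -> coverage l x a j = coverage l y a j.
Proof. by move=> xy; apply: eq_in_count => i; rewrite mem_iota => ?; rewrite xy //; lia. Qed.

Lemma coverageS l x a j :
  coverage l x a.+1 j = coverage l x a j + (x a.+1 <= j < x a.+1 + l a.+1).
Proof.
by rewrite /coverage -(addn1 a) iotaD count_cat /= addn0 add1n addn1.
Qed.

Lemma coverage_le l x a a' j : a <= a' -> coverage l x a j <= coverage l x a' j.
Proof. by move=> aa; rewrite -(subnKC aa) /coverage iotaD count_cat leq_addr. Qed.

Lemma coverage_lt l x a a' j : a <= a' -> coverage l x a j < coverage l x a' j ->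
  exists i, a < i <= a' /\ x i <= j < x i + l i.
Proof.
move=> aa; rewrite -{1}(subnKC aa) /coverage iotaD count_cat => lt.
have : has (fun i => x i <= j < x i + l i) (iota (1 + a) (a' - a)).
  by rewrite has_count; lia.
by case/hasP => i; rewrite mem_iota => ? ?; exists i; split => //; lia.
Qed.

(** Serves to exchange the first a rows of a chain; adding crosswise avoids truncated
    differences. *)
Lemma coverage_tail l x x' a A j : a <= A -> (forall i, a < i -> x i = x' i) ->
  coverage l x A j + coverage l x' a j = coverage l x' A j + coverage l x a j.
Proof.
move=> aA xx'; rewrite -(subnKC aA) /coverage iotaD !count_cat.
have -> : count (fun i => x i <= j < x i + l i) (iota (1 + a) (A - a))
    = count (fun i => x' i <= j < x' i + l i) (iota (1 + a) (A - a)).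
  by apply: eq_in_count => i; rewrite mem_iota => ?; rewrite xx' //; lia.
by rewrite addnAC [RHS]addnAC; congr (_ + _); rewrite addnC.
Qed.

Section Chains.

Variable n : nat.

Lemma chain_nested l x a i j : chain l x a -> i <= j -> j <= a ->
  x i <= x j /\ x j + l j <= x i + l i.
Proof.
move=> [_ xS] ij; rewrite -(subnKC ij); elim: (j - i) => [|d IHd] ja.
  by rewrite addn0.
by have := xS (i + d); rewrite addnS in ja *; have := IHd; lia.
Qed.

Lemma chain_in l x a i : l 0 = n -> chain l x a -> i <= a -> 1 <= x i /\ x i + l i <= n.+1.
Proof.
move=> l0 xc ia; have := chain_nested xc (leq0n i) ia.
by case: xc => -> _; rewrite l0; lia.
Qed.

Lemma mirrorK l x a i : l 0 = n -> chain l x a -> i <= a ->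
  mirror n l x i + x i + l i = n.+2.
Proof. by move=> l0 xc ia; have := chain_in l0 xc ia; rewrite /mirror; lia. Qed.

Lemma chain_mirror l x a : l 0 = n -> chain l x a -> chain l (mirror n l x) a.
Proof.
move=> l0 xc; split=> [|i ia].
  by case: xc; rewrite /mirror l0 => ->; lia.
have := mirrorK l0 xc ia; have := mirrorK l0 xc (ltnW ia).
by have [_ /(_ i ia)] := xc; lia.
Qed.

Lemma coverage_mirror l x a j : l 0 = n -> chain l x a -> 1 <= j <= n ->
  coverage l (mirror n l x) a j = coverage l x a (n.+1 - j).
Proof.
move=> l0 xc jn; apply: eq_in_count => i; rewrite mem_iota => ia.
have ia' : i <= a by lia.
by have := mirrorK l0 xc ia'; lia.
Qed.

Lemma sum_chain l x a : l 0 = n -> chain l x a ->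
  \sum_(j <- columns n) coverage l x a j = \sum_(i <- iota 1 a) l i.
Proof.
move=> l0 xc; apply: sum_coverage => i; rewrite mem_iota => ia.
by apply: chain_in xc _ => //; lia.
Qed.

Lemma sum_chain_mirror l x a : l 0 = n -> chain l x a ->
  \sum_(j <- columns n) coverage l x a (n.+1 - j) = \sum_(i <- iota 1 a) l i.
Proof.
move=> l0 xc; rewrite -(sum_chain l0 (chain_mirror l0 xc)).
by apply: eq_big_seq => j; rewrite mem_columns => jn; rewrite coverage_mirror.
Qed.

(* The number of cells in column j of the full row, of the first a rows of a
   chain with left offsets x and of the first b rows of a chain with right
   offsets y. *)
Definition total (L R x : nat -> nat) (a : nat) (y : nat -> nat) (b j : nat) : nat :=
  (coverage L x a j + coverage R y b (n.+1 - j)).+1.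

(** A solution split at row k. With the two chains measured from opposite ends, exchanging them
    while reversing the columns leaves all offsets unchanged. *)
Definition packing (L R : nat -> nat) (A B : nat) (c x y : nat -> nat) : Prop :=
  [/\ chain L x A, chain R y B
    & forall j, 1 <= j <= n -> total L R x A y B j = c j].

(* The state of a run seen from one end of its window of unsaturated columns,
   which is [al, n + 1 - be].  The columns before al are saturated; the rows 1
   to U of the opposite chain reach column al, the rows beyond W of the own chain
   end before it; the rows up to a0 were placed before the last restart and cover
   the whole window. *)
Definition half (L R c : nat -> nat) (a a0 : nat) (x : nat -> nat) (b : nat)
    (y : nat -> nat) (al be U W : nat) : Prop :=
  [/\ chain L x a, x a <= al,
      forall j, 1 <= j < al -> total L R x a y b j = c j,
      forall i, i <= U -> n.+2 <= al + y i + R i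
    & (forall i, W < i <= a -> x i + L i <= al) /\ n.+2 <= x a0 + L a0 + be].

Lemma total_swap L R x a y b j : 1 <= j <= n ->
  total R L y b x a j = total L R x a y b (n.+1 - j).
Proof. by move=> jn; rewrite /total subKn 1?addnC //; lia. Qed.

Section Agree.

Variables (L R : nat -> nat) (a b : nat) (x y X Y : nat -> nat).
Hypothesis Xx : forall i, i <= a -> X i = x i.
Hypothesis Yy : forall i, i <= b -> Y i = y i.

Lemma total_agree j : total L R x a y b j = total L R X a Y b j.
Proof.
rewrite /total (@eq_coverage _ x X) => [|i ia]; last by rewrite Xx //; lia.
by rewrite (@eq_coverage _ y Y) // => i ia; rewrite Yy //; lia.
Qed.

Variables (c : nat -> nat) (A B : nat).
Hypotheses (aA : a <= A) (bB : b <= B).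
Hypothesis XY : packing L R A B c X Y.

Lemma total_le j : 1 <= j <= n -> total L R x a y b j <= c j.
Proof.
case: XY => _ _ cov jn; rewrite total_agree -cov // /total.
by rewrite ltnS leq_add // coverage_le.
Qed.

(** Later rows are nested in the next row of their chain, so the two next rows decide. *)
Lemma total_next j : 1 <= j <= n -> total L R x a y b j < c j <->
  (a < A /\ X a.+1 <= j < X a.+1 + L a.+1) \/
  (b < B /\ Y b.+1 <= n.+1 - j < Y b.+1 + R b.+1).
Proof.
case: XY => Xc Yc cov jn; rewrite total_agree -cov // /total; split=> [lt | next].
  have := @coverage_le L X a A j aA; have := @coverage_le R Y b B (n.+1 - j) bB => ? ?.
  have [lt' | ge] := ltnP (coverage L X a j) (coverage L X A j).
    have [i [ia ij]] := coverage_lt aA lt'.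
    by left; have := chain_nested (i := a.+1) (j := i) Xc; lia.
  have lt' : coverage R Y b (n.+1 - j) < coverage R Y B (n.+1 - j) by lia.
  have [i [ia ij]] := coverage_lt bB lt'.
  by right; have := chain_nested (i := b.+1) (j := i) Yc; lia.
have := @coverage_le L X a A j aA; have := @coverage_le R Y b B (n.+1 - j) bB.
case: next => [[lt cov_j] | [lt cov_j]].
  by have := coverage_le L X j lt; rewrite coverageS cov_j; lia.
by have := coverage_le R Y (n.+1 - j) lt; rewrite coverageS cov_j; lia.
Qed.

End Agree.

Section Pair.

Variables (L R c cr : nat -> nat) (A B : nat).
Hypotheses (L0 : L 0 = n) (R0 : R 0 = n).
Hypothesis L_gt0 : forall i, 1 <= i <= A -> 0 < L i.
Hypothesis R_gt0 : forall i, 1 <= i <= B -> 0 < R i.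
Hypothesis cr_c : forall j, 1 <= j <= n -> cr j = c (n.+1 - j).

Lemma packing_swap X Y : packing L R A B c X Y -> packing R L B A cr Y X.
Proof.
move=> [Xc Yc cov]; split => // j jn; rewrite total_swap // cov ?cr_c //; lia.
Qed.

(** Here the columns are reversed without exchanging the chains, so the offsets change. In this form
    a solution is compared with the reflected run. *)
Lemma packing_mirror X Y : packing L R A B c X Y ->
  packing L R A B cr (mirror n L X) (mirror n R Y).
Proof.
move=> [Xc Yc cov]; split; try exact: chain_mirror.
move=> j jn; rewrite cr_c // -cov; last lia.
by rewrite /total !coverage_mirror // ?subKn //; lia.
Qed.

Section Slot.

Variables (a a0 b b0 : nat) (x y : nat -> nat) (al be U W V Z : nat).
Hypotheses (aA : a <= A) (bB : b <= B).
Hypotheses (a0W : a0 <= W) (Wa : W <= a) (Ub : U <= b).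
Hypotheses (b0Z : b0 <= Z) (Zb : Z <= b) (Va : V <= a).
Hypotheses (al_gt0 : 0 < al) (be_gt0 : 0 < be).
Hypothesis hL : half L R c a a0 x b y al be U W.
Hypothesis hR : half R L cr b b0 y a x be al V Z.

Lemma half_U : n.+2 <= al + y U.+1 + R U.+1 -> half L R c a a0 x b y al be U.+1 W.
Proof.
case: hL => xc xal cov Uc Wc next; split => // i iU.
by have [-> // | ne] := eqVneq i U.+1; apply: Uc; lia.
Qed.

Lemma half_W : x W + L W <= al -> half L R c a a0 x b y al be U W.-1.
Proof.
case: hL => xc xal cov Uc [Wc e] drop; split => //; split => // i iW.
have [-> // | ne] := eqVneq i W.
by apply: Wc; lia.
Qed.

(** In each chain the rows covering column [al] form an initial segment: all of them start in time,
    and the ends are nested. [W] and [U] are the lengths of these segments once neither counter can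
    move; for [W = a0], the rows from before the restart cover the whole window. *)
Lemma total_scan : al + be <= n.+1 ->
  (U < b -> al + y U.+1 + R U.+1 < n.+2) -> (a0 < W -> al < x W + L W) ->
  total L R x a y b al = (W + U).+1.
Proof.
move=> ab Ustop Wstop; rewrite /total; congr (_ + _).+1.
  case: hL => xc xal _ _ [Wc x0]; apply: count_prefix => // i iW.
    have := chain_nested (i := i) (j := a) xc; have := chain_nested (i := i) (j := W) xc.
    have [e | ne] := eqVneq a0 W; first by rewrite e in x0; lia.
    lia.
  by have := Wc i iW; lia.
case: hR => yc ybe _ _ _; case: hL => _ _ _ Uc _; apply: count_prefix => // i iU.
  have := Uc i; have := chain_nested (i := i) (j := b) yc; lia.
by have := chain_nested (i := U.+1) (j := i) yc; lia.
Qed.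

Lemma half_ptr : al + be <= n.+1 -> total L R x a y b al = c al ->
  half L R c a a0 x b y al.+1 be U W /\ half R L cr b b0 y a x be al.+1 V Z.
Proof.
move=> ab cov_al; case: hL => xc xal cov Uc [Wc x0]; case: hR => yc ybe cov' Vc [Zc y0].
split; split => //.
- by lia.
- move=> j jal; have [-> // | ne] := eqVneq j al.
  by apply: cov; lia.
- by move=> i /Uc; lia.
- by split=> [i /Wc|]; lia.
by split => //; lia.
Qed.

Lemma half_add x' : 
  a < A -> (forall i, i <= a -> x' i = x i) -> x' a.+1 = al ->
  al + L a.+1 <= x a + L a -> al + be + L a.+1 <= n.+2 -> a0 <= a ->
  half L R c a.+1 a0 x' b y al be U W.+1 /\ half R L cr b b0 y a.+1 x' be al V Z.
Proof.
move=> aA' xx' xS le_l le_w a0a.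
case: hL => xc xal cov Uc [Wc x0]; case: hR => yc ybe cov' Vc [Zc y0].
have La : 0 < L a.+1 by apply: L_gt0; lia.
(* Row a contains the new row, which is nonempty and starts at [al]; so row a ends after [al] and
   has not been dropped. *)
have eW : W = a by have := Wc a; lia.
have xc' : chain L x' a.+1.
  split=> [|i]; first by rewrite xx' //; case: xc.
  move=> ia; have [-> | ne] := eqVneq i a; first by rewrite xS xx'; lia.
  have {}ia : i < a by lia.
  by rewrite !xx'; [case: xc => _; apply | lia | lia].
have cov_x' j : coverage L x' a.+1 j = coverage L x a j + (al <= j < al + L a.+1).
  by rewrite coverageS xS (@eq_coverage _ x' x) // => i ia; apply: xx'; lia.
split; split => //.
- by rewrite xS.
- move=> j jal; rewrite -cov // /total cov_x'.
  have -> : (al <= j < al + L a.+1) = false by lia.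
  by rewrite addn0.
- by split=> [i|]; [lia | rewrite xx'].
- move=> j jbe; rewrite -cov' // /total cov_x'.
  have -> : (al <= n.+1 - j < al + L a.+1) = false by lia.
  by rewrite addn0.
by move=> i iV; rewrite xx'; [apply: Vc | lia].
Qed.

Section Balanced.

Hypothesis ab : al + be <= n.+1.
Hypotheses (Ue : U = b) (Ve : V = a).

Lemma total_balanced j : al <= j -> j + be <= n.+1 -> total L R x a y b j = (a + b).+1.
Proof.
move=> alj jbe; rewrite /total; congr (_ + _).+1.
  case: hL => xc xal _ _ _; case: hR => _ _ _ Vc _; apply: count_prefix => // i iW; last lia.
  by have := Vc a; have := chain_nested (i := i) (j := a) xc; lia.
case: hR => yc ybe _ _ _; case: hL => _ _ _ Uc _; apply: count_prefix => // i iW; last lia.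
by have := Uc b; have := chain_nested (i := i) (j := b) yc; lia.
Qed.

Lemma half_commit :
  half L R c a a x b y al be b a.
Proof.
case: hL => xc xal cov Uc _; case: hR => _ _ _ Vc _; split => //.
  by rewrite -Ue.
split; first lia.
by have := Vc a; rewrite Ve; lia.
Qed.

(** Reflection exchanges the ends of the window, so [be] takes the place of [al]. In a balanced
    stage every row reaches both ends, which justifies the full counters [b] and [a]. *)
Lemma half_mirror x' y' : (forall i, i <= a -> x' i = mirror n L x i) ->
  (forall i, i <= b -> y' i = mirror n R y i) ->
  half L R cr a a x' b y' be al b a.
Proof.
move=> xx' yy'; case: hL => xc xal cov Uc _; case: hR => yc ybe cov' Vc _; split.
- by apply: (@eq_chain _ (mirror n L x)) (chain_mirror L0 xc) => i ia; rewrite xx'.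
- by rewrite xx' //; have := mirrorK L0 xc (leqnn a); have := Vc a; lia.
- move=> j jbe; rewrite -cov' //.
  rewrite /total (@eq_coverage _ x' (mirror n L x)); last by move=> i ia; apply: xx'; lia.
  rewrite (@eq_coverage _ y' (mirror n R y)); last by move=> i ia; apply: yy'; lia.
  by rewrite !coverage_mirror // ?subKn 1?addnC //; lia.
- move=> i ib; rewrite yy' //; have := mirrorK R0 yc ib.
  by have := chain_nested yc ib; lia.
split; first lia.
by rewrite xx' //; have := mirrorK L0 xc (leqnn a); lia.
Qed.

End Balanced.

Lemma half_packing : a = A -> b = B -> n.+2 <= al + be -> packing L R A B c x y.
Proof.
move=> eA eB ab; case: hL => xc _ cov _ _; case: hR => yc _ cov' _ _.
rewrite -eA -eB; split => // j jn.
have [jal | jal] := ltnP j al; first by apply: cov; lia.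
have := cov' (n.+1 - j); rewrite cr_c ?(total_swap L R) ?subKn //; lia.
Qed.

(** The scan is at rest at this end: none of its three tests [touches], [drops] and [saturates]
    applies. *)
Definition stopped : Prop := al + be <= n.+1 ->
  [/\ U < b -> al + y U.+1 + R U.+1 < n.+2, a0 < W -> al < x W + L W
    & c al <> (W + U).+1].

Variables (X Y : nat -> nat).
Hypothesis XY : packing L R A B c X Y.
Hypothesis Xx : forall i, i <= a -> X i = x i.
Hypothesis Yy : forall i, i <= b -> Y i = y i.

Lemma window_next j : 1 <= j <= n -> total L R x a y b j < c j -> al <= j /\ j + be <= n.+1.
Proof.
case: hL => _ _ cov _ _; case: hR => _ _ cov' _ _ jn lt; split.
  by rewrite leqNgt; apply/negP => jal; have := cov j; lia.
rewrite leqNgt; apply/negP => jbe; have := cov' (n.+1 - j).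
by rewrite cr_c ?(total_swap L R) ?subKn //; lia.
Qed.

Lemma window_next_row : a < A ->
  [/\ al <= X a.+1, X a.+1 + L a.+1 + be <= n.+2, al + be <= n.+1 & 0 < L a.+1].
Proof.
move=> aA'; have [Xc _ _] := XY; have [X1 Xn] := chain_in L0 Xc aA'.
have L1 : 0 < L a.+1 by apply: L_gt0.
have in_window j : X a.+1 <= j < X a.+1 + L a.+1 -> al <= j /\ j + be <= n.+1.
  move=> jX; have jn : 1 <= j <= n by lia.
  by apply: window_next => //; apply/(total_next Xx Yy aA bB XY jn); left.
have := in_window (X a.+1); have := in_window (X a.+1 + L a.+1).-1.
by move=> ? ?; split=> //; lia.
Qed.

(** Agreement with a solution bounds the sum in column [al] by its demand, and the last condition of
    [stopped] excludes equality. *)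
Lemma stopped_next : stopped -> al + be <= n.+1 ->
  total L R x a y b al < c al.
Proof.
move=> st ab; have [U_st W_st c_st] := st ab.
have alN : 1 <= al <= n by lia.
by have := total_le Xx Yy aA bB XY alN; have := total_scan ab U_st W_st; lia.
Qed.

End Slot.

Section Next.

Variables (a a0 b b0 : nat) (x y : nat -> nat) (al be U W V Z : nat).
Hypotheses (aA : a <= A) (bB : b <= B).
Hypotheses (a0W : a0 <= W) (Wa : W <= a) (Ub : U <= b).
Hypotheses (b0Z : b0 <= Z) (Zb : Z <= b) (Va : V <= a).
Hypotheses (al_gt0 : 0 < al) (be_gt0 : 0 < be).
Hypothesis hL : half L R c a a0 x b y al be U W.
Hypothesis hR : half R L cr b b0 y a x be al V Z.
Variables (X Y : nat -> nat).
Hypothesis XY : packing L R A B c X Y.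
Hypothesis Xx : forall i, i <= a -> X i = x i.
Hypothesis Yy : forall i, i <= b -> Y i = y i.

Lemma stopped_end : stopped a0 b x y al be U W -> a = A -> b = B -> n.+2 <= al + be.
Proof.
move=> st eA eB; rewrite leqNgt; apply/negP => ab.
have {}ab : al + be <= n.+1 by lia.
have := stopped_next aA bB a0W Wa Ub b0Z Zb Va al_gt0 be_gt0 hL hR XY Xx Yy st ab.
rewrite (total_agree _ _ Xx Yy); have [_ _ cov] := XY.
by rewrite -cov -?eA -?eB ?ltnn //; lia.
Qed.

(** The counterpart of [balanced_vec] for chains: double counting gives equal column sums, and then
    the tails of X and Y are attached to x and y. *)
Lemma balanced_packing : al + be <= n.+1 -> U = b -> V = a ->
  exists X' Y', [/\ packing L R A B c X' Y', forall i, i <= a -> X' i = x i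
    & forall i, i <= b -> Y' i = y i].
Proof.
move=> ab eU eV; have [Xc Yc cov] := XY.
have le_total : {in columns n, forall j, total L R X a Y b j <= total L R x a y b j}.
  move=> j; rewrite mem_columns => jn; have [jw | jw] := boolP ((al <= j) && (j + be <= n.+1)).
    rewrite (total_balanced aA bB a0W Wa Ub b0Z Zb Va al_gt0 be_gt0 hL hR ab eU eV); try lia.
    rewrite ltnS leq_add // (leq_trans (count_size _ _)) // size_iota; lia.
  apply: leq_trans (@total_le L R a b X Y X Y _ _ c A B aA bB XY j jn) _ => //.
  case: hL => _ _ covL _ _; case: hR => _ _ covR _ _.
  have [jal | jal] := ltnP j al; first by rewrite covL //; lia.
  have := covR (n.+1 - j); rewrite cr_c ?(total_swap L R) ?subKn //; lia.
have sumE x' y' : chain L x' a -> chain R y' b -> \sum_(j <- columns n) total L R x' a y' b j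
    = \sum_(i <- iota 1 a) L i + \sum_(i <- iota 1 b) R i + \sum_(j <- columns n) 1.
  move=> xc yc; rewrite -(sum_chain L0 xc) -(sum_chain_mirror R0 yc) -!big_split.
  by apply: eq_bigr => j _; rewrite /total /= addn1.
have [xc yc] : chain L x a /\ chain R y b by case: hL => ? _ _ _ _; case: hR.
have sub_chain l x' a' a'' : a' <= a'' -> chain l x' a'' -> chain l x' a'.
  by move=> le [x0 xS]; split=> // i ia; apply: xS; lia.
have eq_total j : 1 <= j <= n -> total L R X a Y b j = total L R x a y b j.
  move=> jn; apply: (eq_sum_leq le_total); last by rewrite mem_columns.
  by rewrite !sumE //; [exact: sub_chain aA Xc | exact: sub_chain bB Yc].
(* The remaining rows stay in the window, whose two ends are reached by row a of x and row b of y;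
   this gives nestedness at the seam. *)
have window j : 1 <= j <= n -> 
    (a < A /\ X a.+1 <= j < X a.+1 + L a.+1) \/
    (b < B /\ Y b.+1 <= n.+1 - j < Y b.+1 + R b.+1) -> al <= j /\ j + be <= n.+1.
  move=> jn next; apply: (window_next aA bB a0W Wa Ub b0Z Zb Va al_gt0 be_gt0 hL hR jn).
  rewrite -eq_total //; apply/(@total_next L R a b X Y X Y _ _ c A B aA bB XY j jn) => //.
pose X' i := if i <= a then x i else X i.
pose Y' i := if i <= b then y i else Y i.
have X'x i : i <= a -> X' i = x i by rewrite /X' => ->.
have Y'y i : i <= b -> Y' i = y i by rewrite /Y' => ->.
have X'X i : a < i -> X' i = X i by rewrite /X' ltnNge => /negbTE ->.
have Y'Y i : b < i -> Y' i = Y i by rewrite /Y' ltnNge => /negbTE ->.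
exists X', Y'; split; [split | exact: X'x | exact: Y'y].
- split=> [|i iA]; first by rewrite X'x //; case: xc.
  have [ia | ia] := ltnP i a; first by rewrite !X'x ?(ltnW ia) //; case: xc => _; apply.
  have [_ /(_ i iA)] := Xc; have [ei | ne] := eqVneq i a; last by rewrite !X'X; lia.
  rewrite X'x ?ei ?X'X //; have aA' : a < A by lia.
  have [X1 Xn] := chain_in L0 Xc aA'; have L1 : 0 < L a.+1 by apply: L_gt0.
  have := window (X a.+1); have := window (X a.+1 + L a.+1).-1.
  by case: hL => _ xal _ _ _; case: hR => _ _ _ Vc _; have := Vc a; lia.
- split=> [|i iA]; first by rewrite Y'y //; case: yc.
  have [ib | ib] := ltnP i b; first by rewrite !Y'y ?(ltnW ib) //; case: yc => _; apply.
  have [_ /(_ i iA)] := Yc; have [ei | ne] := eqVneq i b; last by rewrite !Y'Y; lia.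
  rewrite Y'y ?ei ?Y'Y //; have bB' : b < B by lia.
  have [Y1 Yn] := chain_in R0 Yc bB'; have R1 : 0 < R b.+1 by apply: R_gt0.
  have := window (n.+1 - Y b.+1); have := window (n.+2 - (Y b.+1 + R b.+1)).
  by case: hR => _ ybe _ _ _; case: hL => _ _ _ Uc _; have := Uc b; lia.
move=> j jn; rewrite -cov // /total; congr _.+1.
have := eq_total j jn; rewrite /total.
have := coverage_tail L j aA X'X; have := coverage_tail R (n.+1 - j) bB Y'Y.
rewrite (@eq_coverage L X' x a) => [|i ia]; last by rewrite X'x //; lia.
rewrite (@eq_coverage R Y' y b) => [|i ia]; last by rewrite Y'y //; lia.
lia.
Qed.

End Next.

End Pair.

(** * Forced placement of the next row *)

Section Step.

Variables (L R c cr : nat -> nat) (A B : nat).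
Hypotheses (L0 : L 0 = n) (R0 : R 0 = n).
Hypothesis L_gt0 : forall i, 1 <= i <= A -> 0 < L i.
Hypothesis R_gt0 : forall i, 1 <= i <= B -> 0 < R i.
Hypothesis cr_c : forall j, 1 <= j <= n -> cr j = c (n.+1 - j).
Variables (a a0 b b0 : nat) (x y : nat -> nat) (al be U W V Z : nat).
Hypotheses (aA : a <= A) (bB : b <= B).
Hypotheses (a0W : a0 <= W) (Wa : W <= a) (Ub : U <= b).
Hypotheses (b0Z : b0 <= Z) (Zb : Z <= b) (Va : V <= a).
Hypotheses (al_gt0 : 0 < al) (be_gt0 : 0 < be).
Hypothesis hL : half L R c a a0 x b y al be U W.
Hypothesis hR : half R L cr b b0 y a x be al V Z.
Hypothesis st : stopped L R c a0 b x y al be U W.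
Hypothesis st' : stopped R L cr b0 a y x be al V Z.

Lemma stopped_balanced X Y : packing L R A B c X Y ->
  (forall i, i <= a -> X i = x i) -> (forall i, i <= b -> Y i = y i) ->
  al + be <= n.+1 -> U = b -> V = a -> (a + b).+1 < c al.
Proof.
move=> XY Xx Yy ab Ub' Va'.
have := stopped_next L0 R0 aA bB a0W Wa Ub b0Z Zb Va al_gt0 be_gt0 hL hR XY Xx Yy st ab.
by rewrite (total_balanced L0 R0 aA bB a0W Wa Ub b0Z Zb Va al_gt0 be_gt0 hL hR ab Ub' Va'); lia.
Qed.

Lemma next_row X Y : packing L R A B c X Y ->
  (forall i, i <= a -> X i = x i) -> (forall i, i <= b -> Y i = y i) ->
  a < A -> R b.+1 <= L a.+1 ->
  [/\ al + be + L a.+1 <= n.+2, al + L a.+1 <= x a + L a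
    & X a.+1 = al] \/
  [/\ al + be <= n.+1, U = b, V = a, X a.+1 <> al & X a.+1 + L a.+1 + be = n.+2].
Proof.
move=> XY Xx Yy aA' RL; have [Xc Yc cov] := XY.
have [alX Xbe ab L1] := window_next_row L0 R0 L_gt0 cr_c aA bB a0W Wa Ub b0Z Zb Va al_gt0 be_gt0 hL hR XY Xx Yy aA'.
have alN : 1 <= al <= n by lia.
have beN : 1 <= n.+1 - be <= n by lia.
have lt_al := stopped_next L0 R0 aA bB a0W Wa Ub b0Z Zb Va al_gt0 be_gt0 hL hR XY Xx Yy st ab.
have ba : be + al <= n.+1 by lia.
have c_cr j : 1 <= j <= n -> c j = cr (n.+1 - j).
  by move=> jn; rewrite cr_c ?subKn //; lia.
have lt_be := stopped_next R0 L0 bB aA b0Z Zb Va a0W Wa Ub be_gt0 al_gt0 hR hL (packing_swap L0 R0 cr_c XY) Yy Xx st' ba.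
rewrite (total_swap L R x a y b) ?cr_c in lt_be; try lia.
have := (total_next Xx Yy aA bB XY alN).1 lt_al.
have := (total_next Xx Yy aA bB XY beN).1 lt_be.
rewrite subKn; last lia.
have [U_st W_st _] := st ab; have [V_st Z_st _] := st' ba.
have [_ XS] := Xc; have [Xa XaL] := XS a aA'.
rewrite -(Xx _ (leqnn a)).
(* Row U+1 of the opposite chain misses [al], hence so does its row b+1, and row a+1 has to cover
   [al]. *)
have [Ub' | Ub'] := ltnP U b.
  have := chain_nested Yc (i := U.+1) (j := b.+1); rewrite (Yy _ Ub').
  by move=> nY Hbe Hal; left; split; lia.
(* Row V+1 misses the last column of the window, hence so does row a+1, and the opposite row b+1
   covers that column. If row b+1 covered [al] too, it would fill the window; row a+1, being at
   least as long, would fill it as well. *)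
have [Va' | Va'] := ltnP V a.
  have := chain_nested Xc (i := V.+1) (j := a.+1); rewrite (Xx _ Va').
  by move=> nX Hbe Hal; left; split; lia.
(* In the balanced case the same comparison of lengths leaves both ends possible, but nothing
   else. *)
move=> Hbe Hal; have [e | ne] := eqVneq (X a.+1) al; first by left; split; lia.
by right; split; [lia | lia | lia | exact/eqP | lia].
Qed.

End Step.

End Chains.

(** * Solutions as pairs of chains *)

Section Correspondence.

Variables (m n : nat) (r : m.-tuple nat) (c : n.-tuple nat) (k : nat).
Hypothesis rc : reconstruction_input r c.
Hypothesis rk : full_row n r k.

Definition above (i : nat) : nat := entry r (k - i).
Definition below (i : nat) : nat := entry r (k + i).

Definition stack (x y : nat -> nat) (i : nat) : nat :=
  if i <= k then x (k - i) else mirror n below y (i - k).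

Lemma above0 : above 0 = n.
Proof. by rewrite /above subn0; case: rk. Qed.

Lemma below0 : below 0 = n.
Proof. by rewrite /below addn0; case: rk. Qed.

Lemma covered_chains t j : covered r t 1 m j =
  count (fun i => t (k - i) <= j < t (k - i) + above i) (iota 1 k.-1) +
  (t k <= j < t k + n) +
  count (fun i => t (k + i) <= j < t (k + i) + below i) (iota 1 (m - k)).
Proof.
have [k1m rkn] := rk; rewrite /covered /rows.
have -> : index_iota 1 m.+1 = index_iota 1 k ++ k :: [seq k + i | i <- iota 1 (m - k)].
  rewrite -iotaDl addn1 /index_iota (_ : m.+1 - 1 = k.-1 + (m - k).+1); last lia.
  by rewrite iotaD subn1 (_ : 1 + k.-1 = k) //; lia.
rewrite count_cat /= count_map rkn addnA; congr (_ + _ + _).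
have : perm_eq (index_iota 1 k) [seq k - i | i <- iota 1 k.-1].
  apply: uniq_perm; first exact: iota_uniq.
    rewrite map_inj_in_uniq ?iota_uniq // => i h; rewrite !mem_iota; lia.
  move=> i; rewrite mem_index_iota; apply/idP/mapP => [ik | [h]].
    by exists (k - i); rewrite ?mem_iota; lia.
  by rewrite mem_iota; lia.
by move/permP ->; rewrite count_map.
Qed.

Lemma solution_packing t : solution r c k t ->
  packing n above below k.-1 (m - k) (entry c)
    (fun i => t (k - i)) (mirror n below (fun i => t (k + i))).
Proof.
move=> [t_in t_nest t_cov]; have [k1m rkn] := rk.
have tk : t k = 1 by have := t_in k k1m; rewrite rkn; lia.
have yc : chain below (fun i => t (k + i)) (m - k).
  split=> [|i im]; first by rewrite addn0.
  have := t_nest (k + i.+1); rewrite /nested /towards /below ifF; last lia.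
  by rewrite addnS /=; apply; lia.
split.
- split=> [|i ik]; first by rewrite subn0.
  have := t_nest (k - i.+1); rewrite /nested /towards /above ifT; last lia.
  by rewrite -subSn ?subSS; [apply; lia | lia].
- exact: chain_mirror below0 yc.
move=> j jn; rewrite -t_cov // covered_chains /total tk.
rewrite coverage_mirror ?subKn; [| lia | exact: below0 | exact: yc | lia].
have -> : (1 <= j < 1 + n) by lia.
by rewrite /coverage; lia.
Qed.

Lemma packing_solution x y :
  packing n above below k.-1 (m - k) (entry c) x y -> solution r c k (stack x y).
Proof.
move=> [xc yc cov]; have [k1m rkn] := rk.
have up i : i <= k -> stack x y i = x (k - i) by rewrite /stack => ->.
have mc := chain_mirror below0 yc.
(* Row k can be read off either chain, as both start it in column 1. *)
have down i : k <= i -> stack x y i = mirror n below y (i - k).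
  rewrite /stack leq_eqVlt => /orP [/eqP <- | ki]; last by rewrite leqNgt ki.
  by rewrite leqnn subnn; case: xc => ->; case: mc => ->.
split.
- move=> i im; have [ik | ik] := leqP i k.
    have := chain_in above0 xc (i := k - i); rewrite up // /above subKn //; apply; lia.
  have := chain_in below0 mc (i := i - k); rewrite down; last lia.
  by rewrite /below subnKC; [apply; lia | lia].
- move=> i im ik; rewrite /nested /towards; case: ifP => lt_ik.
    have [_ /(_ (k - i.+1))] := xc; rewrite !up /above; try lia.
    by rewrite -subSn ?subSS ?subKn; try lia; apply; lia.
  have [_ /(_ (i.-1 - k))] := mc; rewrite !down /below; try lia.
  have -> : (i.-1 - k).+1 = i - k by lia.
  by rewrite !subnKC; [apply; lia | lia | lia].
move=> j jn; rewrite -cov // covered_chains /total /=.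
have -> : stack x y k = 1 by rewrite up // subnn; case: xc.
have -> : (1 <= j < 1 + n) by lia.
rewrite addn1 addSn; congr (_ + _).+1.
  by apply: eq_in_count => i; rewrite mem_iota => ik; rewrite up ?subKn //; lia.
rewrite -(coverage_mirror below0 yc) //; apply: eq_in_count => i; rewrite mem_iota => ik.
by rewrite down ?addKn //; lia.
Qed.

End Correspondence.

(** * Two runs in parallel *)

(* One end of the window of a run, with the chain of cnt rows placed from there:
   off and ptr are the offsets of these rows and of the window from this end,
   base the number of rows at the last restart, hit the number of rows of the
   opposite chain known to reach ptr, kept that of the own rows not known to end
   before ptr. *)
Record side := Side {
  cnt : nat; base : nat; off : nat -> nat; ptr : nat; hit : nat; kept : nat;
  len : nat -> nat; bound : nat; col : nat -> nat }.

Definition set_hit p v :=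
  Side (cnt p) (base p) (off p) (ptr p) v (kept p) (len p) (bound p) (col p).
Definition set_kept p v :=
  Side (cnt p) (base p) (off p) (ptr p) (hit p) v (len p) (bound p) (col p).
Definition set_ptr p v :=
  Side (cnt p) (base p) (off p) v (hit p) (kept p) (len p) (bound p) (col p).

Definition grow p v :=
  Side (cnt p).+1 (base p) (fun i => if i == (cnt p).+1 then v else off p i)
       (ptr p) (hit p) (kept p).+1 (len p) (bound p) (col p).

Section Sides.

Variable n : nat.
Hypothesis n_gt0 : 0 < n.

Implicit Types p q : side.

Record statics p q : Prop := Statics {
  len_p0 : len p 0 = n;
  len_q0 : len q 0 = n;
  len_p : forall i, 1 <= i <= bound p -> 0 < len p i;
  len_q : forall i, 1 <= i <= bound q -> 0 < len q i;
  col_pq : forall j, 1 <= j <= n -> col q j = col p (n.+1 - j) }.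

Lemma statics_swap p q : statics p q -> statics q p.
Proof. by case=> ? ? ? ? cpq; split => // j jn; rewrite cpq ?subKn //; lia. Qed.

Definition bounds p q : bool :=
  [&& base p <= kept p, kept p <= cnt p, hit p <= cnt q, 0 < ptr p & cnt p <= bound p].

(** Unlike [halves], this is maintained for failed runs too. A restart needs it to show that the
    pointers of the overwritten run do not move back. *)
Definition low p q : Prop := forall j, 1 <= j < ptr p -> col p j <= (cnt p + cnt q).+1.

Definition halves p q : Prop :=
  half n (len p) (len q) (col p) (cnt p) (base p) (off p) (cnt q) (off q)
       (ptr p) (ptr q) (hit p) (kept p).

Definition alive p q : Prop := off p (cnt p) <= n /\ off q (cnt q) <= n.

Record slot_ok p q : Prop := SlotOk {
  bounds_p : bounds p q; bounds_q : bounds q p;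
  low_p : low p q; low_q : low q p;
  ptr_pq : ptr p + ptr q <= n.+2;
  halvesP : alive p q -> halves p q /\ halves q p }.

Lemma slot_ok_swap p q : slot_ok p q -> slot_ok q p.
Proof.
by case=> ? ? ? ? ? hv; split => //; [rewrite addnC | case=> ? ?; apply/and_comm/hv].
Qed.

Definition touches p q : bool :=
  (hit p < cnt q) && (n.+2 <= ptr p + off q (hit p).+1 + len q (hit p).+1).
Definition drops p : bool :=
  (base p < kept p) && (off p (kept p) + len p (kept p) <= ptr p).
Definition saturates p : bool := col p (ptr p) == (kept p + hit p).+1.
Definition stops p q : Prop :=
  ptr p + ptr q <= n.+1 -> [|| touches p q, drops p | saturates p] = false.

Definition fits p q : bool :=
  [&& off p (cnt p) <= ptr p,
      ptr p + len p (cnt p).+1 <= off p (cnt p) + len p (cnt p)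
    & ptr p + ptr q + len p (cnt p).+1 <= n.+2].

(* The offset n + 1 marks a run that failed: no later row fits next to it. *)
Definition extend p q : side := grow p (if fits p q then ptr p else n.+1).

(* Balanced, with pointers known to be final: the last two conditions ensure that
   restarting the other run does not move its pointers backwards. *)
Definition ripe p q : bool :=
  [&& ptr p + ptr q <= n.+1, off p (cnt p) <= ptr p, off q (cnt q) <= ptr q,
      cnt q <= hit p, cnt p <= hit q, (cnt p + cnt q).+1 < col p (ptr p)
    & (cnt q + cnt p).+1 < col q (ptr q)].

Definition settle p q : side :=
  Side (cnt p) (cnt p) (off p) (ptr p) (cnt q) (cnt p) (len p) (bound p) (col p).

(** Side p' of a run just overwritten by the reflection of the run p, q. Its rows correspond to
    those of p, while pointer and column sums come from the other end, q. *)
Record reflects p q p' : Prop := Reflects {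
  cntE : cnt p' = cnt p; baseE : base p' = cnt p; ptrE : ptr p' = ptr q;
  hitE : hit p' = cnt q; keptE : kept p' = cnt p; lenE : len p' = len p;
  boundE : bound p' = bound p; colE : col p' = col q;
  offE : forall i, i <= cnt p -> off p' i + off p i + len p i = n.+2 }.

Definition agrees p q : Prop := exists X Y,
  [/\ packing n (len p) (len q) (bound p) (bound q) (col p) X Y,
      forall i, i <= cnt p -> X i = off p i & forall i, i <= cnt q -> Y i = off q i].

Lemma agrees_swap p q : statics p q -> agrees p q -> agrees q p.
Proof.
move=> [p0 q0 _ _ cpq] [X [Y [XY Xx Yy]]]; exists Y, X; split => //.
by apply: packing_swap XY.
Qed.

Lemma agrees_alive p q : statics p q -> slot_ok p q -> agrees p q -> alive p q.
Proof.
move=> [p0 q0 lp lq _] [/and5P [_ _ _ _ bp] /and5P [_ _ _ _ bq] _ _ _ _].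
have le_n l N x a : l 0 = n -> (forall i, 1 <= i <= N -> 0 < l i) -> chain l x N ->
    a <= N -> x a <= n.
  move=> l0 lN xc aN; have := chain_in l0 xc aN.
  by case: a aN => [|a] aN; [rewrite l0; lia | have := lN a.+1; lia].
move=> [X [Y [[Xc Yc _] Xx Yy]]]; split; first by rewrite -Xx //; apply: le_n Xc bp.
by rewrite -Yy //; apply: le_n Yc bq.
Qed.

Section Pair.

Variables p q : side.
Hypothesis pq : statics p q.
Hypothesis ok : slot_ok p q.

Lemma slot_ok_hit : touches p q -> slot_ok (set_hit p (hit p).+1) q.
Proof.
case: pq ok => p0 q0 lp lq cpq [/and5P [b1 b2 b3 b4 b5] /and5P [d1 d2 d3 d4 d5] wp wq pt hv].
move=> /andP [lt_hit touch]; split => //; try by rewrite /bounds /=; lia.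
move=> al; have [h1 h2] := hv al; split => //.
exact: (half_U p0 q0 b5 d5 b1 b2 b3 d1 d2 d3 b4 d4 h1).
Qed.

Lemma slot_ok_kept : drops p -> slot_ok (set_kept p (kept p).-1) q.
Proof.
case: pq ok => p0 q0 lp lq cpq [/and5P [b1 b2 b3 b4 b5] /and5P [d1 d2 d3 d4 d5] wp wq pt hv].
move=> /andP [lt_kept drop]; split => //; try by rewrite /bounds /=; lia.
move=> al; have [h1 h2] := hv al; split => //.
exact: (half_W p0 q0 b5 d5 b1 b2 b3 d1 d2 d3 b4 d4 h1).
Qed.

Lemma slot_ok_ptr : ptr p + ptr q <= n.+1 -> ~~ touches p q -> ~~ drops p ->
  saturates p -> slot_ok (set_ptr p (ptr p).+1) q.
Proof.
case: pq ok => p0 q0 lp lq cpq [/and5P [b1 b2 b3 b4 b5] /and5P [d1 d2 d3 d4 d5] wp wq pt hv].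
move=> pt' touch drop /eqP sat; split; try by rewrite /bounds /=; lia.
- move=> j /= jp; have [-> | ne] := eqVneq j (ptr p); first by rewrite sat; lia.
  by apply: wp; lia.
- by [].
move=> al; have [h1 h2] := hv al.
apply: (half_ptr p0 q0 b5 d5 b1 b2 b3 d1 d2 d3 b4 d4 h1 h2 pt').
rewrite sat; apply: (total_scan p0 q0 b5 d5 b1 b2 b3 d1 d2 d3 b4 d4 h1 h2 pt').
  by move: touch; rewrite /touches; lia.
by move: drop; rewrite /drops; lia.
Qed.

Lemma slot_ok_extend : cnt p < bound p -> 0 < len p (cnt p).+1 -> slot_ok (extend p q) q.
Proof.
case: pq ok => p0 q0 lp lq cpq [/and5P [b1 b2 b3 b4 b5] /and5P [d1 d2 d3 d4 d5] wp wq pt hv].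
move=> pb l1; split; try by rewrite /bounds /=; lia.
- by move=> j /= /wp; lia.
- by move=> j /= /wq; lia.
(* If the row does not fit, the offset n + 1 makes the run not alive, and nothing is claimed about
   [halves]. *)
rewrite /alive /= eqxx; case: ifP => [fit [_ alq] | _ [] ]; last by rewrite ltnn.
have /and3P [f1 f2 f3] := fit.
have [|h1 h2] := hv; first by split => //; lia.
have xx i : i <= cnt p -> (if i == (cnt p).+1 then ptr p else off p i) = off p i.
  by case: eqP => // ->; rewrite ltnn.
rewrite /halves /extend fit /=.
apply: (half_add p0 q0 lp b5 d5 b1 b2 b3 d1 d2 d3 b4 d4 h1 h2) => //.
  by rewrite eqxx.
lia.
Qed.

(** The pointers in [ripe] bound the last offsets by n, so a failed run is never ripe. *)
Lemma ripe_alive : ripe p q -> halves p q /\ halves q p.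
Proof.
case: ok => /and5P [b1 b2 b3 b4 b5] /and5P [d1 d2 d3 d4 d5] _ _ _ hv /and5P [r1 r2 r3 _ _].
by apply: hv; split; lia.
Qed.

Lemma slot_ok_settle : ripe p q -> slot_ok (settle p q) (settle q p).
Proof.
move=> r; have [h1 h2] := ripe_alive r.
case: pq ok => p0 q0 lp lq cpq [/and5P [b1 b2 b3 b4 b5] /and5P [d1 d2 d3 d4 d5] wp wq pt _].
move: r => /and5P [r1 r2 r3 r4 /and3P [r5 r6 r7]].
split; try by rewrite /bounds /=; lia.
- exact: wp.
- exact: wq.
move=> _; split.
  by apply: (half_commit p0 q0 b5 d5 b1 b2 b3 d1 d2 d3 b4 d4 h1 h2); lia.
by apply: (half_commit q0 p0 d5 b5 d1 d2 d3 b1 b2 b3 d4 b4 h2 h1); lia.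
Qed.

(** After a restart all rows count at both ends, and by the strict inequalities in [ripe] they do
    not saturate the columns there; no new scan is needed. *)
Lemma stops_settle : ripe p q -> stops (settle p q) (settle q p).
Proof.
move=> /and5P [r1 r2 r3 r4 /and3P [r5 r6 r7]] _.
by rewrite /touches /drops /saturates /=; lia.
Qed.

Lemma slot_ok_reflect p' q' : ripe p q -> reflects p q p' -> reflects q p q' ->
  slot_ok p' q'.
Proof.
move=> r; have [h1 h2] := ripe_alive r.
case: pq ok => p0 q0 lp lq cpq [/and5P [b1 b2 b3 b4 b5] /and5P [d1 d2 d3 d4 d5] wp wq pt _].
move: r => /and5P [r1 r2 r3 r4 /and3P [r5 r6 r7]].
move=> [e1 e2 e3 e4 e5 e6 e7 e8 e9] [f1 f2 f3 f4 f5 f6 f7 f8 f9].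
split.
- by rewrite /bounds e1 e2 e3 e4 e5 e7 f1; lia.
- by rewrite /bounds f1 f2 f3 f4 f5 f7 e1; lia.
- by move=> j; rewrite e1 f1 e3 e8 addnC; apply: wq.
- by move=> j; rewrite e1 f1 f3 f8 addnC; apply: wp.
- by rewrite e3 f3; lia.
have [xc _ _ _ _] := h1; have [yc _ _ _ _] := h2.
have xe i : i <= cnt p -> off p' i = mirror n (len p) (off p) i.
  by move=> ic; have := e9 i ic; have := mirrorK p0 xc ic; lia.
have ye i : i <= cnt q -> off q' i = mirror n (len q) (off q) i.
  by move=> ic; have := f9 i ic; have := mirrorK q0 yc ic; lia.
move=> _; rewrite /halves !(e1, e2, e3, e4, e5, e6, e8) !(f1, f2, f3, f4, f5, f6, f8).
split.
  by apply: (half_mirror p0 q0 b5 d5 b1 b2 b3 d1 d2 d3 b4 d4 h1 h2) => //; lia.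
by apply: (half_mirror q0 p0 d5 b5 d1 d2 d3 b1 b2 b3 d4 b4 h2 h1) => //; lia.
Qed.

Lemma stops_reflect p' q' : ripe p q -> reflects p q p' -> reflects q p q' -> stops p' q'.
Proof.
move=> /and5P [r1 r2 r3 r4 /and3P [r5 r6 r7]].
move=> [e1 e2 e3 e4 e5 e6 e7 e8 e9] [f1 f2 f3 f4 f5 f6 f7 f8 f9] _.
by rewrite /touches /drops /saturates e2 e3 e4 e5 e8 f1; lia.
Qed.

Lemma stops_stopped : stops p q -> stopped n (len p) (len q) (col p) (base p) (cnt q)
  (off p) (off q) (ptr p) (ptr q) (hit p) (kept p).
Proof.
move=> st ab; have := st ab; rewrite /touches /drops /saturates.
by move=> /negbT; rewrite !negb_or => /and3P [s1 s2 /eqP s3]; split; lia.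
Qed.

Lemma slot_packing : alive p q -> cnt p = bound p -> cnt q = bound q ->
  n.+2 <= ptr p + ptr q ->
  packing n (len p) (len q) (bound p) (bound q) (col p) (off p) (off q).
Proof.
case: pq ok => p0 q0 lp lq cpq [/and5P [b1 b2 b3 b4 b5] /and5P [d1 d2 d3 d4 d5] wp wq pt hv].
move=> al ea eb ab; have [h1 h2] := hv al.
exact: (half_packing p0 q0 cpq b5 d5 b1 b2 b3 d1 d2 d3 b4 d4 h1 h2).
Qed.

Lemma agrees_end : agrees p q -> stops p q -> cnt p = bound p -> cnt q = bound q ->
  n.+2 <= ptr p + ptr q.
Proof.
move=> ag st ea eb; have al := agrees_alive pq ok ag.
case: pq ok => p0 q0 lp lq cpq [/and5P [b1 b2 b3 b4 b5] /and5P [d1 d2 d3 d4 d5] wp wq pt hv].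
have [h1 h2] := hv al; have [X [Y [XY Xx Yy]]] := ag.
exact: (stopped_end p0 q0 b5 d5 b1 b2 b3 d1 d2 d3 b4 d4 h1 h2 XY Xx Yy (stops_stopped st)).
Qed.

Lemma agrees_ripe X Y :
  packing n (len p) (len q) (bound p) (bound q) (col p) X Y -> ripe p q -> agrees p q.
Proof.
move=> XY r; have [h1 h2] := ripe_alive r.
case: pq ok => p0 q0 lp lq cpq [/and5P [b1 b2 b3 b4 b5] /and5P [d1 d2 d3 d4 d5] wp wq pt hv].
move: r => /and5P [r1 r2 r3 r4 /and3P [r5 r6 r7]].
by apply: (balanced_packing p0 q0 lp lq cpq b5 d5 b1 b2 b3 d1 d2 d3 b4 d4 h1 h2 XY); lia.
Qed.

Lemma packing_reflect p' q' X Y : reflects p q p' -> reflects q p q' ->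
  packing n (len p) (len q) (bound p) (bound q) (col p) X Y ->
  (forall i, i <= cnt p -> X i = off p i) -> (forall i, i <= cnt q -> Y i = off q i) ->
  let X' := mirror n (len p) X in let Y' := mirror n (len q) Y in
  [/\ packing n (len p') (len q') (bound p') (bound q') (col p') X' Y',
      forall i, i <= cnt p' -> X' i = off p' i & forall i, i <= cnt q' -> Y' i = off q' i].
Proof.
case: pq ok => p0 q0 lp lq cpq [/and5P [b1 b2 b3 b4 b5] /and5P [d1 d2 d3 d4 d5] wp wq pt hv].
move=> [e1 e2 e3 e4 e5 e6 e7 e8 e9] [f1 f2 f3 f4 f5 f6 f7 f8 f9] XY Xx Yy /=.
rewrite e6 f6 e7 f7 e8 e1 f1; have [Xc Yc _] := XY.
split; first exact: (packing_mirror p0 q0 cpq XY).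
  move=> i ic; have := e9 i ic; have := mirrorK p0 Xc (leq_trans ic b5); rewrite Xx //; lia.
move=> i ic; have := f9 i ic; have := mirrorK q0 Yc (leq_trans ic d5); rewrite Yy //; lia.
Qed.

Lemma agrees_next X Y :
  packing n (len p) (len q) (bound p) (bound q) (col p) X Y ->
  (forall i, i <= cnt p -> X i = off p i) -> (forall i, i <= cnt q -> Y i = off q i) ->
  stops p q -> stops q p -> cnt p < bound p -> len q (cnt q).+1 <= len p (cnt p).+1 ->
  (fits p q /\ X (cnt p).+1 = ptr p) \/
  [/\ ripe p q, X (cnt p).+1 <> ptr p & X (cnt p).+1 + len p (cnt p).+1 + ptr q = n.+2].
Proof.
move=> XY Xx Yy st st' pb le_len.
have al : alive p q by apply: agrees_alive pq ok _; exists X, Y.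
case: pq ok => p0 q0 lp lq cpq [/and5P [b1 b2 b3 b4 b5] /and5P [d1 d2 d3 d4 d5] wp wq pt hv].
have [h1 h2] := hv al; have s1 := stops_stopped st.
have [_ hp _ _ _] := h1; have [_ hq _ _ _] := h2.
have s2 : stopped n (len q) (len p) (col q) (base q) (cnt p)
    (off q) (off p) (ptr q) (ptr p) (hit q) (kept q).
  move=> ab; have := st' ab; rewrite /touches /drops /saturates.
  by move=> /negbT; rewrite !negb_or => /and3P [t1 t2 /eqP t3]; split; lia.
have := next_row p0 q0 lp cpq b5 d5 b1 b2 b3 d1 d2 d3 b4 d4 h1 h2 s1 s2 XY Xx Yy pb le_len.
case=> [[f1 f2 f3] | [ab eU eV ne e]]; [left; split => // | right; split => //].
  by rewrite /fits hp; lia.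
have := stopped_balanced p0 q0 b5 d5 b1 b2 b3 d1 d2 d3 b4 d4 h1 h2 s1 XY Xx Yy ab eU eV.
have ba : ptr q + ptr p <= n.+1 by lia.
have := stopped_balanced q0 p0 d5 b5 d1 d2 d3 b1 b2 b3 d4 b4 h2 h1 s2
  (packing_swap p0 q0 cpq XY) Yy Xx ba eV eU.
by rewrite /ripe hp hq; lia.
Qed.

Lemma agrees_extend X Y :
  packing n (len p) (len q) (bound p) (bound q) (col p) X Y ->
  (forall i, i <= cnt p -> X i = off p i) -> (forall i, i <= cnt q -> Y i = off q i) ->
  fits p q -> X (cnt p).+1 = ptr p -> agrees (extend p q) q.
Proof.
move=> XY Xx Yy fit eX; exists X, Y; split => //= i; rewrite fit.
by case: eqP => [-> // | ne] ic; apply: Xx; lia.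
Qed.

End Pair.

(* S i s is side s of run i. *)
Section Slots.

Variable S : bool -> bool -> side.
Hypothesis S_statics : forall i, statics (S i false) (S i true).

Definition slots_ok : Prop := forall i, slot_ok (S i false) (S i true).
Definition some_agrees : Prop := exists i, agrees (S i false) (S i true).
Definition slots_stop : Prop := forall i s, stops (S i s) (S i (~~ s)).
(** Either the end for the next row is forced in any run that agrees with a solution, or the runs
    are reflections of each other and together try both ends. *)
Definition committed : Prop :=
  (forall i, ~~ ripe (S i false) (S i true)) \/
  (forall i s, reflects (S i s) (S i (~~ s)) (S (~~ i) s)).

Lemma slots_sym (P : side -> side -> Prop) i : (forall p q, P p q -> P q p) ->
  P (S i false) (S i true) -> forall s, P (S i s) (S i (~~ s)).
Proof. by move=> P_sym P_i [] //=; apply: P_sym. Qed.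

Lemma statics_side i s : statics (S i s) (S i (~~ s)).
Proof. exact: slots_sym statics_swap (S_statics i) s. Qed.

Lemma slot_ok_side i s : slots_ok -> slot_ok (S i s) (S i (~~ s)).
Proof. by move=> ok; apply: slots_sym slot_ok_swap (ok i) s. Qed.

Lemma agrees_side i s : agrees (S i false) (S i true) -> agrees (S i s) (S i (~~ s)).
Proof. by case: s => //=; apply: agrees_swap. Qed.

Lemma ripe_side i s : ripe (S i s) (S i (~~ s)) = ripe (S i false) (S i true).
Proof. by case: s => //=; rewrite /ripe [ptr _ + _]addnC; lia. Qed.

Lemma slots_extend s : slots_ok -> some_agrees -> slots_stop -> committed ->
  (forall i, cnt (S i s) < bound (S i s)) ->
  (forall i, len (S i (~~ s)) (cnt (S i (~~ s))).+1 <= len (S i s) (cnt (S i s)).+1) ->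
  exists i, agrees (extend (S i s) (S i (~~ s))) (S i (~~ s)).
Proof.
move=> ok [i ag] st comm lt_cnt le_len.
have [X [Y [XY Xx Yy]]] := agrees_side s ag.
have st' : stops (S i (~~ s)) (S i s) by have := st i (~~ s); rewrite negbK.
have := agrees_next (statics_side i s) (slot_ok_side i s ok) XY Xx Yy (st i s) st'
  (lt_cnt i) (le_len i).
case=> [[fit eX] | [rp ne e]].
  by exists i; apply: agrees_extend XY Xx Yy fit eX.
(* The row touches the end that run i does not try. The other run holds the reflected rows, so it
   agrees with the reflected solution, in which the row starts at the pointer. *)
case: comm => [/(_ i) | refl]; first by rewrite -(ripe_side i s) rp.
have r1 := refl i s; have r2 : reflects (S i (~~ s)) (S i s) (S (~~ i) (~~ s)).
  by have := refl i (~~ s); rewrite negbK.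
have [XY' Xx' Yy'] := packing_reflect (statics_side i s) (slot_ok_side i s ok) r1 r2 XY Xx Yy.
have st2 : stops (S (~~ i) (~~ s)) (S (~~ i) s) by have := st (~~ i) (~~ s); rewrite negbK.
have := agrees_next (statics_side (~~ i) s) (slot_ok_side (~~ i) s ok) XY' Xx' Yy'
  (st (~~ i) s) st2 (lt_cnt _) (le_len _).
case=> [[fit eX] | [_ _]]; first by exists (~~ i); apply: agrees_extend XY' Xx' Yy' fit eX.
rewrite (cntE r1) (lenE r1) (ptrE r2) /mirror; lia.
Qed.

End Slots.

End Sides.

(** * The program *)

(** Termination, time and final memory in one predicate, so that bounds compose along the structure
    of a program. *)
Definition runs (S : program) (M : memory) (Q : nat -> memory -> Prop) : Prop :=
  exists t M', exec S M t M' /\ Q t M'.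

Lemma runs_weaken S M (Q Q' : nat -> memory -> Prop) :
  runs S M Q -> (forall t M', Q t M' -> Q' t M') -> runs S M Q'.
Proof. by move=> [t [M' [ex q]]] QQ'; exists t, M'; split; last exact: QQ'. Qed.

Lemma runs_skip M (Q : nat -> memory -> Prop) : Q 1 M -> runs Skip M Q.
Proof. by exists 1, M; split => //; constructor. Qed.

Lemma runs_store M a e1 e2 (Q : nat -> memory -> Prop) :
  Q 1 (update M a (eval M e1) (eval M e2)) -> runs (Store a e1 e2) M Q.
Proof. by move=> q; do 2!eexists; split; [constructor | exact: q]. Qed.

Lemma runs_seq S1 S2 M (Q : nat -> memory -> Prop) :
  runs S1 M (fun t1 M1 => runs S2 M1 (fun t2 M2 => Q (t1 + t2) M2)) ->
  runs (Seq S1 S2) M Q.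
Proof.
move=> [t1 [M1 [ex1 [t2 [M2 [ex2 q]]]]]]; exists (t1 + t2), M2.
by split => //; apply: exec_seq ex1 ex2.
Qed.

Lemma runs_if g S1 S2 M (Q : nat -> memory -> Prop) :
  runs (if holds M g then S1 else S2) M (fun t M' => Q t.+1 M') -> runs (If g S1 S2) M Q.
Proof. by move=> [t [M' [ex q]]]; exists t.+1, M'; split => //; constructor. Qed.

(** [phi] is both variant and time budget: the strict decrease pays for the test before each pass,
    and the extra unit for the last test. *)
Lemma runs_while g S (I : memory -> Prop) (phi : memory -> nat) M :
  (forall M1, I M1 -> holds M1 g ->
     runs S M1 (fun t M2 => I M2 /\ t + phi M2 < phi M1)) ->
  I M ->
  runs (While g S) M (fun t M' => [/\ I M', ~~ holds M' g & t + phi M' <= (phi M).+1]).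
Proof.
move=> body; have [b] := ubnP (phi M); elim: b M => // b IHb M lt_b IM.
have [gM | gM] := boolP (holds M g); last first.
  by exists 1, M; split; [constructor | split].
have [t1 [M1 [ex1 [IM1 lt1]]]] := body M IM gM.
have [|t2 [M2 [ex2 [IM2 gM2 lt2]]]] := IHb M1 _ IM1; first lia.
exists (t1 + t2).+1, M2; split; first exact: exec_while_pass ex1 ex2.
by split => //; lia.
Qed.

Definition var (a : nat) : expr := Fetch a (Const 0).
Definition set_var (a : nat) (e : expr) : program := Store a (Const 0) e.
Definition rows_e : expr := Fetch 0 (Const 0).
Definition cols_e : expr := Fetch 0 (Const 1).
Definition succ_e (e : expr) : expr := Plus e (Const 1).
Definition or_g (g1 g2 : guard) : guard := Neg (And (Neg g1) (Neg g2)).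

(* Run true is the mirror image of run false; side false holds the rows above k,
   side true those below k. *)
Definition kA : nat := 5.
Definition cntA (s : bool) : nat := if s then 7 else 6.
Definition baseA (s : bool) : nat := if s then 9 else 8.
Definition ptrA (i s : bool) : nat :=
  if i then (if s then 13 else 12) else (if s then 11 else 10).
Definition hitA (i s : bool) : nat :=
  if i then (if s then 17 else 16) else (if s then 15 else 14).
Definition keptA (i s : bool) : nat :=
  if i then (if s then 21 else 20) else (if s then 19 else 18).
Definition offA (i s : bool) : nat :=
  if i then (if s then 25 else 24) else (if s then 23 else 22).
Definition outA : nat := 26.

Definition len_e (s : bool) (e : expr) : expr :=
  Fetch 1 (if s then Plus (var kA) e else Minus (var kA) e).
Definition col_e (i s : bool) (e : expr) : expr :=
  Fetch 2 (if i (+) s then Minus (succ_e cols_e) e else e).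

Definition touch_g (i s : bool) : guard :=
  And (Leq (succ_e (var (hitA i s))) (var (cntA (~~ s))))
      (Leq (Plus cols_e (Const 2))
           (Plus (Plus (var (ptrA i s)) (Fetch (offA i (~~ s)) (succ_e (var (hitA i s)))))
                 (len_e (~~ s) (succ_e (var (hitA i s)))))).
Definition drop_g (i s : bool) : guard :=
  And (Leq (succ_e (var (baseA s))) (var (keptA i s)))
      (Leq (Plus (Fetch (offA i s) (var (keptA i s))) (len_e s (var (keptA i s))))
           (var (ptrA i s))).
Definition saturate_g (i s : bool) : guard :=
  let v := succ_e (Plus (var (keptA i s)) (var (hitA i s))) in
  And (Leq (col_e i s (var (ptrA i s))) v) (Leq v (col_e i s (var (ptrA i s)))).

Definition scan (i s : bool) : program :=
  While (And (Leq (Plus (var (ptrA i s)) (var (ptrA i (~~ s)))) (succ_e cols_e))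
             (or_g (touch_g i s) (or_g (drop_g i s) (saturate_g i s))))
    (If (touch_g i s) (set_var (hitA i s) (succ_e (var (hitA i s))))
    (If (drop_g i s) (set_var (keptA i s) (Minus (var (keptA i s)) (Const 1)))
       (set_var (ptrA i s) (succ_e (var (ptrA i s)))))).

Definition scan_all : program :=
  Seq (scan false false) (Seq (scan false true) (Seq (scan true false) (scan true true))).

Definition fits_g (i s : bool) : guard :=
  And (Leq (Fetch (offA i s) (var (cntA s))) (var (ptrA i s)))
  (And (Leq (Plus (var (ptrA i s)) (len_e s (succ_e (var (cntA s)))))
            (Plus (Fetch (offA i s) (var (cntA s))) (len_e s (var (cntA s)))))
       (Leq (Plus (Plus (var (ptrA i s)) (var (ptrA i (~~ s))))
                  (len_e s (succ_e (var (cntA s)))))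
            (Plus cols_e (Const 2)))).

Definition place (i s : bool) : program :=
  Seq (If (fits_g i s)
         (Store (offA i s) (succ_e (var (cntA s))) (var (ptrA i s)))
         (Store (offA i s) (succ_e (var (cntA s))) (succ_e cols_e)))
      (set_var (keptA i s) (succ_e (var (keptA i s)))).

Definition add_row (s : bool) : program :=
  Seq (place false s) (Seq (place true s) (set_var (cntA s) (succ_e (var (cntA s))))).

Definition ripe_g (i : bool) : guard :=
  let s := succ_e (Plus (var (cntA false)) (var (cntA true))) in
  And (Leq (Plus (var (ptrA i false)) (var (ptrA i true))) (succ_e cols_e))
  (And (Leq (Fetch (offA i false) (var (cntA false))) (var (ptrA i false)))
  (And (Leq (Fetch (offA i true) (var (cntA true))) (var (ptrA i true)))
  (And (Leq (var (cntA true)) (var (hitA i false)))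
  (And (Leq (var (cntA false)) (var (hitA i true)))
  (And (Leq (succ_e s) (col_e i false (var (ptrA i false))))
       (Leq (succ_e s) (col_e i true (var (ptrA i true))))))))).

(** [base] is the loop counter: the rows up to it are already reflected, and at the end it equals
    [cnt], as a restart requires. *)
Definition copy (i s : bool) : program :=
  While (Leq (succ_e (var (baseA s))) (var (cntA s)))
    (Seq (set_var (baseA s) (succ_e (var (baseA s))))
         (Store (offA (~~ i) s) (var (baseA s))
            (Minus (Plus cols_e (Const 2))
                   (Plus (Fetch (offA i s) (var (baseA s))) (len_e s (var (baseA s))))))).

Definition settle_side (i s : bool) : program :=
  Seq (set_var (hitA i s) (var (cntA (~~ s)))) (set_var (keptA i s) (var (cntA s))).

Definition reset (i : bool) : program :=
  Seq (set_var (ptrA (~~ i) false) (var (ptrA i true)))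
  (Seq (set_var (ptrA (~~ i) true) (var (ptrA i false)))
  (Seq (settle_side i false) (Seq (settle_side i true)
  (Seq (settle_side (~~ i) false) (settle_side (~~ i) true))))).

Definition commit (i : bool) : program :=
  Seq (copy i false) (Seq (copy i true) (reset i)).

Definition settle_all : program :=
  Seq scan_all (If (ripe_g false) (commit false) (If (ripe_g true) (commit true) Skip)).

(** * The memory as four sides; cost of scanning and copying *)

Section View.

Variables (m n : nat) (r : m.-tuple nat) (c : n.-tuple nat) (k : nat).
Hypothesis rc : reconstruction_input r c.
Hypothesis rk : full_row n r k.

Lemma n_gt0 : 0 < n.
Proof. by have [k1m rkn] := rk; rewrite -rkn; apply: (entry_gt0 rc). Qed.

Definition lenS (s : bool) : nat -> nat := if s then below r k else above r k.
Definition boundS (s : bool) : nat := if s then m - k else k.-1.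
Definition colS (i s : bool) : nat -> nat :=
  if i (+) s then fun j => entry c (n.+1 - j) else entry c.

Definition sideM (M : memory) (i s : bool) : side :=
  Side (M (cntA s) 0) (M (baseA s) 0) (M (offA i s)) (M (ptrA i s) 0)
       (M (hitA i s) 0) (M (keptA i s) 0) (lenS s) (boundS s) (colS i s).

Definition input_kept (M : memory) : Prop :=
  [/\ M 0 0 = m, M 0 1 = n, M kA 0 = k & M 1 =1 entry r] /\
  M 2 =1 entry c /\ M 3 0 = 0.

Lemma eval_len M s e : input_kept M -> eval M (len_e s e) = lenS s (eval M e).
Proof. by move=> [[_ _ kE rE] _]; case: s; rewrite /= rE kE. Qed.

Lemma eval_col M i s e : input_kept M -> eval M (col_e i s e) = colS i s (eval M e).
Proof.
move=> [[_ nE _ _] [cE _]]; rewrite /col_e /colS.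
by case: (i (+) s); rewrite /= cE // nE addn1.
Qed.

Lemma eval_cols M : input_kept M -> eval M cols_e = n.
Proof. by case=> [[]]. Qed.

(* Simplification must leave these expressions intact for [eval_len], [eval_col] and [eval_cols] to
   rewrite. *)
#[global] Opaque len_e col_e cols_e.

Lemma holds_and M g1 g2 : holds M (And g1 g2) = holds M g1 && holds M g2.
Proof. by []. Qed.

Lemma holds_or M g1 g2 : holds M (or_g g1 g2) = holds M g1 || holds M g2.
Proof. by rewrite /= negb_and !negbK. Qed.

Section Guards.

Variables (M : memory) (i : bool).
Hypothesis inp : input_kept M.

Lemma holds_touch s : holds M (touch_g i s) = touches n (sideM M i s) (sideM M i (~~ s)).
Proof.
by rewrite /= eval_len // (eval_cols inp) /= addn1 addn2.
Qed.

Lemma holds_drop s : holds M (drop_g i s) = drops (sideM M i s).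
Proof. by rewrite /= eval_len //= addn1. Qed.

Lemma holds_saturate s : holds M (saturate_g i s) = saturates (sideM M i s).
Proof. by rewrite /= eval_col //= addn1 /saturates eqn_leq. Qed.

Lemma holds_fits s : holds M (fits_g i s) = fits n (sideM M i s) (sideM M i (~~ s)).
Proof.
by rewrite /= !eval_len // (eval_cols inp) /= addn1 addn2.
Qed.

Lemma holds_ripe : holds M (ripe_g i) = ripe n (sideM M i false) (sideM M i true).
Proof.
rewrite /= !eval_col // (eval_cols inp) /= !addn1.
by rewrite /ripe /= (addnC (M 7 0)).
Qed.

End Guards.


Local Notation side_ok := (slot_ok n).

Record scanned (p p' : side) : Prop := Scanned {
  sc_cnt : cnt p' = cnt p; sc_base : base p' = base p; sc_off : off p' = off p;
  sc_ptr : ptr p <= ptr p'; sc_len : len p' = len p; sc_bound : bound p' = bound p;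
  sc_col : col p' = col p }.

Lemma agrees_scanned p q p' q' : scanned p p' -> scanned q q' ->
  agrees n p q -> agrees n p' q'.
Proof.
move=> [a1 _ a3 _ a5 a6 a7] [b1 _ b3 _ b5 b6 _] [X [Y XY]].
by exists X, Y; rewrite a1 a3 a5 a6 a7 b1 b3 b5 b6.
Qed.

(** A scan of the opposite end only advances the pointer there, which enters [stops] through its
    premise alone. Hence one scan per end suffices. *)
Lemma stops_scanned p q q' : scanned q q' -> stops n p q -> stops n p q'.
Proof.
move=> [e1 _ e3 e4 e5 _ _] st pt; rewrite /touches e1 e3 e5.
by apply: st; lia.
Qed.

Lemma set_ptr_side M i s v : sideM (update M (ptrA i s) 0 v) i s = set_ptr (sideM M i s) v.
Proof. by case: i s => [] []. Qed.

Lemma set_hit_side M i s v : sideM (update M (hitA i s) 0 v) i s = set_hit (sideM M i s) v.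
Proof. by case: i s => [] []. Qed.

Lemma set_kept_side M i s v : sideM (update M (keptA i s) 0 v) i s = set_kept (sideM M i s) v.
Proof. by case: i s => [] []. Qed.

Definition other_sides (M M' : memory) (i s : bool) : Prop :=
  forall i' s', (i', s') != (i, s) -> sideM M' i' s' = sideM M i' s'.

Lemma other_sides_ptr M i s v : other_sides M (update M (ptrA i s) 0 v) i s.
Proof. by case: i s => [] [] [] []. Qed.

Lemma other_sides_hit M i s v : other_sides M (update M (hitA i s) 0 v) i s.
Proof. by case: i s => [] [] [] []. Qed.

Lemma other_sides_kept M i s v : other_sides M (update M (keptA i s) 0 v) i s.
Proof. by case: i s => [] [] [] []. Qed.

Lemma other_sides_trans M M1 M2 i s :
  other_sides M M1 i s -> other_sides M1 M2 i s -> other_sides M M2 i s.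
Proof. by move=> o1 o2 i' s' ne; rewrite o2 // o1. Qed.

Definition is_private (a : nat) : bool := (a == 4) || (6 <= a).

Lemma input_update M a j v : is_private a -> input_kept M -> input_kept (update M a j v).
Proof.
move=> pa [[e1 e2 e3 e4] [e5 e6]].
have ne b : ~~ is_private b -> update M a j v b =1 M b.
  by move=> pb h; rewrite /update ifF //; case: eqP => // e; rewrite e pa in pb.
by do 2![split] => //; try move=> h; rewrite ne.
Qed.

(** The room left for the pointer and the two counters, each of which moves in one direction during
    a scan. Taking the final length of the opposite chain for N keeps rows added there from raising
    it. *)
Definition pot (p : side) (N : nat) : nat := (n.+2 - ptr p) + (N - hit p) + kept p.

Lemma neq_side (i s : bool) : (i, ~~ s) != (i, s).
Proof. by case: i s => [] []. Qed.

Lemma scan_run M i s :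
  input_kept M -> side_ok (sideM M i s) (sideM M i (~~ s)) ->
  statics n (sideM M i s) (sideM M i (~~ s)) ->
  runs (scan i s) M (fun t M' =>
    [/\ input_kept M', other_sides M M' i s, scanned (sideM M i s) (sideM M' i s),
        side_ok (sideM M' i s) (sideM M i (~~ s)) /\
        stops n (sideM M' i s) (sideM M i (~~ s))
      & t + 10 * pot (sideM M' i s) (boundS (~~ s))
          <= (10 * pot (sideM M i s) (boundS (~~ s))).+1]).
Proof.
move=> inp ok stat; set q := sideM M i (~~ s).
pose I M1 := [/\ input_kept M1, other_sides M M1 i s, scanned (sideM M i s) (sideM M1 i s)
               & side_ok (sideM M1 i s) q].
(* A pass takes at most four steps, its test included; 10 is a convenient upper bound. *)
pose phi M1 := 10 * pot (sideM M1 i s) (boundS (~~ s)).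
have guard M1 : I M1 -> holds M1 (And (Leq (Plus (var (ptrA i s)) (var (ptrA i (~~ s))))
      (succ_e cols_e)) (or_g (touch_g i s) (or_g (drop_g i s) (saturate_g i s))))
    = (ptr (sideM M1 i s) + ptr q <= n.+1) &&
      [|| touches n (sideM M1 i s) q, drops (sideM M1 i s) | saturates (sideM M1 i s)].
  move=> [inp1 oth _ _]; have qE : q = sideM M1 i (~~ s) by rewrite oth ?neq_side.
  rewrite holds_and !holds_or holds_touch // holds_drop // holds_saturate // qE.
  by rewrite /= (eval_cols inp1) addn1.
have body M1 : I M1 -> holds M1 (And (Leq (Plus (var (ptrA i s)) (var (ptrA i (~~ s))))
      (succ_e cols_e)) (or_g (touch_g i s) (or_g (drop_g i s) (saturate_g i s)))) ->
    runs (If (touch_g i s) (set_var (hitA i s) (succ_e (var (hitA i s))))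
         (If (drop_g i s) (set_var (keptA i s) (Minus (var (keptA i s)) (Const 1)))
            (set_var (ptrA i s) (succ_e (var (ptrA i s)))))) M1
      (fun t M2 => I M2 /\ t + phi M2 < phi M1).
  move=> IM1; rewrite guard // => /andP [ab step].
  have [inp1 oth1 sc1 ok1] := IM1; have qE : q = sideM M1 i (~~ s) by rewrite oth1 ?neq_side.
  have stat1 : statics n (sideM M1 i s) q.
    by case: stat => ? ? ? ? ?; split.
  have [/and5P [b1 b2 b3 b4 b5] /and5P [d1 d2 d3 d4 d5] _ _ _ _] := ok1.
  have [sc1a sc1b sc1c sc1d _ _ _] := sc1.
  apply: runs_if; rewrite holds_touch // -qE; case: ifP => touch.
    apply: runs_store; have := slot_ok_hit n_gt0 stat1 ok1 touch.
    rewrite /= addn1 -set_hit_side => ok2; split.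
      split => //; first by apply: input_update => //; case: (i) (s) => [] [].
        by apply: (@other_sides_trans _ M1) oth1 _; apply: other_sides_hit.
      by rewrite set_hit_side.
    have : hit (sideM M1 i s) < cnt q by case/andP: touch.
    by rewrite /phi /pot set_hit_side /=; move: d5 => /=; lia.
  apply: runs_if; rewrite holds_drop //; case: ifP => drop.
    apply: runs_store; have := slot_ok_kept n_gt0 stat1 ok1 drop.
    rewrite /= subn1 -set_kept_side => ok2; split.
      split => //; first by apply: input_update => //; case: (i) (s) => [] [].
        by apply: (@other_sides_trans _ M1) oth1 _; apply: other_sides_kept.
      by rewrite set_kept_side.
    have : base (sideM M1 i s) < kept (sideM M1 i s) by case/andP: drop.
    by rewrite /phi /pot set_kept_side /=; lia.
  have sat : saturates (sideM M1 i s) by move: step; rewrite touch drop.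
  apply: runs_store; have := slot_ok_ptr n_gt0 stat1 ok1 ab (negbT touch) (negbT drop) sat.
  rewrite /= addn1 -set_ptr_side => ok2; split.
    split => //; first by apply: input_update => //; case: (i) (s) => [] [].
      by apply: (@other_sides_trans _ M1) oth1 _; apply: other_sides_ptr.
    by rewrite set_ptr_side; split => //=; move: sc1d => /=; lia.
  by rewrite /phi /pot set_ptr_side /=; move: ab => /=; lia.
have IM : I M by split.
apply: runs_weaken (runs_while body IM) _ => t M' [IM' gM' le_t].
have [inp' oth' sc' ok'] := IM'; split => //; split => // ab; move: gM'.
by rewrite guard // ab => /negbTE.
Qed.

Lemma sideM_statics M i : statics n (sideM M i false) (sideM M i true).
Proof.
have [k1m _] := rk; split; rewrite /= ?(above0 rk) ?(below0 rk) //.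
- by move=> h hk; apply: (entry_gt0 rc); lia.
- by move=> h hk; apply: (entry_gt0 rc); lia.
by move=> j jn; rewrite /colS; case: i => //=; rewrite subKn //; lia.
Qed.

Definition pots M i s := pot (sideM M i s) (boundS (~~ s)).

(* A pass of scan lowers a pot by 1.  A restart raises each kept by at most the
   number of rows copied, which the weight 3 of base pays twice over; a new row
   raises two kept by 1, so that the weight 13 of cnt leaves 11 units, that is
   110 steps, for the rest of a pass of the main loop. *)
Definition Phi M :=
  pots M false false + pots M false true + pots M true false + pots M true true
  + 3 * ((boundS false - M (baseA false) 0) + (boundS true - M (baseA true) 0))
  + 13 * ((boundS false - M (cntA false) 0) + (boundS true - M (cntA true) 0)).

Definition all_scanned M M' := forall i s, scanned (sideM M i s) (sideM M' i s).

Lemma all_scanned_trans M M1 M2 : all_scanned M M1 -> all_scanned M1 M2 -> all_scanned M M2.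
Proof.
move=> sc1 sc2 i s; case: (sc1 i s) (sc2 i s) => [a1 a2 a3 a4 a5 a6 a7] [b1 b2 b3 b4 b5 b6 b7].
by split; [rewrite b1 | rewrite b2 | rewrite b3 | lia | rewrite b5 | rewrite b6 | rewrite b7].
Qed.

Lemma scan_step M i s : input_kept M -> slots_ok n (sideM M) ->
  runs (scan i s) M (fun t M' =>
    [/\ input_kept M', slots_ok n (sideM M'), all_scanned M M',
        forall i' s', (i', s') != (i, s) -> stops n (sideM M i' s') (sideM M i' (~~ s')) ->
          stops n (sideM M' i' s') (sideM M' i' (~~ s'))
      & stops n (sideM M' i s) (sideM M' i (~~ s)) /\ t + 10 * Phi M' <= (10 * Phi M).+1]).
Proof.
move=> inp ok.
have stat := statics_side n_gt0 (sideM_statics M) i s.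
apply: runs_weaken (scan_run inp (slot_ok_side i s ok) stat) _.
move=> t M' [inp' oth sc [ok' st'] le_t].
have scs : all_scanned M M'.
  move=> i' s'; have [[-> ->] // | ne] := eqVneq (i', s') (i, s).
  by rewrite oth.
have qE : sideM M' i (~~ s) = sideM M i (~~ s) by rewrite oth ?neq_side.
split => //.
- have ok2 : side_ok (sideM M' i s) (sideM M' i (~~ s)) by rewrite qE.
  move=> i'; have [-> | ne] := eqVneq i' i.
    by case: (s) ok2 => //; apply: slot_ok_swap.
  by rewrite !oth ?xpair_eqE ?(negbTE ne).
- move=> i' s' ne st; rewrite oth //; apply: stops_scanned st; exact: scs.
split; first by rewrite qE.
have cE s' : M' (cntA s') 0 = M (cntA s') 0 by have := sc_cnt (scs false s').
have bE s' : M' (baseA s') 0 = M (baseA s') 0 by have := sc_base (scs false s').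
rewrite /Phi !cE !bE.
have potE i' s' : (i', s') != (i, s) -> pots M' i' s' = pots M i' s' by move=> ne; rewrite /pots oth.
rewrite -!/(pots _ _ _) in le_t.
case: (i) (s) potE le_t => [] [] potE le_t.
- by have := potE true false isT; have := potE false true isT; have := potE false false isT; lia.
- by have := potE true true isT; have := potE false true isT; have := potE false false isT; lia.
- by have := potE true false isT; have := potE true true isT; have := potE false false isT; lia.
by have := potE true false isT; have := potE false true isT; have := potE true true isT; lia.
Qed.

Lemma scan_all_run M : input_kept M -> slots_ok n (sideM M) ->
  runs scan_all M (fun t M' =>
    [/\ input_kept M', slots_ok n (sideM M'), slots_stop n (sideM M'), all_scanned M M'
      & t + 10 * Phi M' <= 10 * Phi M + 4]).
Proof.
move=> inp ok; do ![apply: runs_seq].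
apply: runs_weaken (scan_step false false inp ok) _ => t1 M1 [inp1 ok1 sc1 _ [st1 le1]].
apply: runs_seq.
apply: runs_weaken (scan_step false true inp1 ok1) _ => t2 M2 [inp2 ok2 sc2 k2 [st2 le2]].
apply: runs_seq.
apply: runs_weaken (scan_step true false inp2 ok2) _ => t3 M3 [inp3 ok3 sc3 k3 [st3 le3]].
apply: runs_weaken (scan_step true true inp3 ok3) _ => t4 M4 [inp4 ok4 sc4 k4 [st4 le4]].
split => //.
- move=> [] [] //.
  + by apply: k4.
  + by apply: k4 => //; apply: k3.
  by apply: k4 => //; apply: k3 => //; apply: k2.
- exact: all_scanned_trans sc1 (all_scanned_trans sc2 (all_scanned_trans sc3 sc4)).
lia.
Qed.

Definition set_base p v :=
  Side (cnt p) v (off p) (ptr p) (hit p) (kept p) (len p) (bound p) (col p).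
Definition set_off p v :=
  Side (cnt p) (base p) v (ptr p) (hit p) (kept p) (len p) (bound p) (col p).

Lemma copy_run M i s : input_kept M -> M (baseA s) 0 <= M (cntA s) 0 ->
  runs (copy i s) M (fun t M' =>
    [/\ input_kept M', forall i', sideM M' i' (~~ s) = sideM M i' (~~ s),
        sideM M' i s = set_base (sideM M i s) (M (cntA s) 0),
        exists2 o, sideM M' (~~ i) s = set_off (set_base (sideM M (~~ i) s) (M (cntA s) 0)) o
          & forall j, o j = if M (baseA s) 0 < j <= M (cntA s) 0
                            then n.+2 - (M (offA i s) j + lenS s j) else M (offA (~~ i) s) j
      & t <= (4 * (M (cntA s) 0 - M (baseA s) 0)).+1]).
Proof.
move=> inp le_bc.
pose I M1 := [/\ input_kept M1, forall i', sideM M1 i' (~~ s) = sideM M i' (~~ s),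
  M (baseA s) 0 <= M1 (baseA s) 0 <= M (cntA s) 0,
  sideM M1 i s = set_base (sideM M i s) (M1 (baseA s) 0)
  & exists2 o, sideM M1 (~~ i) s = set_off (set_base (sideM M (~~ i) s) (M1 (baseA s) 0)) o
      & forall j, o j = if M (baseA s) 0 < j <= M1 (baseA s) 0
                  then n.+2 - (M (offA i s) j + lenS s j) else M (offA (~~ i) s) j].
pose phi M1 := 4 * (M (cntA s) 0 - M1 (baseA s) 0).
have cntE M1 : I M1 -> M1 (cntA s) 0 = M (cntA s) 0.
  by case=> _ _ _ e _; have := f_equal cnt e.
have body M1 : I M1 -> holds M1 (Leq (succ_e (var (baseA s))) (var (cntA s))) ->
    runs (Seq (set_var (baseA s) (succ_e (var (baseA s))))
         (Store (offA (~~ i) s) (var (baseA s))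
            (Minus (Plus cols_e (Const 2))
                   (Plus (Fetch (offA i s) (var (baseA s))) (len_e s (var (baseA s)))))))
      M1 (fun t M2 => I M2 /\ t + phi M2 < phi M1).
  move=> IM1; rewrite /= (cntE _ IM1) addn1 => lt_b.
  have [inp1 oth1 b1 e1 [o e2 oE]] := IM1.
  have offE : M1 (offA i s) = M (offA i s) by have := f_equal off e1.
  apply: runs_seq; apply: runs_store; apply: runs_store.
  rewrite /= addn1; set b := M1 (baseA s) 0 in lt_b b1 e1 e2 oE *.
  set M2 := update M1 _ _ _.
  have inp2 : input_kept M2 by apply: input_update => //; case: (s).
  rewrite eval_len // (eval_cols inp2) addn2 /=.
  have -> : M2 (offA i s) = M (offA i s).
    by rewrite -offE /M2; case: (i) (s) => [] [].
  have -> : M2 (baseA s) 0 = b.+1 by rewrite /M2; case: (s).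
  set v := n.+2 - _; set M3 := update M2 _ _ _.
  have bE : M3 (baseA s) 0 = b.+1 by rewrite /M3 /M2; case: (i) (s) => [] [].
  split; last by rewrite /phi bE -/b; lia.
  split; rewrite ?bE.
  - by apply: input_update => //; case: (i) (s) => [] [].
  - by move=> i'; rewrite -oth1 /M3 /M2; case: (i) (s) (i') => [] [] [].
  - by lia.
  - rewrite -[RHS]/(set_base (set_base (sideM M i s) b) b.+1) -e1.
    by rewrite /M3 /M2; case: (i) (s) => [] [].
  exists (fun j => if j == b.+1 then v else o j).
    rewrite -[RHS]/(set_off (set_base (set_off (set_base (sideM M (~~ i) s) b) o) b.+1)
                      (fun j => if j == b.+1 then v else o j)).
    have -> : o = off (sideM M1 (~~ i) s) by rewrite e2.
    have -> : set_off (set_base (sideM M (~~ i) s) b) (off (sideM M1 (~~ i) s))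
            = sideM M1 (~~ i) s by rewrite e2.
    by rewrite /M3 /M2; case: (i) (s) => [] [].
  move=> j; case: eqP => [-> | /eqP ne].
    by rewrite ifT //; lia.
  rewrite oE (_ : (_ < j <= b.+1) = (M (baseA s) 0 < j <= b)) //; lia.
have IM : I M.
  split => //; first by rewrite leqnn.
  exists (M (offA (~~ i) s)) => // j.
  by case: ifP => //; lia.
apply: runs_weaken (runs_while body IM) _ => t M' [IM' gM' le_t].
have [inp' oth' b' e1 e2] := IM'.
have bE : M' (baseA s) 0 = M (cntA s) 0.
  by move: gM'; rewrite /= (cntE _ IM') addn1 -leqNgt; lia.
rewrite bE in e1 e2; split => //.
by move: le_t; rewrite /phi bE subnn; lia.
Qed.

Lemma reset_run M i : input_kept M ->
  runs (reset i) M (fun t M' =>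
    [/\ input_kept M',
        forall s, sideM M' i s
          = set_kept (set_hit (sideM M i s) (M (cntA (~~ s)) 0)) (M (cntA s) 0),
        forall s, sideM M' (~~ i) s
          = set_kept (set_hit (set_ptr (sideM M (~~ i) s) (M (ptrA i (~~ s)) 0))
              (M (cntA (~~ s)) 0)) (M (cntA s) 0)
      & t = 10]).
Proof.
move=> inp; rewrite /reset /settle_side.
do 2![apply: runs_seq; apply: runs_store].
do 3![apply: runs_seq; apply: runs_seq; do 2!apply: runs_store].
apply: runs_seq; do 2!apply: runs_store.
split; last by [].
- by do 10!(apply: input_update; first by case: (i)); exact: inp.
- by case: (i) => [] [].
by case: (i) => [] [].
Qed.

End View.

(** * Restarts and their cost *)

Section Settle.

Variables (m n : nat) (r : m.-tuple nat) (c : n.-tuple nat) (k : nat).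
Hypothesis rc : reconstruction_input r c.
Hypothesis rk : full_row n r k.

Local Notation sideM := (sideM r c k).
Local Notation lenS := (lenS r k).
Local Notation boundS := (boundS m k).
Local Notation input_kept := (input_kept r c k).

(** Rows placed before the last restart are reflected already, so each row is copied only once
    during restarts. *)
Definition mirrored (M : memory) : Prop := forall s j, j <= M (baseA s) 0 ->
  M (offA false s) j + M (offA true s) j + lenS s j = n.+2.

Lemma mirrored_side M i s j : mirrored M -> j <= M (baseA s) 0 ->
  M (offA (~~ i) s) j + M (offA i s) j + lenS s j = n.+2.
Proof. by move=> mi jb; rewrite -(mi s j jb); case: i => //=; lia. Qed.

Definition to_copy (M : memory) (s : bool) : nat := M (cntA s) 0 - M (baseA s) 0.

Lemma copied_off M i s o : mirrored M -> chain (lenS s) (M (offA i s)) (M (cntA s) 0) ->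
  (forall j, o j = if M (baseA s) 0 < j <= M (cntA s) 0
                   then n.+2 - (M (offA i s) j + lenS s j) else M (offA (~~ i) s) j) ->
  forall j, j <= M (cntA s) 0 -> o j + M (offA i s) j + lenS s j = n.+2.
Proof.
move=> mi xc oE j jc; rewrite oE; case: ifP => jb; last first.
  by apply: (mirrored_side i mi); lia.
have l0 : lenS s 0 = n by case: (s); [apply: (below0 rk) | apply: (above0 rk)].
by have := chain_in l0 xc jc; lia.
Qed.

(** Stated for an arbitrary continuation, because [reset] follows in a restart and [emit] at the
    end. *)
Lemma copy_both M i : input_kept M -> mirrored M ->
  (forall s, M (baseA s) 0 <= M (cntA s) 0) ->
  (forall s, chain (lenS s) (M (offA i s)) (M (cntA s) 0)) ->
  forall S (Q : nat -> memory -> Prop),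
  (forall t M', input_kept M' ->
     (forall s, sideM M' i s = set_base (sideM M i s) (M (cntA s) 0)) ->
     (forall s, exists2 o, sideM M' (~~ i) s = set_off (set_base (sideM M (~~ i) s) (M (cntA s) 0)) o
        & forall j, j <= M (cntA s) 0 -> o j + M (offA i s) j + lenS s j = n.+2) ->
     t <= 4 * (to_copy M false + to_copy M true) + 2 ->
     runs S M' (fun t' => Q (t + t'))) ->
  runs (Seq (copy i false) (Seq (copy i true) S)) M Q.
Proof.
move=> inp mi le_bc xc S Q post; apply: runs_seq.
apply: runs_weaken (copy_run i inp (le_bc false)) _.
move=> t1 M1 [inp1 oth1 e1 [o1 f1 oE1] le1]; apply: runs_seq.
have c1 : M1 (cntA true) 0 = M (cntA true) 0 by have := f_equal cnt (oth1 false).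
have b1 : M1 (baseA true) 0 = M (baseA true) 0 by have := f_equal base (oth1 false).
have x1 i' : M1 (offA i' true) = M (offA i' true) by have := f_equal off (oth1 i').
apply: runs_weaken (copy_run i (s := true) inp1 _) _; first by rewrite c1 b1.
move=> t2 M2 [inp2 oth2 e2 [o2 f2 oE2] le2].
rewrite c1 in e2 f2.
have := post (t1 + t2) M2 inp2; rewrite /to_copy => H.
apply: runs_weaken (H _ _ _) _.
- by case=> /=; [rewrite e2 (oth1 i) | rewrite (oth2 i) e1].
- case=> /=; [exists o2 | exists o1].
  + by rewrite f2 (oth1 (~~ i)).
  + apply: (@copied_off M i true) => // j; rewrite oE2 c1 b1 !x1.
    by [].
  + by rewrite (oth2 (~~ i)).
  exact: (@copied_off M i false).
- by rewrite c1 b1 in le2; lia.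
by move=> t3 M3; rewrite addnA.
Qed.

Lemma commit_run M i : input_kept M -> slots_ok n (sideM M) -> mirrored M ->
  ripe n (sideM M i false) (sideM M i true) ->
  runs (commit i) M (fun t M' =>
    [/\ input_kept M', forall s, sideM M' i s = settle (sideM M i s) (sideM M i (~~ s)),
        forall s, reflects n (sideM M i s) (sideM M i (~~ s)) (sideM M' (~~ i) s)
      & t <= 4 * (to_copy M false + to_copy M true) + 12]).
Proof.
move=> inp ok mi rp; have [h1 h2] := ripe_alive (n_gt0 rc rk) (ok i) rp.
have le_bc s : M (baseA s) 0 <= M (cntA s) 0.
  have := bounds_p (slot_ok_side false s ok); rewrite /bounds /=; lia.
apply: copy_both => //; first by case; [case: h2 | case: h1].
move=> t1 M1 inp1 e1 f1 le1; apply: runs_weaken (reset_run i inp1) _.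
move=> t2 M2 [inp2 e2 f2 ->].
have cE s : M1 (cntA s) 0 = M (cntA s) 0 by have := f_equal cnt (e1 s).
have pE s : M1 (ptrA i s) 0 = M (ptrA i s) 0 by have := f_equal ptr (e1 s).
split => //; last lia.
  by move=> s; rewrite e2 !cE e1.
move=> s; rewrite f2 !cE pE; have [o -> oE] := f1 s; split => //=.
by rewrite /colS; case: (i) (s) => [] [].
Qed.

Definition solvable : Prop := exists X Y,
  packing n (lenS false) (lenS true) (boundS false) (boundS true) (entry c) X Y.

Lemma solvable_packing i : solvable -> exists X Y,
  packing n (lenS false) (lenS true) (boundS false) (boundS true) (colS c i false) X Y.
Proof.
move=> [X [Y XY]]; case: i; last by exists X, Y.
exists (mirror n (lenS false) X), (mirror n (lenS true) Y).
have [p0 q0 _ _ _] := sideM_statics rc rk (fun _ _ => 0) false.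
exact: (packing_mirror p0 q0 _ XY).
Qed.

(** Being conditional on solvability, the invariant serves both outcomes: if all rows are placed and
    no run is complete, it refutes solvability. *)
Definition some_agreement (M : memory) : Prop := solvable -> some_agrees n (sideM M).

Record ready (M : memory) : Prop := Ready {
  ready_input : input_kept M;
  ready_ok : slots_ok n (sideM M);
  ready_stop : slots_stop n (sideM M);
  ready_committed : committed n (sideM M);
  ready_mirrored : mirrored M;
  ready_agree : some_agreement M }.

Lemma commit_ready M i t M' : slots_ok n (sideM M) -> mirrored M ->
  ripe n (sideM M i false) (sideM M i true) ->
  input_kept M' -> (forall s, sideM M' i s = settle (sideM M i s) (sideM M i (~~ s))) ->
  (forall s, reflects n (sideM M i s) (sideM M i (~~ s)) (sideM M' (~~ i) s)) ->
  t <= 4 * (to_copy M false + to_copy M true) + 12 ->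
  [/\ ready M', forall s, M' (cntA s) 0 = M (cntA s) 0
    & t + 10 * Phi r c k M' <= 10 * Phi r c k M + 12].
Proof.
move=> ok mi rp inp' eS eR le_t; have gt0 := n_gt0 rc rk.
have stat s := statics_side gt0 (sideM_statics rc rk M) i s.
have rps s : ripe n (sideM M i s) (sideM M i (~~ s)) by rewrite (ripe_side gt0).
have oks s := slot_ok_side i s ok.
have eR' s : reflects n (sideM M i (~~ s)) (sideM M i s) (sideM M' (~~ i) (~~ s)).
  by have := eR (~~ s); rewrite negbK.
have cE s : M' (cntA s) 0 = M (cntA s) 0 by have := f_equal cnt (eS s).
have bE s : M' (baseA s) 0 = M (cntA s) 0 by have := f_equal base (eS s).
split => //; first split => //.
- have two i' : i' = i \/ i' = ~~ i by case: (i') (i) => [] []; auto.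
  move=> i'; have [-> | ->] := two i'; first by rewrite !eS; apply: slot_ok_settle (stat false) (ok i) rp.
  exact: (slot_ok_reflect gt0 (stat false) (ok i) rp (eR false) (eR true)).
- have two i' : i' = i \/ i' = ~~ i by case: (i') (i) => [] []; auto.
  move=> i' s; have [-> | ->] := two i'.
    by rewrite !eS negbK; apply: stops_settle.
  exact: (stops_reflect gt0 (rps s) (eR s) (eR' s)).
- right=> i' s; have [-> | ->] : i' = i \/ i' = ~~ i by case: (i') (i) => [] []; auto.
    by rewrite !eS negbK; case: (eR s) => *; split.
  rewrite negbK eS; case: (eR s) (eR' s) => [a1 a2 a3 a4 a5 a6 a7 a8 a9] [b1 b2 b3 b4 b5 b6 b7 b8 b9].
  split => //; try by rewrite /= ?a1 ?b1.
  move=> j; rewrite a1 => jc; have := a9 j jc; rewrite a6 /=; lia.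
- move=> s j; rewrite bE => jc; have := offE (eR s) jc; have := f_equal off (eS s) => /= <-.
  by case: (i) => /=; lia.
(* The agreeing run may be the one overwritten; but since the other one is ripe, any solution can be
   changed into one that agrees with it. *)
- move=> sol; have [X [Y XY]] := solvable_packing i sol.
  have [X' [Y' ag]] := agrees_ripe gt0 (stat false) (ok i) XY rp.
  by exists i; rewrite !eS; exists X', Y'.
have pot_i s : pots r c k M' i s <= pots r c k M i s + to_copy M s.
  have := bounds_p (oks s); rewrite /pots /pot eS /bounds /to_copy /=.
  by move=> /and5P [? ? ? ? ?]; lia.
have pot_i' s : pots r c k M' (~~ i) s <= pots r c k M (~~ i) s + to_copy M s.
  have ok' := slot_ok_side (~~ i) s ok.
  have /and5P [k1 k2 k3 k4 k5] := bounds_p ok'; have lo := low_p ok'.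
  (* These two sides see the same end of the grid. Columns before the old pointer demand at most as
     many cells as there are placed rows, counting row k, by [low]; the column at the pointer of the
     ripe run demands more. *)
  have le_ptr : ptr (sideM M (~~ i) s) <= ptr (sideM M i (~~ s)).
    rewrite leqNgt; apply/negP => lt_ptr.
    have /and5P [_ _ _ _ /and3P [_ _ lt_col]] := rps s.
    have p_gt0 : 0 < ptr (sideM M i (~~ s)) by have /and5P [] := bounds_q (oks s).
    have := lo (ptr (sideM M i (~~ s))); rewrite p_gt0 => /(_ lt_ptr).
    have -> : col (sideM M (~~ i) s) = col (sideM M i (~~ s)).
      by rewrite /= /colS; case: (i) (s) => [] [].
    by move: lt_col => /=; lia.
  rewrite /pots /pot (ptrE (eR s)) (hitE (eR s)) (keptE (eR s)) /to_copy.
  by move: k1 k2 k3 le_ptr => /=; lia.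
have le_bc s : M (baseA s) 0 <= M (cntA s) 0 /\ M (cntA s) 0 <= boundS s.
  by have := bounds_p (slot_ok_side false s ok); rewrite /bounds /= => /and5P [? ? ? ? ?]; lia.
have := le_bc false; have := le_bc true; rewrite /Phi !cE !bE.
have := pot_i false; have := pot_i true; have := pot_i' false; have := pot_i' true.
by case: (i) le_t; rewrite /to_copy /=; lia.
Qed.

Lemma settle_run M : input_kept M -> slots_ok n (sideM M) -> mirrored M ->
  some_agreement M ->
  runs settle_all M (fun t M' =>
    [/\ ready M', forall s, M' (cntA s) 0 = M (cntA s) 0
      & t + 10 * Phi r c k M' <= 10 * Phi r c k M + 20]).
Proof.
move=> inp ok mi ag; apply: runs_seq.
apply: runs_weaken (scan_all_run rc rk inp ok) _ => t1 M1 [inp1 ok1 st1 sc1 le1].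
have cE s : M1 (cntA s) 0 = M (cntA s) 0 by have := sc_cnt (sc1 false s).
have mi1 : mirrored M1.
  move=> s j; have := sc_base (sc1 false s) => /= ->.
  have := sc_off (sc1 false s) => /= ->; have := sc_off (sc1 true s) => /= ->.
  exact: mi.
have ag1 : some_agreement M1.
  by move=> /ag [i agi]; exists i; apply: agrees_scanned agi.
have fin i : ripe n (sideM M1 i false) (sideM M1 i true) -> runs (commit i) M1 (fun t M' =>
    [/\ ready M', forall s, M' (cntA s) 0 = M (cntA s) 0
      & t + 10 * Phi r c k M' <= 10 * Phi r c k M1 + 12]).
  move=> rp; apply: runs_weaken (commit_run inp1 ok1 mi1 rp) _.
  move=> t M' [inp' eS eR le_t].
  by have [rd cE' le'] := commit_ready ok1 mi1 rp inp' eS eR le_t; split=> // s; rewrite cE'.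
apply: runs_if; rewrite (holds_ripe _ inp1); case: ifP => [rp | nrp0].
  by apply: runs_weaken (fin _ rp) _ => t M' [? ? ?]; split => //; lia.
apply: runs_if; rewrite (holds_ripe _ inp1); case: ifP => [rp | nrp1].
  by apply: runs_weaken (fin _ rp) _ => t M' [? ? ?]; split => //; lia.
apply: runs_skip; split => //; last lia.
split => //; left; case; first by rewrite nrp1.
by rewrite nrp0.
Qed.

End Settle.

(** * The main loop, the output and the total time *)

Definition main_loop : program :=
  While (Leq (Plus (succ_e (var (cntA false))) (succ_e (var (cntA true)))) rows_e)
    (Seq (If (Leq (len_e true (succ_e (var (cntA true)))) (len_e false (succ_e (var (cntA false)))))
            (add_row false) (add_row true))
         settle_all).

Definition emit : program :=
  Seq (set_var outA (Const 0))
  (Seq (While (Leq (succ_e (var outA)) rows_e)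
          (Seq (set_var outA (succ_e (var outA)))
          (If (Leq (var outA) (var kA))
             (Store 4 (var outA) (Fetch (offA false false) (Minus (var kA) (var outA))))
             (Store 4 (var outA)
                (Minus (Plus cols_e (Const 2))
                       (Plus (Fetch (offA false true) (Minus (var outA) (var kA)))
                             (len_e true (Minus (var outA) (var kA)))))))))
       (set_var 3 (Const 1))).

Definition done_g (i : bool) : guard :=
  And (Leq (Plus cols_e (Const 2)) (Plus (var (ptrA i false)) (var (ptrA i true))))
  (And (Leq (Fetch (offA i false) (var (cntA false))) cols_e)
       (Leq (Fetch (offA i true) (var (cntA true))) cols_e)).

Definition finish : program :=
  If (done_g false) emit
    (If (done_g true) (Seq (copy true false) (Seq (copy true true) emit)) Skip).

Definition init_side (i s : bool) : program :=
  Seq (Store (offA i s) (Const 0) (Const 1)) (set_var (ptrA i s) (Const 1)).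

Definition init : program :=
  Seq (init_side false false) (Seq (init_side false true)
  (Seq (init_side true false) (init_side true true))).

Definition find_row : program :=
  Seq (set_var kA (Const 1))
      (While (Neg (And (Leq cols_e (Fetch 1 (var kA))) (Leq (Fetch 1 (var kA)) cols_e)))
         (set_var kA (succ_e (var kA)))).

Definition reconstruct : program :=
  Seq find_row (Seq init (Seq settle_all (Seq main_loop finish))).

Lemma eq_packing n L R A B c x y x' y' :
  (forall i, i <= A -> x i = x' i) -> (forall i, i <= B -> y i = y' i) ->
  packing n L R A B c x y -> packing n L R A B c x' y'.
Proof.
move=> xx yy [xc yc cov]; split; [exact: eq_chain xx xc | exact: eq_chain yy yc |].
move=> j jn; rewrite -cov // /total (@eq_coverage _ x' x) => [|i ia].
  by rewrite (@eq_coverage _ y' y) // => i ia; rewrite yy //; lia.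
by rewrite xx //; lia.
Qed.

Section Main.

Variables (m n : nat) (r : m.-tuple nat) (c : n.-tuple nat).
Hypothesis rc : reconstruction_input r c.

Section Row.

Variable k : nat.
Hypothesis rk : full_row n r k.

Local Notation sideM := (sideM r c k).
Local Notation lenS := (lenS r k).
Local Notation boundS := (boundS m k).
Local Notation input_kept := (input_kept r c k).
Local Notation ready := (ready r c k).
Local Notation mirrored := (mirrored n r k).
Local Notation solvable := (solvable r c k).
Local Notation some_agreement := (some_agreement r c k).

Lemma place_run M i s : input_kept M ->
  runs (place i s) M (fun t M' =>
    [/\ input_kept M',
        sideM M' i s = set_kept (set_off (sideM M i s)
          (fun j => if j == (M (cntA s) 0).+1
                    then if fits n (sideM M i s) (sideM M i (~~ s)) then M (ptrA i s) 0 else n.+1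
                    else M (offA i s) j)) (M (keptA i s) 0).+1,
        other_sides r c k M M' i s & t = 3]).
Proof.
move=> inp; apply: runs_seq; apply: runs_if; rewrite (holds_fits _ inp).
pose v := if fits n (sideM M i s) (sideM M i (~~ s)) then M (ptrA i s) 0 else n.+1.
have [e [-> ev]] : exists e, (if fits n (sideM M i s) (sideM M i (~~ s))
      then Store (offA i s) (succ_e (var (cntA s))) (var (ptrA i s))
      else Store (offA i s) (succ_e (var (cntA s))) (succ_e cols_e))
    = Store (offA i s) (succ_e (var (cntA s))) e /\ eval M e = v.
  rewrite /v; case: ifP => _; first by exists (var (ptrA i s)).
  by exists (succ_e cols_e); rewrite /= (eval_cols inp) addn1.
apply: runs_store; apply: runs_store; rewrite ev [eval _ (Const _)]/=.
rewrite [eval M _]/= addn1; set M1 := update M _ _ _.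
have inp1 : input_kept M1 by apply: input_update => //; case: (i) (s) => [] [].
have kE : M1 (keptA i s) 0 = M (keptA i s) 0 by rewrite /M1; case: (i) (s) => [] [].
rewrite [eval M1 _]/= kE addn1; split => //.
- by apply: input_update => //; case: (i) (s) => [] [].
- by rewrite /M1 /v; case: (i) (s) => [] [].
by rewrite /M1; case: (i) (s) => [] [] [] [].
Qed.

Lemma add_row_run M s : input_kept M ->
  runs (add_row s) M (fun t M' =>
    [/\ input_kept M',
        forall i, sideM M' i s = extend n (sideM M i s) (sideM M i (~~ s)),
        forall i, sideM M' i (~~ s) = sideM M i (~~ s) & t = 7]).
Proof.
move=> inp; apply: runs_seq.
apply: runs_weaken (place_run false s inp) _ => t1 M1 [inp1 e1 o1 ->].
apply: runs_seq; apply: runs_weaken (place_run true s inp1) _ => t2 M2 [inp2 e2 o2 ->].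
have s1 : sideM M1 true s = sideM M true s by apply: o1; case: (s).
have q1 i : sideM M1 i (~~ s) = sideM M i (~~ s) by apply: o1; case: (i) (s) => [] [].
have s2 : sideM M2 false s = sideM M1 false s by apply: o2; case: (s).
have q2 i : sideM M2 i (~~ s) = sideM M1 i (~~ s) by apply: o2; case: (i) (s) => [] [].
apply: runs_store.
have c1 : M1 (cntA s) 0 = M (cntA s) 0 by have := f_equal cnt s1.
have c2 : M2 (cntA s) 0 = M (cntA s) 0.
  by have := f_equal cnt s2; have := f_equal cnt e1 => /= -> ->.
rewrite /= c2 addn1; split => //.
- by apply: input_update => //; case: (s).
- have setc i : sideM (update M2 (cntA s) 0 (M (cntA s) 0).+1) i s =
      Side (M (cntA s) 0).+1 (base (sideM M2 i s)) (off (sideM M2 i s)) (ptr (sideM M2 i s))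
        (hit (sideM M2 i s)) (kept (sideM M2 i s)) (lenS s) (boundS s) (colS c i s).
    by case: (i) (s) => [] [].
  have p1 : M1 (ptrA true s) 0 = M (ptrA true s) 0 by have := f_equal ptr s1.
  have k1 : M1 (keptA true s) 0 = M (keptA true s) 0 by have := f_equal kept s1.
  have x1 : M1 (offA true s) = M (offA true s) by have := f_equal off s1.
  by case; rewrite setc ?e2 ?s2 ?e1 ?s1 ?q1 ?c1 ?p1 ?k1 ?x1.
by move=> i; rewrite -q1 -q2; case: (i) (s) => [] [].
Qed.

Lemma row_step M s : ready M -> M (cntA s) 0 < boundS s ->
  lenS (~~ s) (M (cntA (~~ s)) 0).+1 <= lenS s (M (cntA s) 0).+1 ->
  runs (Seq (add_row s) settle_all) M (fun t M' => ready M' /\ t + 10 * Phi r c k M' + 10 <= 10 * Phi r c k M).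
Proof.
move=> [inp ok st cm mi ag] lt_cnt le_len; apply: runs_seq.
apply: runs_weaken (add_row_run s inp) _ => t1 M1 [inp1 e1 q1 ->].
have gt0 := n_gt0 rc rk.
have ok1 : slots_ok n (sideM M1).
  move=> i; have stat := statics_side gt0 (sideM_statics rc rk M) i s.
  have l1 : 0 < lenS s (M (cntA s) 0).+1 by case: stat => _ _ + _ _; apply => /=; lia.
  have := slot_ok_extend gt0 stat (slot_ok_side i s ok) lt_cnt l1.
  rewrite -e1 -q1; case: (s) => //; exact: slot_ok_swap.
have bc s' : M (baseA s') 0 <= M (cntA s') 0 /\ M (cntA s') 0 <= boundS s'.
  by have := bounds_p (slot_ok_side false s' ok); rewrite /bounds /= => /and5P [? ? ? ? ?]; lia.
have mi1 : mirrored M1.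
  have mi_q j : j <= M1 (baseA (~~ s)) 0 ->
      M1 (offA false (~~ s)) j + M1 (offA true (~~ s)) j + lenS (~~ s) j = n.+2.
    have := f_equal base (q1 false) => /= ->; have := f_equal off (q1 false) => /= ->.
    by have := f_equal off (q1 true) => /= ->; apply: mi.
  have mi_s j : j <= M1 (baseA s) 0 ->
      M1 (offA false s) j + M1 (offA true s) j + lenS s j = n.+2.
    have := f_equal base (e1 false) => /= ->; have := f_equal off (e1 false) => /= ->.
    have := f_equal off (e1 true) => /= -> jb; have [le_b _] := bc s.
    have -> : (j == (M (cntA s) 0).+1) = false by lia.
    exact: mi.
  by move=> s' j; case: (s) (s') mi_q mi_s => [] [] /= H1 H2; auto.
have ag1 : some_agreement M1.
  move=> /ag sag; have [i agi] := slots_extend gt0 (sideM_statics rc rk M) ok sag st cm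
    (fun=> lt_cnt) (fun=> le_len).
  exists i; move: agi; rewrite -e1 -q1.
  have stat1 := statics_side gt0 (sideM_statics rc rk M1) i s.
  by case: (s) stat1 => //= stat1; apply: agrees_swap.
apply: runs_weaken (settle_run rc rk inp1 ok1 mi1 ag1) _ => t M' [rd _ le_t].
split => //.
have cs : M1 (cntA s) 0 = (M (cntA s) 0).+1 by have := f_equal cnt (e1 false).
have cq : M1 (cntA (~~ s)) 0 = M (cntA (~~ s)) 0 by have := f_equal cnt (q1 false).
have bs : M1 (baseA s) 0 = M (baseA s) 0 by have := f_equal base (e1 false).
have bq : M1 (baseA (~~ s)) 0 = M (baseA (~~ s)) 0 by have := f_equal base (q1 false).
have ps i : pots r c k M1 i s = (pots r c k M i s).+1 by rewrite /pots e1 /pot /= addnS.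
have pq i : pots r c k M1 i (~~ s) = pots r c k M i (~~ s) by rewrite /pots q1.
have e : boundS s - M (cntA s) 0 = (boundS s - M1 (cntA s) 0).+1 by rewrite cs subnSK.
have le_Phi : Phi r c k M1 + 11 <= Phi r c k M.
  rewrite /Phi; case: (s) cq bs bq ps pq e => /= cq bs bq ps pq e.
    rewrite cq bs bq !ps !pq e; move: (_ - M 6 0) (_ - M1 7 0) (_ - M 8 0) (_ - M 9 0).
    by clear; lia.
  rewrite cq bs bq !ps !pq e; move: (_ - M1 6 0) (_ - M 7 0) (_ - M 8 0) (_ - M 9 0).
  by clear; lia.
by move: le_t le_Phi; clear; lia.
Qed.

Lemma ready_cnt M s : ready M -> M (cntA s) 0 <= boundS s.
Proof.
move=> [_ ok _ _ _ _].
by have := bounds_p (slot_ok_side false s ok); rewrite /bounds /= => /and5P [? ? ? ? ?]; lia.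
Qed.

Lemma main_loop_run M : ready M -> runs main_loop M (fun t M' =>
  [/\ ready M', forall s, M' (cntA s) 0 = boundS s & t + 10 * Phi r c k M' <= (10 * Phi r c k M).+1]).
Proof.
move=> rd; have [k1m _] := rk; have [kpos kb] := andP k1m.
have guard M1 : ready M1 ->
    holds M1 (Leq (Plus (succ_e (var (cntA false))) (succ_e (var (cntA true)))) rows_e)
    = (M1 (cntA false) 0 + M1 (cntA true) 0 + 2 <= m).
  by case=> [[[mE _ _ _] _] _ _ _ _ _]; rewrite /= mE; lia.
have body M1 : ready M1 ->
    holds M1 (Leq (Plus (succ_e (var (cntA false))) (succ_e (var (cntA true)))) rows_e) ->
    runs (Seq (If (Leq (len_e true (succ_e (var (cntA true)))) (len_e false (succ_e (var (cntA false)))))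
            (add_row false) (add_row true)) settle_all) M1
      (fun t M2 => ready M2 /\ t + 10 * Phi r c k M2 < 10 * Phi r c k M1).
  move=> rd1; rewrite guard // => lt_m; have inp1 := ready_input rd1.
  have b0 := ready_cnt false rd1; have b1 := ready_cnt true rd1.
  have pos s h : 1 <= h <= boundS s -> 0 < lenS s h.
    by case: s => hb; apply: (entry_gt0 rc); move: hb => /=; lia.
  (* Rows 0 and m + 1 have length 0, so an exhausted chain never wins the comparison of lengths
     while the other has rows left. *)
  have len0 s : lenS s (boundS s).+1 = 0.
    case: s => /=; last by rewrite /above prednK // subnn.
    by rewrite /below (_ : k + (m - k).+1 = m.+1) ?entry_last //; lia.
  have step s : M1 (cntA s) 0 < boundS s ->
      lenS (~~ s) (M1 (cntA (~~ s)) 0).+1 <= lenS s (M1 (cntA s) 0).+1 ->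
      runs (add_row s) M1 (fun t1 M2 => runs settle_all M2 (fun t2 M3 =>
         ready M3 /\ t1.+1 + t2 + 10 * Phi r c k M3 < 10 * Phi r c k M1)).
    move=> lt_cnt le_len; have [t [M2 [ex [rd2 le_t]]]] := row_step rd1 lt_cnt le_len.
    (* The conditional encloses [add_row] alone and costs one more step, so the execution obtained
       from [row_step] is cut at the sequence. *)
    inversion ex as [| |? ? ? M3 ? t1 t2 ex1 ex2| | |]; subst.
    exists t1, M3; split => //; exists t2, M2; split => //; split => //; lia.
  apply: runs_seq; apply: runs_if.
  have -> : holds M1 (Leq (len_e true (succ_e (var (cntA true))))
        (len_e false (succ_e (var (cntA false)))))
      = (lenS true (M1 (cntA true) 0).+1 <= lenS false (M1 (cntA false) 0).+1).
    by rewrite /= !(eval_len _ _ inp1) /= !addn1.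
  case: leqP => le_len.
    apply: step => //; rewrite ltn_neqAle b0 andbT; apply/eqP => e.
    move: le_len; rewrite e len0 leqNgt pos //.
    by move: lt_m; rewrite e /=; lia.
  apply: step; last exact: ltnW.
  rewrite ltn_neqAle b1 andbT; apply/eqP => e.
  by move: le_len; rewrite e len0.
apply: runs_weaken (runs_while body rd) _ => t M' [rd' gM' le_t]; split => //.
move: gM'; rewrite guard // -ltnNge; have := ready_cnt false rd'; have := ready_cnt true rd'.
by move=> /= b1 b0 lt; case=> /=; lia.
Qed.

Lemma emit_run M : input_kept M -> runs emit M (fun t M' =>
  [/\ M' 3 0 = 1,
      forall i, 1 <= i <= m -> M' 4 i = stack n r k (M (offA false false)) (M (offA false true)) i
    & t <= 5 * m + 5]).
Proof.
move=> inp; apply: runs_seq; apply: runs_store.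
set M0 := update M _ _ _.
have inp0 : input_kept M0 by apply: input_update.
pose I M1 := [/\ input_kept M1, M1 (offA false false) = M (offA false false),
  M1 (offA false true) = M (offA false true), M1 outA 0 <= m
  & forall i, 1 <= i <= M1 outA 0 ->
      M1 4 i = stack n r k (M (offA false false)) (M (offA false true)) i].
pose phi M1 := 5 * (m - M1 outA 0).
have IM0 : I M0.
  split => // i; rewrite (_ : M0 outA 0 = 0) //; lia.
have body M1 : I M1 -> holds M1 (Leq (succ_e (var outA)) rows_e) ->
    runs (Seq (set_var outA (succ_e (var outA)))
          (If (Leq (var outA) (var kA))
             (Store 4 (var outA) (Fetch (offA false false) (Minus (var kA) (var outA))))
             (Store 4 (var outA)
                (Minus (Plus cols_e (Const 2))
                       (Plus (Fetch (offA false true) (Minus (var outA) (var kA)))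
                             (len_e true (Minus (var outA) (var kA)))))))) M1
      (fun t M2 => I M2 /\ t + phi M2 < phi M1).
  move=> [inp1 x1 y1 zm out]; have [[mE nE kE _] _] := inp1.
  rewrite /= mE addn1 => lt_z; apply: runs_seq; apply: runs_store.
  rewrite [eval M1 (Const _)]/= [eval M1 _]/= addn1.
  set z := M1 outA 0 in zm out lt_z *; set M2 := update M1 _ _ _.
  have inp2 : input_kept M2 by apply: input_update.
  have [[mE2 nE2 kE2 _] _] := inp2.
  have zE : M2 outA 0 = z.+1 by [].
  pose v := stack n r k (M (offA false false)) (M (offA false true)) z.+1.
  have post t M3 : M3 = update M2 4 z.+1 v -> t <= 2 -> I M3 /\ 1 + t + phi M3 < phi M1.
    move=> -> t2; split; last by rewrite /phi (_ : update M2 _ _ _ outA 0 = z.+1) // -/z; lia.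
    split => //.
    move=> i iz; rewrite /update /=; case: eqP => [-> // | ne].
    by apply: out; move: iz; rewrite /= /update /= -/z; lia.
  apply: runs_if; rewrite /= kE2; case: ifP => le_k.
    apply: runs_store; apply: post => //; rewrite [eval M2 (var outA)]/= zE /v /stack.
    by congr update; rewrite /= kE2 le_k -x1.
  apply: runs_store; apply: post => //; rewrite [eval M2 (var outA)]/= zE /v /stack.
  congr update; rewrite [RHS]ifF //= (eval_cols inp2) (eval_len _ _ inp2) /= kE2 addn2.
  by rewrite /mirror -y1.
apply: runs_seq; apply: runs_weaken (runs_while body IM0) _ => t M1 [[inp1 x1 y1 zm out] gM1 le_t].
apply: runs_store; have [[mE _ _ _] _] := inp1.
have zE : M1 outA 0 = m by move: gM1; rewrite /= mE addn1 -ltnNge; lia.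
split => //; first by move=> i im; rewrite -out ?zE.
by move: le_t; rewrite /phi (_ : M0 outA 0 = 0) //; lia.
Qed.

Lemma holds_done M i : input_kept M -> holds M (done_g i) =
  [&& n.+2 <= M (ptrA i false) 0 + M (ptrA i true) 0,
      M (offA i false) (M (cntA false) 0) <= n & M (offA i true) (M (cntA true) 0) <= n].
Proof. by move=> inp; rewrite /= (eval_cols inp) addn2. Qed.

Lemma done_packing M i : ready M -> (forall s, M (cntA s) 0 = boundS s) ->
  holds M (done_g i) ->
  packing n (lenS false) (lenS true) (boundS false) (boundS true) (colS c i false)
    (M (offA i false)) (M (offA i true)).
Proof.
move=> [inp ok _ _ _ _] full; rewrite holds_done // => /and3P [d1 d2 d3].
exact: (slot_packing (sideM_statics rc rk M i) (ok i) (conj d2 d3) (full false) (full true) d1).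
Qed.

Lemma finish_run M : ready M -> (forall s, M (cntA s) 0 = boundS s) ->
  runs finish M (fun t M' => t <= 9 * m + 15 /\
    ((M' 3 0 = 1 /\ exists X Y,
        packing n (lenS false) (lenS true) (boundS false) (boundS true) (entry c) X Y /\
        forall i, 1 <= i <= m -> M' 4 i = stack n r k X Y i)
     \/ (M' 3 0 = 0 /\ ~ solvable))).
Proof.
move=> rd full; have [inp ok st _ mi ag] := rd; have [k1m _] := rk.
apply: runs_if; case: ifP => d0.
  apply: runs_weaken (emit_run inp) _ => t M' [M'3 M'4 le_t]; split; first lia.
  left; split => //; do 2!eexists; split; last exact: M'4.
  exact: (done_packing rd full d0).
apply: runs_if; case: ifP => d1.
  (* [emit] reads run false, so the reflection of run true is copied there first. *)
  have pk := done_packing rd full d1; have [xc yc _] := pk.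
  apply: (copy_both rk inp mi).
  - by move=> s; have := bounds_p (slot_ok_side false s ok); rewrite /bounds /= => /and5P [? ? ? ? ?]; lia.
  - by case; rewrite full.
  move=> t1 M1 inp1 e1 f1 le1; apply: runs_weaken (emit_run inp1) _.
  move=> t M' [M'3 M'4 le_t]; split.
    move: le1; rewrite /to_copy (full false) (full true) /=; lia.
  left; split => //; do 2!eexists; split; last exact: M'4.
  have [p0 q0 _ _ cpq] := sideM_statics rc rk M true.
  have cr_c j : 1 <= j <= n -> entry c j = colS c true false (n.+1 - j).
    by move=> jn; rewrite /colS /= subKn //; lia.
  apply: eq_packing (packing_mirror p0 q0 cr_c pk) => i ib.
    have [o eo oE] := f1 false; have -> : M1 (offA false false) = o by have := f_equal off eo.
    rewrite full in oE; have := oE i ib; have := mirrorK p0 xc ib => /=; lia.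
  have [o eo oE] := f1 true; have -> : M1 (offA false true) = o by have := f_equal off eo.
  rewrite full in oE; have := oE i ib; have := mirrorK q0 yc ib => /=; lia.
apply: runs_skip; split; first lia.
right; split; first by case: inp => _ [].
(* A run that agrees with a solution is alive and, with all rows placed and the scans at rest, has
   an empty window; its test would have succeeded. *)
move=> /ag [i agi].
have := agrees_end (n_gt0 rc rk) (sideM_statics rc rk M i) (ok i) agi (st i false) (full false) (full true).
have [a1 a2] := agrees_alive (n_gt0 rc rk) (sideM_statics rc rk M i) (ok i) agi.
move: d0 d1; rewrite !holds_done //; case: (i) a1 a2 => /= -> -> /=; rewrite !andbT; lia.
Qed.

Lemma init_run M : M kA 0 = k -> (forall a, a != kA -> M a = input_memory m n r c a) ->
  runs init M (fun t M' =>
    [/\ input_kept M',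
        forall i s, sideM M' i s = Side 0 0 (fun j => if j == 0 then 1 else 0) 1 0 0
                                        (lenS s) (boundS s) (colS c i s)
      & t = 8]).
Proof.
move=> kE ME; rewrite /init /init_side.
do 3![apply: runs_seq; apply: runs_seq; do 2!apply: runs_store].
apply: runs_seq; do 2!apply: runs_store.
split; last by [].
  do 8!(apply: input_update; first by []).
  by do ![split]; rewrite ?kE ?ME.
have cE s : M (cntA s) = fun=> 0 by rewrite ME; case: s.
have bE s : M (baseA s) = fun=> 0 by rewrite ME; case: s.
have hE i s : M (hitA i s) = fun=> 0 by rewrite ME; case: i s => [] [].
have wE i s : M (keptA i s) = fun=> 0 by rewrite ME; case: i s => [] [].
have oE i s : M (offA i s) = fun=> 0 by rewrite ME; case: i s => [] [].
have MS i s : Side (M (cntA s) 0) (M (baseA s) 0)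
    (fun j => if j == 0 then 1 else M (offA i s) j) 1 (M (hitA i s) 0) (M (keptA i s) 0)
    (lenS s) (boundS s) (colS c i s)
  = Side 0 0 (fun j => if j == 0 then 1 else 0) 1 0 0 (lenS s) (boundS s) (colS c i s).
  by rewrite cE bE hE wE oE.
by move=> i s; rewrite -MS; case: i s {MS} => [] [].
Qed.

Lemma init_ready M : input_kept M ->
  (forall i s, sideM M i s = Side 0 0 (fun j => if j == 0 then 1 else 0) 1 0 0
                                   (lenS s) (boundS s) (colS c i s)) ->
  [/\ slots_ok n (sideM M), mirrored M, some_agreement M & Phi r c k M <= 4 * n + 18 * m + 4].
Proof.
move=> inp SE; have l0 s : lenS s 0 = n by case: s; [apply: (below0 rk) | apply: (above0 rk)].
have hf i s s' : halves n (sideM M i s) (sideM M i s').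
  rewrite /halves !SE /=; split => //; [lia | |].
    by move=> j; rewrite leqn0 => /eqP ->; rewrite l0 /=; lia.
  by split=> [j|]; [lia | rewrite l0 /=; lia].
split.
- move=> i; have h1 := hf i false true; have h2 := hf i true false.
  by rewrite !SE in h1 h2 *; split => //= j /=; lia.
- move=> s j; have := f_equal base (SE false s) => /= ->; rewrite leqn0 => /eqP ->.
  have := f_equal off (SE false s) => /= ->; have := f_equal off (SE true s) => /= ->.
  by rewrite l0 /=; lia.
- move=> [X [Y XY]]; exists false, X, Y; have [[X0 _] [Y0 _] _] := XY.
  rewrite !SE /=; split => // j; rewrite leqn0 => /eqP ->; by [rewrite X0 | rewrite Y0].
have [k1m _] := rk.
(* The four pots add up to 4 (n + 1) + 2 (m - 1), the weighted terms to 16 (m - 1). *)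
rewrite /Phi /pots !SE /pot /=.
have := f_equal cnt (SE false false); have := f_equal cnt (SE false true).
have := f_equal base (SE false false); have := f_equal base (SE false true).
by rewrite /= => -> -> -> ->; lia.
Qed.

Lemma solvable_solution : solvable <-> exists t, solution r c k t.
Proof.
split=> [[X [Y XY]] | [t st]].
  by exists (stack n r k X Y); apply: (packing_solution rk XY).
by do 2!eexists; apply: (solution_packing rk st).
Qed.

Lemma search_run M : M kA 0 = k -> (forall a, a != kA -> M a = input_memory m n r c a) ->
  runs (Seq init (Seq settle_all (Seq main_loop finish))) M (fun t M' =>
    t <= 40 * n + 189 * m + 100 /\
    ((exists t, solution r c k t /\ output_of m M' = Some (vec t 1 m))
     \/ (output_of m M' = None /\ ~ exists t, solution r c k t))).
Proof.
move=> kE ME; apply: runs_seq; apply: runs_weaken (init_run kE ME) _.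
move=> t1 M1 [inp1 SE ->]; have [ok1 mi1 ag1 le_Phi] := init_ready inp1 SE.
apply: runs_seq; apply: runs_weaken (settle_run rc rk inp1 ok1 mi1 ag1) _.
move=> t2 M2 [rd2 _ le2].
apply: runs_seq; apply: runs_weaken (main_loop_run rd2) _ => t3 M3 [rd3 full3 le3].
(* Ten times the initial [Phi] gives 40 n + 180 m + 40, the output adds 9 m + 15, and the rest is
   constant. *)
apply: runs_weaken (finish_run rd3 full3) _ => t4 M4 [le4 out]; split; first lia.
case: out => [[M3E [X [Y [XY out]]]] | [M3E unsol]].
  left; exists (stack n r k X Y); split; first exact: (packing_solution rk XY).
  rewrite /output_of M3E /= /vec /rows /index_iota subn1; congr Some.
  by apply/eq_in_map => i; rewrite mem_iota => im; apply: out; lia.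
right; rewrite /output_of M3E; split => //.
by move/solvable_solution.
Qed.

Lemma algorithm2_none pick : choice_function pick -> ~ (exists t, solution r c k t) ->
  algorithm2 r c k pick = None.
Proof.
move=> pickP nosol; case E: (algorithm2 _ _ _ _) => [s|] //; case: nosol.
have /and3P [_ hv real] := algorithm2_full pickP E.
exact: realization_solution rc rk _ hv real.
Qed.

End Row.

(** Row k guarantees that the search halts; the row found is the first full one and may differ from
    it. *)
Lemma find_row_run k : full_row n r k ->
  runs find_row (input_memory m n r c) (fun t M' =>
    [/\ full_row n r (M' kA 0), forall a, a != kA -> M' a = input_memory m n r c a
      & t <= 3 * m + 3]).
Proof.
move=> [k1m rkn]; apply: runs_seq; apply: runs_store; set M1 := update _ _ _ _.
pose I M := 1 <= M kA 0 <= k /\ forall a, a != kA -> M a = input_memory m n r c a.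
have guard M : I M -> holds M (Neg (And (Leq cols_e (Fetch 1 (var kA))) (Leq (Fetch 1 (var kA)) cols_e)))
    = (entry r (M kA 0) != n).
  move=> [_ ME]; have eN : eval M cols_e = n by rewrite -[LHS]/(M 0 1) ME.
  by rewrite /= eN ME //= -eqn_leq eq_sym.
have body M : I M -> holds M (Neg (And (Leq cols_e (Fetch 1 (var kA))) (Leq (Fetch 1 (var kA)) cols_e))) ->
    runs (set_var kA (succ_e (var kA))) M (fun t M2 => I M2 /\ t + 3 * (k - M2 kA 0) < 3 * (k - M kA 0)).
  move=> IM; rewrite guard // => /eqP ne; have [kb ME] := IM; apply: runs_store.
  rewrite [eval M (Const _)]/= [eval M _]/= addn1.
  have lt_k : M kA 0 < k by rewrite ltn_neqAle; case: eqP ne => [-> | _ _] //=; lia.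
  have kE : update M kA 0 (M kA 0).+1 kA 0 = (M kA 0).+1 by [].
  split; last by rewrite kE; lia.
  split; first by rewrite kE; lia.
  by move=> a ne_a; rewrite -ME // /update (negbTE ne_a).
have I1 : I M1.
  split; first by rewrite (_ : M1 kA 0 = 1) //; lia.
  by move=> a ne_a; rewrite /M1 /update (negbTE ne_a).
apply: runs_weaken (runs_while body I1) _ => t M' [IM' gM' le_t].
have [kb ME] := IM'; split => //; last by move: le_t; rewrite (_ : M1 kA 0 = 1) //; lia.
by split; [lia | move: gM'; rewrite guard // negbK => /eqP].
Qed.

Lemma reconstruct_run : (exists k, full_row n r k) ->
  runs reconstruct (input_memory m n r c) (fun t M =>
    t <= 300 * (m + n) /\ exists k pick,
      [/\ full_row n r k, choice_function pick & output_of m M = algorithm2 r c k pick]).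
Proof.
move=> [k0 rk0]; apply: runs_seq; apply: runs_weaken (find_row_run rk0) _.
move=> t1 M1 [rk ME le1].
apply: runs_weaken (search_run rk erefl ME) _ => t2 M2 [le2 out].
split; first by have [] := rk; lia.
(* A computed solution is turned into choices under which Algorithm 2 outputs it; without solutions
   every choice function leads to failure. *)
exists (M1 kA 0); case: out => [[t [st ->]] | [-> nosol]].
  by have [pick [pickP E]] := algorithm2_vec rc rk st; exists pick.
exists (head [::]); split => //; first by case=> //= x s _; rewrite mem_head.
by rewrite algorithm2_none //; case=> //= x s _; rewrite mem_head.
Qed.

End Main.

Theorem theorem6 :
  (forall (m n : nat) (r : m.-tuple nat) (c : n.-tuple nat) (k : nat)
          (pick : seq (seq nat) -> seq nat),
     reconstruction_input r c -> full_row n r k -> choice_function pick ->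
     ((exists T : {set 'I_m * 'I_n}, hv_polyomino_realization r c T) ->
        exists t : seq nat,
          [/\ algorithm2 r c k pick = Some t,
              in_range n r 1 m t
            & hv_polyomino_realization r c (cells n r t)]) /\
     (~ (exists T : {set 'I_m * 'I_n}, hv_polyomino_realization r c T) ->
        algorithm2 r c k pick = None))
  /\
  (exists (S : program) (C : nat),
     forall (m n : nat) (r : m.-tuple nat) (c : n.-tuple nat),
       reconstruction_input r c -> (exists k : nat, full_row n r k) ->
       exists (steps : nat) (M : memory),
         [/\ exec S (input_memory m n r c) steps M,
             steps <= C * (m + n)
           & exists (k : nat) (pick : seq (seq nat) -> seq nat),
               [/\ full_row n r k, choice_function pick
                 & output_of m M = algorithm2 r c k pick]]).
Proof.
split=> [m n r c k pick rc rk pickP | ].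
  have hv_full s : algorithm2 r c k pick = Some s ->
      in_range n r 1 m s /\ hv_polyomino_realization r c (cells n r s).
    move=> /(algorithm2_full pickP) /and3P [s_in hv real]; split => //.
    by rewrite /hv_polyomino_realization hv real (polyomino_convex rk hv real).
  split=> [[T /and3P [_ hv real]] | noT].
    have [t st] := realization_solution rc rk hv real.
    have [s E] := algorithm2_some rc rk pickP st.
    by have [s_in s_hv] := hv_full s E; exists s.
  case E: (algorithm2 _ _ _ _) => [s|] //; case: noT.
  by have [_ s_hv] := hv_full s E; exists (cells n r s).
exists reconstruct, 300 => m n r c rc rk.
have [t [M [ex [le_t out]]]] := reconstruct_run rc rk.
by exists t, M.
Qed.
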